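(* Let $\varepsilon>0$ be given and assume $L\ge1$. Let Assumptions (A) and (B) of the context hold, and run the DEEPSTORM algorithm of the context with $$\alpha_k=\frac{\alpha}{K^{1/3}},\qquad\beta_k=\frac{144L^2\alpha^2}{NK^{2/3}}\qquad(k=0,\dots,K-1),\qquad \alpha=\frac{N^{2/3}}{64L}.$$ Let $\mathbf x_i^{(0)}=\mathbf x_j^{(0)}$ for all $i,j=1,\dots,N$, let the initial batch size be $m_0=\sqrt[3]{NK}$ for all $i=1,\dots,N$, and perform $T_0=\left\lceil\frac{-2\ln(1-\tilde\rho)}{\sqrt{1-\rho}}\right\rceil$ Chebyshev communications for the initial gradient tracking variable $\mathbf Y^{(0)}=\mathcal W_{T_0}(\mathbf D^{(0)})$. Let $\tilde{\mathbf v}_i^{(k+1)}$ be any unbiased gradient estimator such that either (v1) or (v2) holds, and let the local batch size be $m=\mathcal O(1)$ for all remaining iterations. Then, provided $K\ge\frac{N^2}{(1-\tilde\rho)^6}$, the algorithm produces a stochastic $\varepsilon$-stationary point in $$K=\mathcal O\left(\max\left\{\frac{(L\Delta)^{3/2}+\hat\sigma^3}{N\varepsilon^{3/2}},\ \frac{\hat\sigma^2}{(1-\tilde\rho)^2\varepsilon},\ \frac{\sqrt N\,\hat\sigma^{3/2}}{\varepsilon^{3/4}}\right\}\right)$$ local stochastic gradient computations and $T_0+T(K-1)$ neighbor communications, for any $T\ge1$, where $\Delta:=\Phi^{(0)}-\phi^*$ with $\Phi^{(0)}$ the initial Lyapunov value defined in the context.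
   Context: Problem. There are $N$ agents; vectors are rows in $\mathbb R^{1\times p}$. Agent $i$ has a smooth, possibly nonconvex function $f_i(\mathbf x)=\mathbb E_{\xi\sim\mathcal D_i}[f_i(\mathbf x;\xi)]$, and $r$ is a regularizer common to all agents. Let $\phi_i=f_i+r$, $f=\frac1N\sum_{i=1}^N f_i$, $\phi=\frac1N\sum_{i=1}^N\phi_i$. The agents minimize $\phi$ collaboratively, communicating only along the edges of a graph $\mathcal G=(\mathcal V,\mathcal E)$. Assumption (A). (i) $r$ is convex (possibly non-smooth) and admits an easily computable proximal mapping. (ii) There is $0<L<\infty$ with $\mathbb E_\xi\|\nabla f_i(\mathbf a;\xi)-\nabla f_i(\mathbf b;\xi)\|_2^2\le L^2\|\mathbf a-\mathbf b\|_2^2$ for all $\mathbf a,\mathbf b\in\mathbb R^{1\times p}$ and all $i$. (iii) There is $\sigma>0$ such that for all $\mathbf a\in\mathbb R^{1\times p}$ (and each $i$), $\mathbb E_\xi[\nabla f_i(\mathbf a;\xi)]=\nabla f_i(\mathbf a)$ and $\mathbb E\|\nabla f_i(\mathbf a;\xi)-\nabla f_i(\mathbf a)\|_2^2\le\sigma^2$. (iv) There is a constant $\phi^*$ with $-\infty<\phi^*\le\phi(\mathbf a)$ for all $\mathbf a\in\mathbb R^{1\times p}$. Assumption (B). $\mathcal G$ is connected and undirected and is represented by a mixing matrix $\mathbf W\in\mathbb R^{N\times N}$ such that: (i) $w_{ij}>0$ if $(i,j)\in\mathcal E$ and $w_{ij}=0$ otherwise; (ii) $\mathbf W=\mathbf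 W^\top$; (iii) $\mathrm{null}(\mathbf I-\mathbf W)=\mathrm{span}\{\mathbf e\}$, where $\mathbf e\in\mathbb R^N$ is the all-ones vector; (iv) the eigenvalues of $\mathbf W$ lie in $(-1,1]$ and $\rho:=\|\mathbf W-\frac1N\mathbf e\mathbf e^\top\|_2<1$. Mixing operator. $\mathcal W_T$ is a degree-$T$ polynomial in $\mathbf W$ satisfying (B)(ii)–(iv), given by Chebyshev acceleration: for an input $\mathbf B_0$, $\mathcal W_T(\mathbf B_0)=\mathbf B_T$, where $\mathbf B_1=\mathbf W\mathbf B_0$, $\mu_0=1$, $\mu_1=1/\rho$ and, for $1\le t\le T-1$, $\mu_{t+1}=\frac2\rho\mu_t-\mu_{t-1}$, $\mathbf B_{t+1}=\frac{2\mu_t}{\rho\mu_{t+1}}\mathbf W\mathbf B_t-\frac{\mu_{t-1}}{\mu_{t+1}}\mathbf B_{t-1}$. Thus $\mathcal W_1=\mathbf W$. Put $\tilde\rho:=\|\mathcal W_T-\frac1N\mathbf e\mathbf e^\top\|_2<1$. DEEPSTORM algorithm. Input: $\mathbf X^{(0)}\in\mathbb R^{N\times p}$, mixing rounds $T_0,T$, iteration number $K$, sequences $\{\alpha_k\},\{\beta_k\}$. Lower-case indexed vectors are rows of the corresponding matrices. Set $\mathbf d_i^{(0)}=\frac1{m_0}\sum_{\xi\in B_i^{(0)}}\nabla f_i(\mathbf x_i^{(0)};\xi)$ for all $i$ ($B_i^{(0)}$ a batch of $m_0$ samples) and $\mathbf Y^{(0)}=\mathcal W_{T_0}(\mathbf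 D^{(0)})$. For $k=0,\dots,K-1$: $\mathbf Z^{(k)}=\mathcal W_T(\mathbf X^{(k)})$; $\mathbf x_i^{(k+1)}=\mathrm{prox}_{\alpha_kr}(\mathbf z_i^{(k)}-\alpha_k\mathbf y_i^{(k)})$; $\mathbf d_i^{(k+1)}=(1-\beta_k)(\mathbf d_i^{(k)}+\mathbf v_i^{(k+1)}-\mathbf u_i^{(k+1)})+\beta_k\tilde{\mathbf v}_i^{(k+1)}$ with $\mathbf v_i^{(k+1)}=\frac1m\sum_{\xi\in B_i^{(k+1)}}\nabla f_i(\mathbf x_i^{(k+1)};\xi)$ and $\mathbf u_i^{(k+1)}=\frac1m\sum_{\xi\in B_i^{(k+1)}}\nabla f_i(\mathbf x_i^{(k)};\xi)$; $\mathbf Y^{(k+1)}=\mathcal W_T(\mathbf Y^{(k)}+\mathbf D^{(k+1)}-\mathbf D^{(k)})$. Here $B_i^{(k+1)}$ is a batch of $m$ samples at the current iteration; for all $k$ and all agents $i,j$, $B_i^{(k+1)}$ and $B_j^{(k+1)}$ contain independent and mutually independent random variables. Also $\mathrm{prox}_g(\mathbf v)=\arg\min_{\mathbf u}\{g(\mathbf u)+\frac12\|\mathbf u-\mathbf v\|_2^2\}$. Output: $\mathbf Z^{(\tau)}$ with $\tau$ chosen randomly from $\{0,\dots,K-1\}$ (uniformly, for the constant step size used here). Estimator $\tilde{\mathbf v}_i^{(k+1)}$: an unbiased estimate of $\nabla f_i(\mathbf x_i^{(k+1)})$ such that, for some $\hat\sigma>0$, either (v1) it is evaluated on another set of samples $\tilde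 B_i^{(k+1)}$, defined analogously to $B_i^{(k+1)}$, with $\tilde B_i^{(k+1)}$ independent of $B_i^{(k+1)}$ and $\mathbb E\|\tilde{\mathbf v}_i^{(k+1)}-\nabla f_i(\mathbf x_i^{(k+1)})\|_2^2\le\hat\sigma^2$; or (v2) $\tilde{\mathbf v}_i^{(k+1)}=\mathbf v_i^{(k+1)}$ with $\mathbb E\|\mathbf v_i^{(k+1)}-\nabla f_i(\mathbf x_i^{(k+1)})\|_2^2\le\hat\sigma^2$. Notation. $\bar{\mathbf A}=\frac1N\mathbf e\mathbf e^\top\mathbf A$, $\mathbf A_\perp=\mathbf A-\bar{\mathbf A}$; $\bar{\mathbf x}^{(k)}=\frac1N\sum_i\mathbf x_i^{(k)}$. $\mathbf r_i^{(k)}=\mathbf d_i^{(k)}-\nabla f_i(\mathbf x_i^{(k)})$, $\mathbf R^{(k)}$ is the matrix with rows $\mathbf r_i^{(k)}$, $\bar{\mathbf r}^{(k)}=\frac1N\sum_i\mathbf r_i^{(k)}$. Proximal gradient mapping: $P(\mathbf x,\mathbf y,\eta)=\frac1\eta(\mathbf x-\mathrm{prox}_{\eta r}(\mathbf x-\eta\mathbf y))$. A stochastic matrix (i.e. a random matrix) $\mathbf X\in\mathbb R^{N\times p}$ with rows $\mathbf x_i$ is a stochastic $\varepsilon$-stationary point if $\mathbb E\big[\frac1N\sum_{i=1}^N\|P(\mathbf x_i,\nabla f(\mathbf x_i),\eta)\|_2^2+\frac{L^2}N\|\mathbf X_\perp\|_F^2\big]\le\varepsilon$, where $\eta>0$.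 Initial Lyapunov value: $$\Phi^{(0)}=\phi(\bar{\mathbf x}^{(0)})+\gamma_1\|\mathbf Y_\perp^{(0)}\|_F^2+\gamma_2\|\mathbf X_\perp^{(0)}\|_F^2+\gamma_3\|\mathbf R^{(0)}\|_F^2+\gamma_4\|\bar{\mathbf r}^{(0)}\|_2^2,$$ with the strictly positive coefficients $\gamma_1=\frac{1}{NL(1-\tilde\rho)}$, $\gamma_2=\frac{16K^{1/3}}{N(1-\tilde\rho)\alpha}$, $\gamma_3=\frac{K^{1/3}}{48NL^2\alpha}$, $\gamma_4=\frac{NK^{1/3}}{48L^2\alpha}$. *)

(* Defs.v *)
(* MathComp / MathComp-Analysis, over an arbitrary [R : realType]. *)
From HB Require Import structures.
From mathcomp Require Export all_boot all_order all_algebra.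
From mathcomp Require Export all_classical all_reals all_analysis.

Set Implicit Arguments.
Unset Strict Implicit.
Unset Printing Implicit Defensive.

Export Order.TTheory GRing.Theory Num.Theory.
Export numFieldNormedType.Exports.

Local Open Scope classical_set_scope.
Local Open Scope ring_scope.

(* The library norm on matrices is the sup norm; [sqnorm] is ||.||_2^2 on row
   and column vectors and ||.||_F^2 on matrices. *)
Definition sqnorm (R : realType) m n (A : 'M[R]_(m, n)) : R :=
  \sum_i \sum_j A i j ^+ 2.

(* The spectral norm ||M||_2. *)
Definition opnorm (R : realType) m n (M : 'M[R]_(m, n)) : R :=
  sup [set Num.sqrt (sqnorm (M *m x)) | x in [set x : 'cV[R]_n | sqnorm x <= 1]].

(* (1/N) e e^T *)
Definition avgmx (R : realType) N : 'M[R]_N := const_mx N%:R^-1.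

Definition perp (R : realType) N p (A : 'M[R]_(N, p)) : 'M[R]_(N, p) :=
  A - avgmx R N *m A.

Definition mean_row (R : realType) N p (A : 'M[R]_(N, p)) : 'rV[R]_p :=
  N%:R^-1 *: \sum_i row i A.

Definition gradient (R : realType) p (g : 'rV[R]_p -> R) (x : 'rV[R]_p) :
    'rV[R]_p :=
  \row_j 'D_(delta_mx 0 j) (g : 'rV[R]_p -> R^o) x.

Definition is_prox (R : realType) p (g : 'rV[R]_p -> R) (v u : 'rV[R]_p) :=
  forall w, g u + 2^-1 * sqnorm (u - v) <= g w + 2^-1 * sqnorm (w - v).

Definition prox (R : realType) p (g : 'rV[R]_p -> R) (v : 'rV[R]_p) :
    'rV[R]_p :=
  xget 0 [set u | is_prox g v u].

Definition prox_grad_map (R : realType) p (r : 'rV[R]_p -> R)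
    (x y : 'rV[R]_p) (eta : R) : 'rV[R]_p :=
  eta^-1 *: (x - prox (fun u => eta * r u) (x - eta *: y)).

Section Network.
Context (R : realType) (N : nat).

(* Self-loops are allowed in [E]: w_ii > 0 exactly when (i, i) is an edge. *)
Record mixing_matrix (E : rel 'I_N) (W : 'M[R]_N) : Prop := {
  graph_undirected : symmetric E;
  graph_connected : forall i j, connect E i j;
  mixing_edge : forall i j, E i j -> 0 < W i j;
  mixing_nonedge : forall i j, ~~ E i j -> W i j = 0;
  mixing_sym : W = W^T;
  mixing_null : forall v : 'cV[R]_N,
    (1%:M - W) *m v = 0 <-> exists c : R, v = c *: const_mx 1;
  mixing_eigen : forall a, eigenvalue W a -> -1 < a <= 1;
  mixing_gap : opnorm (W - avgmx R N) < 1 }.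

Definition mix_rho (W : 'M[R]_N) : R := opnorm (W - avgmx R N).

Fixpoint cheb_mu (rho : R) (t : nat) : R :=
  match t with
  | 0 => 1
  | t1.+1 =>
      match t1 with
      | 0 => rho^-1
      | t2.+1 => 2 / rho * cheb_mu rho t1 - cheb_mu rho t2
      end
  end.

(* [cheb_mix W T B] is the Chebyshev-accelerated mixing W_T(B).  For rho = 0,
   that is W = (1/N) e e^T, the coefficients 1 / rho are meaningless; they are
   replaced by their limits 1 and 0 as rho tends to 0. *)
Fixpoint cheb_mix (W : 'M[R]_N) (t : nat) q (B : 'M[R]_(N, q)) : 'M[R]_(N, q) :=
  match t with
  | 0 => B
  | t1.+1 =>
      match t1 with
      | 0 => W *m B
      | t2.+1 =>
          let rho := mix_rho W in
          let mu := cheb_mu rho in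
          if rho == 0 then W *m cheb_mix W t1 B
          else (2 * mu t1 / (rho * mu t)) *: (W *m cheb_mix W t1 B)
               - (mu t2 / mu t) *: cheb_mix W t2 B
      end
  end.

(* The matrix of the linear operator W_T is its value at the identity. *)
Definition mix_rho_tilde (W : 'M[R]_N) (T : nat) : R :=
  opnorm (cheb_mix W T 1%:M - avgmx R N).

End Network.

Section Problem.
Context (R : realType) (N p : nat) (dX : measure_display)
  (Xi : measurableType dX).
Context (D : 'I_N -> probability Xi R) (F : 'I_N -> 'rV[R]_p -> Xi -> R)
  (r : 'rV[R]_p -> R).

Definition local_loss (i : 'I_N) (x : 'rV[R]_p) : R :=
  \int[D i]_xi F i x xi.

Definition avg_loss (x : 'rV[R]_p) : R := N%:R^-1 * \sum_i local_loss i x.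

Definition local_objective (i : 'I_N) (x : 'rV[R]_p) : R :=
  local_loss i x + r x.

Definition objective (x : 'rV[R]_p) : R :=
  N%:R^-1 * \sum_i local_objective i x.

Definition sgrad (i : 'I_N) (x : 'rV[R]_p) (xi : Xi) : 'rV[R]_p :=
  gradient (fun y => F i y xi) x.

Record problem_assumptions (L sigma phistar : R) : Prop := {
  sample_loss_integrable : forall i x,
    (D i).-integrable setT (EFin \o F i x);
  sample_loss_differentiable : forall i xi x,
    differentiable (fun y => F i y xi : R^o) x;
  local_loss_differentiable : forall i x,
    differentiable (local_loss i : 'rV[R]_p -> R^o) x;
  regularizer_convex :
    convex_function (setT : set (convex_lmodType 'rV[R]_p)) r;
  regularizer_prox : forall (eta : R) v, 0 < eta ->
    exists u, is_prox (fun x => eta * r x) v u;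
  smoothness_gt0 : 0 < L;
  mean_square_smooth : forall i a b,
    (\int[D i]_xi (sqnorm (sgrad i a xi - sgrad i b xi))%:E
       <= (L ^+ 2 * sqnorm (a - b))%:E)%E;
  noise_gt0 : 0 < sigma;
  sgrad_unbiased : forall i a j,
    (\int[D i]_xi (sgrad i a xi 0 j)%:E
       = (gradient (local_loss i) a 0 j)%:E)%E;
  sgrad_variance : forall i a,
    (\int[D i]_xi (sqnorm (sgrad i a xi - gradient (local_loss i) a))%:E
       <= (sigma ^+ 2)%:E)%E;
  objective_lower_bound : forall a, phistar <= objective a }.

Definition minibatch_grad (i : 'I_N) (s : seq Xi) (x : 'rV[R]_p) : 'rV[R]_p :=
  (size s)%:R^-1 *: \sum_(xi <- s) sgrad i x xi.

Definition stationarity_gap (L eta : R) (X : 'M[R]_(N, p)) : R :=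
  N%:R^-1 * \sum_i
    sqnorm (prox_grad_map r (row i X) (gradient avg_loss (row i X)) eta)
  + L ^+ 2 / N%:R * sqnorm (perp X).

Definition stochastic_stationary dO (Om : measurableType dO)
    (P : probability Om R) (L eta eps : R) (X : Om -> 'M[R]_(N, p)) : Prop :=
  0 < eta /\ ('E_P[stationarity_gap L eta \o X] <= eps%:E)%E.

End Problem.

(* Mutual independence of a finite family of classes of events. *)
Definition mutually_independent (R : realType) dO (Om : measurableType dO)
    (P : probability Om R) (I : finType) (Ev : I -> set (set Om)) : Prop :=
  forall (J : {set I}) (A : I -> set Om),
    (forall i, i \in J -> Ev i (A i)) ->
    P (\bigcap_(i in [set` J]) A i) = (\prod_(i in J) fine (P (A i)))%:E.

Definition sigma_of dO (Om : measurableType dO) dX (Xi : measurableType dX)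
    (X : Om -> Xi) : set (set Om) :=
  preimage_set_system [set: Om] X measurable.

Definition has_law (R : realType) dO (Om : measurableType dO)
    (P : probability Om R) dX (Xi : measurableType dX) (X : Om -> Xi)
    (mu : probability Xi R) : Prop :=
  forall A, measurable A -> P (X @^-1` A) = mu A.

Section Deepstorm.
Context (R : realType) (N p : nat) (dX : measure_display)
  (Xi : measurableType dX).
Context (dO : measure_display) (Om : measurableType dO) (P : probability Om R).
Context (m0 m : nat).

(* The two admissible estimators v~_i^(k+1).  [SeparateBatch G xit]: the value
   [G k i x s] of an arbitrary estimator at the current point x, on the batch
   s = (xit k i j)_j = B~_i^(k+1).  [SameBatch]: v~_i^(k+1) = v_i^(k+1). *)
Inductive estimator :=
| SeparateBatch
    (G : nat -> 'I_N -> 'rV[R]_p -> m.-tuple Xi -> 'rV[R]_p)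
    (xit : nat -> 'I_N -> 'I_m -> {RV P >-> Xi})
| SameBatch.

Context (D : 'I_N -> probability Xi R) (F : 'I_N -> 'rV[R]_p -> Xi -> R)
  (r : 'rV[R]_p -> R) (W : 'M[R]_N) (T0 T : nat) (alpha beta : nat -> R)
  (X0 : 'M[R]_(N, p)).
(* [xi0 i j] is the j-th sample of B_i^(0), [xi k i j] that of B_i^(k+1). *)
Context (xi0 : 'I_N -> 'I_m0 -> {RV P >-> Xi})
  (xi : nat -> 'I_N -> 'I_m -> {RV P >-> Xi}) (est : estimator).

Definition realize q (s : 'I_q -> {RV P >-> Xi}) (w : Om) : q.-tuple Xi :=
  [tuple s j w | j < q].

(* v~_i^(k+1) as a function of the point x_i^(k+1). *)
Definition estimate (k : nat) (i : 'I_N) (x : 'rV[R]_p) (w : Om) : 'rV[R]_p :=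
  match est with
  | SeparateBatch G xit => G k i x (realize (xit k i) w)
  | SameBatch => minibatch_grad F i (realize (xi k i) w) x
  end.

Definition estimate_cost : nat :=
  match est with SeparateBatch _ _ => m | SameBatch => 0 end.

(* State after k iterations.  [st_grads] counts the stochastic gradients
   evaluated by each agent, [st_comms] the exchanges with the neighbors
   (multiplications by W) needed to obtain st_Z and st_Y. *)
Record state := State {
  st_X : 'M[R]_(N, p); st_Z : 'M[R]_(N, p);
  st_D : 'M[R]_(N, p); st_Y : 'M[R]_(N, p);
  st_grads : nat; st_comms : nat }.

(* Only the T0 rounds for Y^(0) are counted: when the rows of X^(0) are equal,
   Z^(0) = X^(0) is available without communication. *)
Definition deepstorm_init (w : Om) : state :=
  let D0 := \matrix_(i < N)
              minibatch_grad F i (realize (xi0 i) w) (row i X0) in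
  {| st_X := X0; st_Z := cheb_mix W T X0;
     st_D := D0; st_Y := cheb_mix W T0 D0;
     st_grads := m0; st_comms := T0 |}.

(* Y^(k+1) = W_T(Y^(k) + D^(k+1) - D^(k)) and Z^(k+1) = W_T(X^(k+1)) are mixed
   together: each of the T exchanges carries both messages. *)
Definition deepstorm_step (w : Om) (k : nat) (s : state) : state :=
  let X' := \matrix_(i < N)
      prox (fun u => alpha k * r u)
           (row i (st_Z s) - alpha k *: row i (st_Y s)) in
  let V := \matrix_(i < N)
      minibatch_grad F i (realize (xi k i) w) (row i X') in
  let U := \matrix_(i < N)
      minibatch_grad F i (realize (xi k i) w) (row i (st_X s)) in
  let Vt := \matrix_(i < N) estimate k i (row i X') w in
  let D' := (1 - beta k) *: (st_D s + V - U) + beta k *: Vt in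
  {| st_X := X'; st_Z := cheb_mix W T X';
     st_D := D'; st_Y := cheb_mix W T (st_Y s + D' - st_D s);
     st_grads := st_grads s + (m + m + estimate_cost);
     st_comms := st_comms s + T |}.

Fixpoint deepstorm (w : Om) (k : nat) : state :=
  match k with
  | 0 => deepstorm_init w
  | k'.+1 => deepstorm_step w k' (deepstorm w k')
  end.

Definition estimator_assumptions (K : nat) (shat : R) : Prop :=
  match est with
  | SeparateBatch G xit =>
      [/\ forall k i l, (k < K)%N ->
            measurable_fun setT (fun q : p.-tuple R * m.-tuple Xi =>
              G k i (\row_(j < p) tnth q.1 j) q.2 0 l),
          forall k i j, (k < K)%N -> has_law P (xit k i j) (D i) &
          forall k i x l, (k < K)%N ->
            (\int[P]_w (G k i x (realize (xit k i) w) 0 l)%:E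
               = (gradient (local_loss D F i) x 0 l)%:E)%E]
  | SameBatch => True
  end /\
  forall k i, (k < K)%N ->
    (\int[P]_w (sqnorm
        (estimate k i (row i (st_X (deepstorm w k.+1))) w
         - gradient (local_loss D F i) (row i (st_X (deepstorm w k.+1)))))%:E
       <= (shat ^+ 2)%:E)%E.

(* tau and all the samples drawn in the batches B_i^(0), B_i^(k+1), and
   B~_i^(k+1) if there are such batches, are mutually independent. *)
Definition randomness_independent (K : nat) (tau : {RV P >-> nat}) : Prop :=
  mutually_independent P
    (fun s : unit + 'I_N * 'I_m0 + 'I_K * 'I_N * 'I_m + 'I_K * 'I_N * 'I_m =>
       match s with
       | inl (inl (inl _)) => sigma_of tau
       | inl (inl (inr (i, j))) => sigma_of (xi0 i j)
       | inl (inr (k, i, j)) => sigma_of (xi k i j)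
       | inr (k, i, j) =>
           match est with
           | SeparateBatch _ xit => sigma_of (xit k i j)
           | SameBatch => [set set0; [set: Om]]
           end
       end).

Definition samples_law (K : nat) : Prop :=
  (forall i j, has_law P (xi0 i j) (D i)) /\
  (forall k i j, (k < K)%N -> has_law P (xi k i j) (D i)).

Definition uniform_index (K : nat) (tau : {RV P >-> nat}) : Prop :=
  forall k, (k < K)%N -> P (tau @^-1` [set k]) = (K%:R^-1)%:E.

Definition residual (s : state) : 'M[R]_(N, p) :=
  \matrix_(i < N)
    (row i (st_D s) - gradient (local_loss D F i) (row i (st_X s))).

Definition lyapunov (g1 g2 g3 g4 : R) (s : state) : R :=
  objective D F r (mean_row (st_X s))
  + g1 * sqnorm (perp (st_Y s))
  + g2 * sqnorm (perp (st_X s))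
  + g3 * sqnorm (residual s)
  + g4 * sqnorm (mean_row (residual s)).

End Deepstorm.

Section Tuning.
Context (R : realType) (N K : nat) (L : R).

Definition cbrtK : R := K%:R `^ (3^-1).

Definition step_alpha : R := N%:R `^ (2 / 3) / (64 * L).

Definition step_size : R := step_alpha / cbrtK.

Definition momentum : R :=
  144 * L ^+ 2 * step_alpha ^+ 2 / (N%:R * K%:R `^ (2 / 3)).

Definition gamma1 (rhot : R) : R := (N%:R * L * (1 - rhot))^-1.
Definition gamma2 (rhot : R) : R :=
  16 * cbrtK / (N%:R * (1 - rhot) * step_alpha).
Definition gamma3 : R := cbrtK / (48 * N%:R * L ^+ 2 * step_alpha).
Definition gamma4 : R := N%:R * cbrtK / (48 * L ^+ 2 * step_alpha).

(* The cube root of N K, rounded up to an integer. *)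
Definition init_batch : nat := `|Num.ceil ((N * K)%:R `^ (3^-1) : R)|%N.

Definition init_rounds (rho rhot : R) : nat :=
  `|Num.ceil (- 2 * ln (1 - rhot) / Num.sqrt (1 - rho))|%N.

Definition complexity (rhot Delta shat eps : R) : R :=
  Num.max (((L * Delta) `^ (3 / 2) + shat ^+ 3) / (N%:R * eps `^ (3 / 2)))
  (Num.max (shat ^+ 2 / ((1 - rhot) ^+ 2 * eps))
           (Num.sqrt N%:R * shat `^ (3 / 2) / eps `^ (3 / 4))).

End Tuning.

(* Main.v *)
(** Put d = 1 - rho~, let a be the step size and P the proximal map.

    Lyapunov argument.  Testing the proximal inequality of every agent at the
    mean iterate, averaging (W_T preserves means, so the mean of Y is that of D)
    and using the smoothness of f gives, on every path,
      phi(mean X') + (a/8) gap(Z) <= phi(mean X) - |X' - X|^2 / (4aN)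
        + (5a/2) |mean R|^2 + (2/(aN)) |X_perp|^2 + (1/(8NL)) |Y_perp|^2.
    In mean, each of the four other terms of the Lyapunov function contracts:
    X_perp and Y_perp because W_T contracts by 1 - d, R and its mean by the
    factor 1 - beta, since R' = (1 - beta) R + noise, where the noise is
    orthogonal to everything drawn before, and its rows to each other.  For
    a L <= d^2/64 the coefficients gamma_i make all the terms but the gap cancel,
    up to a noise of order a^3 L^2 shat^2 / N^2 per step.  Summing over k, and
    averaging over the independent index tau,
      E gap <= (512 L Delta + 6 shat^2) / (N K)^(2/3),
    so the first term of the complexity is enough; K >= N^2/(1 - rho~)^6 is what
    ensures a L <= d^2/64.

    No spectral theorem is needed for rho~ < 1: the Chebyshev iterates are
    bounded through a Pell-type identity between the two kinds of Chebyshev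
    polynomials. *)

From HB Require Import structures.
Require Import Defs.
From mathcomp Require Import measurable_realfun.
From mathcomp Require Import ring lra.

Set Implicit Arguments.
Unset Strict Implicit.
Unset Printing Implicit Defensive.

Local Open Scope classical_set_scope.
Local Open Scope ring_scope.

(** * Matrices, averages and mixing *)

(** Conditional expectation is replaced by Fubini. What is known before a draw is modelled by [Om]
    itself under the smaller sigma-algebra generated by the earlier samples; the identity into that
    space is a random variable independent of the draw, so the pair has a product law and the draw
    can be integrated with the past frozen. The price is that the iterates must be shown measurable
    for these smaller sigma-algebras, although a sample loss is only assumed differentiable in the
    point and integrable, hence measurable, in the sample: gradients are therefore handled as limits
    of difference quotients of Caratheodory functions. The momentum b = 144 (a L)^2 / N is tied to
    the weights: b gamma_3 = 3 a / N^2 pays for the part of |R|^2 that the change of D feeds into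
    the tracking error, and b gamma_4 = 3 a pays for the 5 a / 2 that the descent inequality charges
    to |mean R|^2. *)

Lemma le_of_eq (R : realType) (x y : R) : x = y -> x <= y.
Proof. by move->. Qed.

(* [mxE] would also unfold the gradients in [A] and [B]. *)
Lemma mxBE (R : zmodType) m n (A B : 'M[R]_(m, n)) i j : (A - B) i j = A i j - B i j.
Proof. by rewrite !mxE. Qed.

Lemma rowB (R : zmodType) m n (A B : 'M[R]_(m, n)) i : row i (A - B) = row i A - row i B.
Proof. by apply/rowP => j; rewrite !mxE. Qed.

Lemma rowZ (R : pzRingType) m n c (A : 'M[R]_(m, n)) i : row i (c *: A) = c *: row i A.
Proof. by apply/rowP => j; rewrite !mxE. Qed.

(** * Frobenius inner product and quadratic inequalities *)

Section InnerProduct.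
Context (R : realType).

Definition dot m n (A B : 'M[R]_(m, n)) : R := \sum_i \sum_j A i j * B i j.

Lemma sqnormE m n (A : 'M[R]_(m, n)) : sqnorm A = dot A A.
Proof. by apply: eq_bigr => i _; apply: eq_bigr => j _; rewrite expr2. Qed.

Lemma dotC m n (A B : 'M[R]_(m, n)) : dot A B = dot B A.
Proof. by apply: eq_bigr => i _; apply: eq_bigr => j _; rewrite mulrC. Qed.

Lemma dotDl m n (A B C : 'M[R]_(m, n)) : dot (A + B) C = dot A C + dot B C.
Proof.
rewrite -big_split; apply: eq_bigr => i _; rewrite -big_split.
by apply: eq_bigr => j _; rewrite mxE mulrDl.
Qed.

Lemma dotDr m n (A B C : 'M[R]_(m, n)) : dot C (A + B) = dot C A + dot C B.
Proof. by rewrite !(dotC C) dotDl. Qed.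

Lemma dotZl m n c (A B : 'M[R]_(m, n)) : dot (c *: A) B = c * dot A B.
Proof.
rewrite mulr_sumr; apply: eq_bigr => i _; rewrite mulr_sumr.
by apply: eq_bigr => j _; rewrite mxE mulrA.
Qed.

Lemma dotZr m n c (A B : 'M[R]_(m, n)) : dot A (c *: B) = c * dot A B.
Proof. by rewrite dotC dotZl dotC. Qed.

Lemma dotNl m n (A B : 'M[R]_(m, n)) : dot (- A) B = - dot A B.
Proof. by rewrite -scaleN1r dotZl mulN1r. Qed.

Lemma dotNr m n (A B : 'M[R]_(m, n)) : dot A (- B) = - dot A B.
Proof. by rewrite dotC dotNl dotC. Qed.

Lemma dot0l m n (A : 'M[R]_(m, n)) : dot 0 A = 0.
Proof. by rewrite -[0](scale0r 0) dotZl mul0r. Qed.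

Definition dotE := (dotDl, dotDr, dotNl, dotNr, dotZl, dotZr).

Lemma dot_suml m n (I : Type) (s : seq I) (A : I -> 'M[R]_(m, n)) B :
  dot (\sum_(i <- s) A i) B = \sum_(i <- s) dot (A i) B.
Proof. by apply: (big_morph (fun x => dot x B)) => [x y|]; rewrite ?dotDl ?dot0l. Qed.

Lemma dot_tr m n (A B : 'M[R]_(m, n)) : dot A^T B^T = dot A B.
Proof.
rewrite /dot exchange_big; apply: eq_bigr => i _; apply: eq_bigr => j _.
by rewrite !mxE.
Qed.

Lemma dot_mxtrace m n (A B : 'M[R]_(m, n)) : dot A B = \tr (A *m B^T).
Proof.
by apply: eq_bigr => i _; rewrite mxE; apply: eq_bigr => j _; rewrite mxE.
Qed.

Lemma dot_mulmxl m n q (M : 'M[R]_(m, n)) (A : 'M[R]_(n, q)) B :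
  dot (M *m A) B = dot A (M^T *m B).
Proof. by rewrite !dot_mxtrace trmx_mul trmxK -mulmxA mxtrace_mulC mulmxA. Qed.

Lemma sqnorm_ge0 m n (A : 'M[R]_(m, n)) : 0 <= sqnorm A.
Proof. by do 2 (apply: sumr_ge0 => ? _); rewrite sqr_ge0. Qed.

Lemma sqnormD m n (A B : 'M[R]_(m, n)) :
  sqnorm (A + B) = sqnorm A + 2 * dot A B + sqnorm B.
Proof. by rewrite !sqnormE !dotE (dotC B A); ring. Qed.

Lemma sqnormB m n (A B : 'M[R]_(m, n)) :
  sqnorm (A - B) = sqnorm A - 2 * dot A B + sqnorm B.
Proof. by rewrite !sqnormE !dotE (dotC B A); ring. Qed.

Lemma sqnormZ m n c (A : 'M[R]_(m, n)) : sqnorm (c *: A) = c ^+ 2 * sqnorm A.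
Proof. by rewrite !sqnormE !dotE; ring. Qed.

Lemma sqnormN m n (A : 'M[R]_(m, n)) : sqnorm (- A) = sqnorm A.
Proof. by rewrite !sqnormE !dotE opprK. Qed.

Lemma sqnorm0 m n : sqnorm (0 : 'M[R]_(m, n)) = 0.
Proof. by rewrite sqnormE dot0l. Qed.

Lemma sqnorm_eq0 m n (A : 'M[R]_(m, n)) : sqnorm A = 0 -> A = 0.
Proof.
move=> A0; apply/matrixP => i j; rewrite mxE; apply/eqP; rewrite -sqrf_eq0.
move/eqP: A0; rewrite psumr_eq0 => [|k _]; last first.
  by apply: sumr_ge0 => ? _; rewrite sqr_ge0.
move/allP/(_ i (mem_index_enum _)) => /=; rewrite psumr_eq0 => [|k _]; last first.
  by rewrite sqr_ge0.
by move/allP/(_ j (mem_index_enum _)).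
Qed.

Lemma dot_young m n (A B : 'M[R]_(m, n)) s : 0 < s ->
  dot A B <= s / 2 * sqnorm A + (2 * s)^-1 * sqnorm B.
Proof.
move=> s0; have := sqnorm_ge0 (s *: A - B).
rewrite sqnormB sqnormZ dotZl => h.
have -> : s / 2 * sqnorm A + (2 * s)^-1 * sqnorm B =
  dot A B + (2 * s)^-1 * (s ^+ 2 * sqnorm A - 2 * (s * dot A B) + sqnorm B).
  by field; rewrite gt_eqF.
by rewrite lerDl mulr_ge0 // invr_ge0 mulr_ge0 // ltW.
Qed.

Lemma sqnormD_le m n (A B : 'M[R]_(m, n)) :
  sqnorm (A + B) <= 2 * sqnorm A + 2 * sqnorm B.
Proof. by have := sqnorm_ge0 (A - B); rewrite sqnormB sqnormD; lra. Qed.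

Lemma sqnormB_le m n (A B : 'M[R]_(m, n)) :
  sqnorm (A - B) <= 2 * sqnorm A + 2 * sqnorm B.
Proof. by rewrite -(sqnormN B) sqnormD_le. Qed.

Lemma sqnormD4_le m n (A B C E : 'M[R]_(m, n)) : sqnorm ((A + B) + (C + E)) <=
  4 * sqnorm A + 4 * sqnorm B + 4 * sqnorm C + 4 * sqnorm E.
Proof.
move: (sqnormD_le (A + B) (C + E)) (sqnormD_le A B) (sqnormD_le C E).
move: (sqnorm (A + B)) (sqnorm (C + E)) (sqnorm (A + B + (C + E))) => u v w.
by lra.
Qed.

(* Convexity of the square applied to d * (A / d) + (1 - d) * (B / (1 - d)). *)
Lemma sqnormD_conv m n (A B : 'M[R]_(m, n)) (d s t : R) : 0 < d <= 1 ->
  sqnorm A <= (1 - d) ^+ 2 * s -> sqnorm B <= t ->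
  sqnorm (A + B) <= (1 - d) * s + d^-1 * t.
Proof.
move=> /andP[d0 d1] As Bt; have d10 : 0 <= 1 - d by lra.
have [d1'|d1'] := eqVneq d 1.
  rewrite d1' subrr expr0n mul0r in As *.
  have /sqnorm_eq0 -> : sqnorm A = 0 by apply/eqP; rewrite eq_le As sqnorm_ge0.
  by rewrite !add0r invr1 mul1r.
have d11 : 0 < 1 - d by rewrite subr_gt0 lt_neqAle d1'.
have h := dot_young A B (divr_gt0 d0 d11).
rewrite sqnormD; apply: (@le_trans _ _ ((1 - d)^-1 * sqnorm A + d^-1 * sqnorm B)).
  have -> : (1 - d)^-1 * sqnorm A + d^-1 * sqnorm B = sqnorm A +
    2 * (d / (1 - d) / 2 * sqnorm A + (2 * (d / (1 - d)))^-1 * sqnorm B) + sqnorm B.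
    by field; rewrite !gt_eqF.
  by rewrite lerD2r lerD2l ler_pM2l.
apply: lerD; last by rewrite ler_pM2l // invr_gt0.
rewrite mulrC ler_pdivrMr //; apply: le_trans As _.
by rewrite expr2 [X in _ <= X]mulrAC.
Qed.

Lemma sqnorm_rows m n (A : 'M[R]_(m, n)) : sqnorm A = \sum_i sqnorm (row i A).
Proof.
apply: eq_bigr => i _; rewrite /sqnorm big_ord1.
by apply: eq_bigr => j _; rewrite mxE.
Qed.

Lemma dot_rows m n (A B : 'M[R]_(m, n)) :
  dot A B = \sum_i dot (row i A) (row i B).
Proof.
apply: eq_bigr => i _; rewrite /dot big_ord1.
by apply: eq_bigr => j _; rewrite !mxE.
Qed.

Lemma sqnorm_cols m n (A : 'M[R]_(m, n)) : sqnorm A = \sum_j sqnorm (col j A).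
Proof.
rewrite /sqnorm exchange_big; apply: eq_bigr => i _ /=.
by apply: eq_bigr => j _; rewrite big_ord1 mxE.
Qed.

(** The gap between the two sides is #|I| times the sum of the squared deviations of the [A i] from
    their mean. *)
Lemma sqnorm_sum_le m n (I : finType) (A : I -> 'M[R]_(m, n)) :
  sqnorm (\sum_i A i) <= #|I|%:R * \sum_i sqnorm (A i).
Proof.
have [I0|I0] := posnP #|I|.
  rewrite big1 ?sqnorm0 ?I0 ?mul0r // => i.
  by have := card0_eq I0 i; rewrite inE.
have c0 : (0 : R) < #|I|%:R by rewrite ltr0n.
set S := \sum_i A i.
have : 0 <= \sum_i sqnorm (A i - (#|I|%:R)^-1 *: S).
  by apply: sumr_ge0 => i _; exact: sqnorm_ge0.
under eq_bigr do rewrite sqnormB.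
rewrite big_split /= sumrB -mulr_sumr -dot_suml -/S sumr_const.
rewrite (_ : #|xpredT| = #|I|); last by apply: eq_card.
rewrite dotZr sqnormZ -sqnormE.
set X := (X in 0 <= X); have -> : X = \sum_i sqnorm (A i) - #|I|%:R^-1 * sqnorm S.
  by rewrite /X -[_ *+ _]mulr_natr; field; rewrite gt_eqF.
by rewrite subr_ge0 -ler_pdivlMl ?invr_gt0 // invrK.
Qed.

End InnerProduct.

(** * Averages over the agents *)

Section Average.
Context (R : realType) (N : nat).
Hypothesis N0 : (0 < N)%N.

Let N0R : (N%:R : R) != 0. Proof. by rewrite pnatr_eq0 -lt0n. Qed.

Lemma row_avgmx p (A : 'M[R]_(N, p)) i : row i (avgmx R N *m A) = mean_row A.
Proof.
apply/rowP => j; rewrite !mxE summxE mulr_sumr.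
by apply: eq_bigr => k _; rewrite !mxE.
Qed.

Lemma avgmx_idem : avgmx R N *m avgmx R N = avgmx R N.
Proof.
apply/matrixP => i j; rewrite !mxE.
under eq_bigr do rewrite !mxE.
by rewrite sumr_const cardT size_enum_ord -[_ *+ N]mulr_natr -mulrA mulVf // mulr1.
Qed.

Lemma avgmx_sym : (avgmx R N)^T = avgmx R N.
Proof. by rewrite trmx_const. Qed.

Lemma mean_rowE p (A : 'M[R]_(N, p)) j : mean_row A 0 j = N%:R^-1 * \sum_i A i j.
Proof. by rewrite mxE summxE; congr (_ * _); apply: eq_bigr => i _; rewrite mxE. Qed.

Lemma mean_rowD p (A B : 'M[R]_(N, p)) : mean_row (A + B) = mean_row A + mean_row B.
Proof.
apply/rowP => j; rewrite !mxE !summxE -mulrDr -big_split; congr (_ * _).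
by apply: eq_bigr => i _; rewrite !mxE.
Qed.

Lemma mean_rowZ p c (A : 'M[R]_(N, p)) : mean_row (c *: A) = c *: mean_row A.
Proof.
apply/rowP => j; rewrite !mxE !summxE mulrCA; congr (_ * _); rewrite mulr_sumr.
by apply: eq_bigr => i _; rewrite !mxE.
Qed.

Lemma mean_rowN p (A : 'M[R]_(N, p)) : mean_row (- A) = - mean_row A.
Proof. by rewrite -scaleN1r mean_rowZ scaleN1r. Qed.

Lemma mean_row_avgmx p (A : 'M[R]_(N, p)) : mean_row (avgmx R N *m A) = mean_row A.
Proof.
by rewrite -(row_avgmx _ (Ordinal N0)) mulmxA avgmx_idem row_avgmx.
Qed.

Lemma row_perp p (A : 'M[R]_(N, p)) i : row i (perp A) = row i A - mean_row A.
Proof. by rewrite linearB /= row_avgmx. Qed.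

Lemma avgmx_perp p (A : 'M[R]_(N, p)) : avgmx R N *m perp A = 0.
Proof. by rewrite /perp mulmxBr mulmxA avgmx_idem subrr. Qed.

Lemma perpD p (A B : 'M[R]_(N, p)) : perp (A + B) = perp A + perp B.
Proof. by rewrite /perp mulmxDr opprD addrACA. Qed.

Lemma perpZ p c (A : 'M[R]_(N, p)) : perp (c *: A) = c *: perp A.
Proof. by rewrite /perp -scalemxAr scalerBr. Qed.

Lemma perpN p (A : 'M[R]_(N, p)) : perp (- A) = - perp A.
Proof. by rewrite -scaleN1r perpZ scaleN1r. Qed.

Lemma sum_row_mean p (A : 'M[R]_(N, p)) : \sum_i row i A = N%:R *: mean_row A.
Proof. by rewrite /mean_row scalerA mulfV // scale1r. Qed.

Lemma sum_const_mx p (v : 'rV[R]_p) : \sum_(i < N) v = N%:R *: v.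
Proof. by rewrite sumr_const cardT size_enum_ord scaler_nat. Qed.

(** Pythagoras: the N copies of the mean row are orthogonal to the deviations, which sum to zero. *)
Lemma dot_perp p (A B : 'M[R]_(N, p)) :
  dot A B = N%:R * dot (mean_row A) (mean_row B) + dot (perp A) (perp B).
Proof.
rewrite (dot_rows A) (dot_rows (perp A)).
transitivity (N%:R * dot (mean_row A) (mean_row B) + \sum_i (dot (row i A) (row i B)
    - dot (row i A) (mean_row B) - dot (row i B) (mean_row A)
    + dot (mean_row A) (mean_row B))).
  rewrite !big_split /= !sumrN -!dot_suml !sum_row_mean sum_const_mx.
  by rewrite !(dotZl N%:R) (dotC (mean_row B)); ring.
congr (_ + _); apply: eq_bigr => i _.
by rewrite !row_perp !(dotDl, dotDr, dotNl, dotNr) (dotC (mean_row A) (row i B)); ring.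
Qed.

Lemma sqnorm_perp p (A : 'M[R]_(N, p)) :
  sqnorm A = N%:R * sqnorm (mean_row A) + sqnorm (perp A).
Proof. by rewrite !sqnormE dot_perp. Qed.

Lemma sqnorm_perp_le p (A : 'M[R]_(N, p)) : sqnorm (perp A) <= sqnorm A.
Proof. by rewrite [leRHS]sqnorm_perp lerDr mulr_ge0 ?sqnorm_ge0. Qed.

End Average.

(** * The spectral norm *)

Section OperatorNorm.
Context (R : realType).

(** Cauchy-Schwarz on each row. It bounds the set whose supremum is [opnorm M], without which [sup]
    could be a default value. *)
Lemma sqnorm_mulmx_le m n (M : 'M[R]_(m, n)) (x : 'cV[R]_n) :
  sqnorm (M *m x) <= sqnorm M * sqnorm x.
Proof.
rewrite [X in X * _]sqnorm_rows mulr_suml [leLHS]sqnorm_rows; apply: ler_sum => i _.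
rewrite row_mul; set u := row i M.
have -> : sqnorm (u *m x) = dot u^T x ^+ 2.
  rewrite /sqnorm /dot !big_ord1 !mxE; congr (_ ^+ 2).
  by apply: eq_bigr => j _; rewrite big_ord1 !mxE.
have -> : sqnorm u = sqnorm u^T by rewrite !sqnormE dot_tr.
move: u^T => {u}u.
have [/sqnorm_eq0 ->|x0] := eqVneq (sqnorm x) 0.
  by rewrite dotC dot0l expr0n mulr_ge0 ?sqnorm_ge0.
have xp : 0 < sqnorm x by rewrite lt_neqAle eq_sym x0 sqnorm_ge0.
(* The squared distance from [u] to its projection on the line spanned by [x]. *)
have := sqnorm_ge0 (u - (dot u x / sqnorm x) *: x).
rewrite sqnormB sqnormZ dotZr => h.
rewrite -ler_pdivrMr //.
suff : sqnorm u - 2 * (dot u x / sqnorm x * dot u x) +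
    (dot u x / sqnorm x) ^+ 2 * sqnorm x = sqnorm u - dot u x ^+ 2 / sqnorm x by lra.
by field.
Qed.

Let opset m n (M : 'M[R]_(m, n)) :=
  [set Num.sqrt (sqnorm (M *m x)) | x in [set x : 'cV[R]_n | sqnorm x <= 1]].

Let opset0 m n (M : 'M[R]_(m, n)) : opset M 0.
Proof. by exists 0; rewrite /= ?mulmx0 !sqnorm0 // sqrtr0. Qed.

Lemma opnorm_le m n (M : 'M[R]_(m, n)) c : 0 <= c ->
  (forall x : 'cV[R]_n, sqnorm (M *m x) <= c ^+ 2 * sqnorm x) -> opnorm M <= c.
Proof.
move=> c0 h; apply: ge_sup; first by exists 0; exact: opset0.
move=> _ [x /= x1 <-]; rewrite -[leRHS]ger0_norm // -sqrtr_sqr ler_wsqrtr //.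
by apply: le_trans (h x) _; rewrite ler_piMr ?sqr_ge0.
Qed.

Let opset_sup m n (M : 'M[R]_(m, n)) : has_sup (opset M).
Proof.
split; first by exists 0; exact: opset0.
exists (Num.sqrt (sqnorm M)) => _ [x /= x1 <-]; rewrite ler_wsqrtr //.
by apply: le_trans (sqnorm_mulmx_le _ _) _; rewrite ler_piMr ?sqnorm_ge0.
Qed.

Lemma opnorm_ge0 m n (M : 'M[R]_(m, n)) : 0 <= opnorm M.
Proof. by apply: ub_le_sup; [case: (opset_sup M)|exact: opset0]. Qed.

Lemma opnorm_cV m n (M : 'M[R]_(m, n)) (x : 'cV[R]_n) :
  sqnorm (M *m x) <= opnorm M ^+ 2 * sqnorm x.
Proof.
have [/sqnorm_eq0 ->|x0] := eqVneq (sqnorm x) 0.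
  by rewrite mulmx0 !sqnorm0 mulr0.
have xp : 0 < sqnorm x by rewrite lt_neqAle eq_sym x0 sqnorm_ge0.
set s := (Num.sqrt (sqnorm x))^-1.
have s2 : s ^+ 2 = (sqnorm x)^-1 by rewrite exprVn sqr_sqrtr // ltW.
have : opset M (Num.sqrt (sqnorm (M *m (s *: x)))).
  by exists (s *: x) => //=; rewrite sqnormZ s2 mulVf.
move/(ub_le_sup (proj2 (opset_sup M))); rewrite -[sup _]/(opnorm M) => h.
have : sqnorm (M *m (s *: x)) <= opnorm M ^+ 2.
  rewrite -[leLHS]sqr_sqrtr ?sqnorm_ge0 // lerXn2r ?nnegrE ?sqrtr_ge0 //.
  exact: opnorm_ge0.
by rewrite -scalemxAr sqnormZ s2 mulrC ler_pdivrMr.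
Qed.

(** Squared Frobenius norms add up over columns, so the bound on column vectors carries over with
    the same constant. *)
Lemma opnorm_mulmx m n q (M : 'M[R]_(m, n)) (B : 'M[R]_(n, q)) :
  sqnorm (M *m B) <= opnorm M ^+ 2 * sqnorm B.
Proof.
rewrite !(@sqnorm_cols R _ q) mulr_sumr; apply: ler_sum => j _.
by rewrite colE -mulmxA -colE opnorm_cV.
Qed.

End OperatorNorm.

(** * Chebyshev mixing preserves means and contracts deviations *)

Section Chebyshev.
Context (R : realType).

(* [u] and [v] are the values of consecutive second-kind polynomials, which
   satisfy the Pell-type identity |u|^2 - 2 <A u, v> + |v|^2 = |y|^2. *)
Lemma cheb_contraction n (A : 'M[R]_n) (c : nat -> 'cV[R]_n) :
  A^T = A -> (forall x : 'cV[R]_n, sqnorm (A *m x) <= sqnorm x) ->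
  c 1%N = A *m c 0%N ->
  (forall t, c t.+2 = 2 *: (A *m c t.+1) - c t) ->
  forall t, sqnorm (c t) <= sqnorm (c 0%N).
Proof.
move=> As A1 c1 cS t.
have [u [v [cu cv uv]]] : exists u v, [/\ c t = u - A *m v, c t.+1 = A *m u - v &
    sqnorm u - 2 * dot (A *m u) v + sqnorm v = sqnorm (c 0%N)].
  elim: t => [|t [u [v [cu cv uv]]]].
    (* With y = [c 0], the pair (u, v) is (U_t(A) y, U_{t-1}(A) y), where U_{-1} = 0. *)
    exists (c 0%N), 0; split; rewrite ?mulmx0 ?subr0 //.
    by rewrite dotC dot0l sqnorm0 mulr0 subr0 addr0.
  exists (2 *: (A *m u) - v), u; split.
  - by rewrite cv scaler_nat mulr2n [RHS]addrAC addrK.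
  - rewrite cS cu cv !mulmxBr -scalemxAr.
    move: (A *m (A *m u)) (A *m v) => x y.
    by apply/colP => i; rewrite !mxE; ring.
  - rewrite -uv sqnormB sqnormZ mulmxBr -scalemxAr !(dotDl, dotNl, dotZl).
    have -> : dot (A *m (A *m u)) u = sqnorm (A *m u) by rewrite dot_mulmxl As sqnormE.
    have -> : dot (A *m v) u = dot (A *m u) v by rewrite dot_mulmxl As dotC.
    by ring.
(* |c_t|^2 = |u|^2 - 2 <Au, v> + |Av|^2 exceeds the invariant by |Av|^2 - |v|^2, which is at most
   0. *)
have := A1 v; rewrite cu sqnormB -uv.
by rewrite (dot_mulmxl A u) As; lra.
Qed.

Context (N : nat) (E : rel 'I_N) (W : 'M[R]_N).
Hypothesis (N0 : (0 < N)%N) (mixW : mixing_matrix E W).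

Let rho := mix_rho W.
Let J := avgmx R N.

Lemma mixing_avgmx : W *m J = J.
Proof.
have h : W *m (const_mx 1 : 'cV[R]_N) = const_mx 1.
  have := (mixing_null mixW (const_mx 1)).2.
  rewrite mulmxBl mul1mx => /(_ _)/esym/eqP; rewrite eq_sym subr_eq0 => hh.
  by apply/esym/eqP/hh; exists 1; rewrite scale1r.
have -> : J = const_mx 1 *m (const_mx (N%:R^-1) : 'rV_N).
  by apply/matrixP => i j; rewrite !mxE big_ord1 !mxE mul1r.
by rewrite mulmxA h.
Qed.

Lemma avgmx_mixing : J *m W = J.
Proof. by rewrite -[LHS]trmxK trmx_mul avgmx_sym -(mixing_sym mixW) mixing_avgmx avgmx_sym. Qed.

Lemma cheb_mixSS t q (B : 'M[R]_(N, q)) : cheb_mix W t.+2 B =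
  if rho == 0 then W *m cheb_mix W t.+1 B
  else (2 * cheb_mu rho t.+1 / (rho * cheb_mu rho t.+2)) *: (W *m cheb_mix W t.+1 B)
       - (cheb_mu rho t / cheb_mu rho t.+2) *: cheb_mix W t B.
Proof. by []. Qed.

Lemma nat_ind2 (Q : nat -> Prop) :
  Q 0%N -> Q 1%N -> (forall t, Q t -> Q t.+1 -> Q t.+2) -> forall t, Q t.
Proof.
move=> Q0 Q1 QS t; suff : Q t /\ Q t.+1 by case.
by elim: t => [|t [h1 h2]]; split => //; exact: QS.
Qed.

(** Reduces the properties of the mixing operator to those of one matrix, its value at the
    identity. *)
Lemma cheb_mix_mulmx t q (B : 'M[R]_(N, q)) : cheb_mix W t B = cheb_mix W t 1%:M *m B.
Proof.
elim/nat_ind2: t => [||t h1 h2]; [by rewrite mul1mx|by rewrite /= mulmx1|].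
rewrite !cheb_mixSS h1 h2; case: ifP => _; rewrite ?mulmxA //.
by rewrite mulmxBl -!scalemxAl.
Qed.

Let rho_lt1 : rho < 1. Proof. exact: mixing_gap mixW. Qed.

(** As 1 / rho > 1, the recurrence makes the increments of mu grow. Hence the denominators in
    [cheb_mix] are positive, and mu_t > 1 for t >= 1, where 1 / mu_t is the contraction factor. *)
Lemma cheb_mu_incr t : rho != 0 -> 1 <= cheb_mu rho t < cheb_mu rho t.+1.
Proof.
move=> rho0; have rhop : 0 < rho by rewrite lt_neqAle eq_sym rho0 opnorm_ge0.
have r1 : 1 < rho^-1 by rewrite invf_gt1.
elim: t => [|t /andP[h1 h2]]; first by rewrite lexx.
apply/andP; split; first by lra.
by rewrite -[cheb_mu rho t.+2]/(2 / rho * cheb_mu rho t.+1 - cheb_mu rho t); nra.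
Qed.

Lemma cheb_mu_gt0 t : rho != 0 -> 0 < cheb_mu rho t.
Proof. by move=> /(cheb_mu_incr t)/andP[+ _]; apply: lt_le_trans. Qed.

(** The recurrence of mu divided by mu_{t+2}: a Chebyshev round is an affine combination, which is
    why it preserves averages. *)
Lemma cheb_mu_rec t : rho != 0 ->
  2 * cheb_mu rho t.+1 / (rho * cheb_mu rho t.+2) - cheb_mu rho t / cheb_mu rho t.+2 = 1.
Proof.
move=> rho0; have m2 := cheb_mu_gt0 t.+2 rho0.
have -> : 2 * cheb_mu rho t.+1 / (rho * cheb_mu rho t.+2) - cheb_mu rho t / cheb_mu rho t.+2
  = (2 / rho * cheb_mu rho t.+1 - cheb_mu rho t) / cheb_mu rho t.+2.
  by field; rewrite rho0 gt_eqF.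
by rewrite -[2 / rho * _ - _]/(cheb_mu rho t.+2) mulfV // gt_eqF.
Qed.

Lemma avgmx_cheb t : J *m cheb_mix W t 1%:M = J.
Proof.
elim/nat_ind2: t => [||t h1 h2]; [by rewrite mulmx1|by rewrite /= mulmx1 avgmx_mixing|].
rewrite cheb_mixSS; case: eqVneq => [r0|r0].
  by rewrite mulmxA avgmx_mixing.
rewrite mulmxBr -!scalemxAr mulmxA avgmx_mixing h1 h2 -scalerBl cheb_mu_rec ?scale1r //.
Qed.

Lemma cheb_avgmx t : cheb_mix W t 1%:M *m J = J.
Proof.
elim/nat_ind2: t => [||t h1 h2]; [by rewrite mul1mx|by rewrite /= mulmx1 mixing_avgmx|].
rewrite cheb_mixSS; case: eqVneq => [r0|r0].
  by rewrite -mulmxA h2 mixing_avgmx.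
by rewrite mulmxBl -!scalemxAl -mulmxA h1 h2 mixing_avgmx -scalerBl cheb_mu_rec ?scale1r.
Qed.

Lemma mean_row_cheb t q (B : 'M[R]_(N, q)) : mean_row (cheb_mix W t B) = mean_row B.
Proof.
by rewrite cheb_mix_mulmx -(row_avgmx _ (Ordinal N0)) mulmxA avgmx_cheb row_avgmx.
Qed.

Lemma perp_cheb t q (B : 'M[R]_(N, q)) :
  sqnorm (perp (cheb_mix W t B)) <= mix_rho_tilde W t ^+ 2 * sqnorm (perp B).
Proof.
have -> : perp (cheb_mix W t B) = (cheb_mix W t 1%:M - J) *m perp B.
  rewrite mulmxBl avgmx_perp // subr0 /perp mulmxBr mulmxA cheb_avgmx.
  by rewrite [in LHS]cheb_mix_mulmx mulmxA avgmx_cheb.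
exact: opnorm_mulmx.
Qed.

Lemma mix_rho_tilde_ge0 t : 0 <= mix_rho_tilde W t.
Proof. exact: opnorm_ge0. Qed.

(** The vectors mu_s (W_s - J) x satisfy the recurrence of the first-kind polynomials of A = (W - J)
    / rho, a symmetric matrix of norm at most 1. They stay bounded by their initial value x - J x,
    so rho~ <= 1 / mu_t < 1. *)
Lemma mix_rho_tilde_lt1 t : (0 < t)%N -> mix_rho_tilde W t < 1.
Proof.
move=> t0; have [r0|r0] := eqVneq rho 0.
  (* When rho = 0 the matrix [W] is the exact average, and so is every mixing with at least one
     round. *)
  have WJ : W = J.
    apply/eqP; rewrite -subr_eq0; apply/eqP/sqnorm_eq0/eqP; rewrite eq_le sqnorm_ge0 andbT.
    have := opnorm_mulmx (W - J) 1%:M.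
    by rewrite mulmx1 -[opnorm _]/rho r0 expr0n mul0r.
  suff -> : mix_rho_tilde W t = 0 by [].
  apply/eqP; rewrite eq_le mix_rho_tilde_ge0 andbT; apply: opnorm_le => // x.
  rewrite expr0n mul0r; suff -> : cheb_mix W t 1%:M = J by rewrite subrr mul0mx sqnorm0.
  case: t t0 => // t _; elim: t => [|t IH]; first by rewrite /= mulmx1.
  by rewrite cheb_mixSS r0 eqxx IH mixing_avgmx.
have rhop : 0 < rho by rewrite lt_neqAle eq_sym r0 opnorm_ge0.
have mut := cheb_mu_gt0 t r0.
have mu1 : 1 < cheb_mu rho t.
  case: t t0 {mut} => // t _.
  by have /andP[+ +] := cheb_mu_incr t r0; apply: le_lt_trans.
apply: (@le_lt_trans _ _ (cheb_mu rho t)^-1); last by rewrite invf_lt1.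
apply: opnorm_le; first by rewrite invr_ge0 ltW.
move=> x; pose c s := cheb_mu rho s *: ((cheb_mix W s 1%:M - J) *m x).
have : sqnorm (c t) <= sqnorm (c 0%N).
  apply: (@cheb_contraction _ (rho^-1 *: (W - J))).
  - by rewrite linearZ linearB /= -(mixing_sym mixW) avgmx_sym.
  - move=> y; rewrite -scalemxAl sqnormZ exprVn mulrC ler_pdivrMr ?exprn_gt0 //.
    by rewrite mulrC opnorm_cV.
  - rewrite /c /= mulmx1 scale1r -scalemxAl mulmxA; congr (_ *: (_ *m _)).
    by rewrite [RHS]mulmxBr mulmx1 mulmxBl mixing_avgmx avgmx_idem // subrr subr0.
  - move=> s; rewrite /c cheb_mixSS (negbTE r0).
    set C := cheb_mix W s.+1 1%:M; set B := cheb_mix W s 1%:M.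
    have JC : J *m C = J by exact: avgmx_cheb.
    have JB : J *m B = J by exact: avgmx_cheb.
    have m2 := cheb_mu_gt0 s.+2 r0.
    rewrite -!(scalemxAl, scalemxAr) !scalerA !mulmxA.
    have -> : (W - J) *m (C - J) = W *m C - J.
      by rewrite mulmxBl !mulmxBr mixing_avgmx avgmx_idem // JC subrr subr0.
    rewrite !scalemxAl -mulmxBl; congr (_ *m _).
    have mu2 : cheb_mu rho s.+2 = 2 / rho * cheb_mu rho s.+1 - cheb_mu rho s by [].
    rewrite -!scalemxAl; move: (W *m C) mu2 m2.
    move: (cheb_mu rho s.+2) (cheb_mu rho s.+1) (cheb_mu rho s) => a b d WC e a0.
    apply/matrixP => i j; rewrite !mxE.
    transitivity (2 / rho * b * WC i j - d * B i j - a * N%:R^-1); last by rewrite e; ring.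
    by field; rewrite r0 pnatr_eq0 -lt0n N0 gt_eqF.
rewrite /c scale1r sqnormZ => ct.
rewrite exprVn mulrC ler_pdivlMr ?exprn_gt0 // mulrC; apply: le_trans ct _.
have -> : (cheb_mix W 0 1%:M - J) *m x = perp x by rewrite mulmxBl mul1mx.
exact: sqnorm_perp_le.
Qed.

End Chebyshev.

(** * Proximal maps and smooth functions *)

Section Prox.
Context (R : realType) (p : nat) (r : 'rV[R]_p -> R).
Hypothesis cvx_r : convex_function (setT : set (convex_lmodType 'rV[R]_p)) r.

Lemma convex_comb (t : R) x y : 0 <= t <= 1 ->
  r (t *: x + (1 - t) *: y) <= t * r x + (1 - t) * r y.
Proof.
move=> t01; have t01' : t \in `[0, 1] by rewrite in_itv.
have xT z : z \in (setT : set (convex_lmodType 'rV[R]_p)) by rewrite inE.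
exact: (cvx_r (Itv01 (andP t01).1 (andP t01).2) (xT x) (xT y)).
Qed.

Lemma convex_mean_seq n (x : 'I_n.+1 -> 'rV[R]_p) :
  r (n.+1%:R^-1 *: \sum_i x i) <= n.+1%:R^-1 * \sum_i r (x i).
Proof.
elim: n x => [|n IH] x; first by rewrite !big_ord1 invr1 scale1r mul1r.
rewrite [in leLHS]big_ord_recr [in leRHS]big_ord_recr /=.
set s := \sum_i _; have n1 : (n.+1%:R : R) != 0 by rewrite pnatr_eq0.
have n2 : (n.+2%:R : R) != 0 by rewrite pnatr_eq0.
have e2 : n.+2%:R = 1 + n.+1%:R :> R by rewrite -nat1r.
pose t : R := n.+1%:R / n.+2%:R.
have t1 : 1 - t = n.+2%:R^-1.
  by rewrite /t -[X in X - _](divff n2) -mulrBl e2 addrK mul1r.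
have -> : n.+2%:R^-1 *: (s + x ord_max) =
    t *: (n.+1%:R^-1 *: s) + (1 - t) *: x ord_max.
  by rewrite t1 scalerDr scalerA /t mulrAC mulfV // mul1r.
apply: le_trans (convex_comb _ _ _) _.
  by rewrite divr_ge0 //= ler_pdivrMr ?ltr0n // mul1r ler_nat.
rewrite mulrDr t1 lerD2r.
apply: (@le_trans _ _ (t * (n.+1%:R^-1 * \sum_(i < n.+1) r (x (widen_ord (leqnSn n.+1) i))))).
  by rewrite ler_wpM2l ?divr_ge0 //; exact: IH.
by rewrite mulrA /t (mulrAC n.+1%:R) mulfV // mul1r.
Qed.

Lemma convex_mean_row N (X : 'M[R]_(N, p)) : (0 < N)%N ->
  r (mean_row X) <= N%:R^-1 * \sum_i r (row i X).
Proof. by case: N X => // N X _; exact: convex_mean_seq. Qed.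

Context (eta : R).
Hypothesis eta0 : 0 < eta.

(** First-order optimality without subgradients: u is compared with the points of the segment from u
    to w, the inequality is divided by the parameter t, and t is taken small. *)
Lemma is_prox_variational v u w : is_prox (fun x => eta * r x) v u ->
  eta * r u <= eta * r w + dot (u - v) (w - u).
Proof.
move=> uv; rewrite leNgt; apply/negP => h.
set A := eta * r w + dot (u - v) (w - u) - eta * r u.
have A0 : A < 0 by rewrite subr_lt0.
have key t : 0 < t <= 1 -> 0 <= A + t / 2 * sqnorm (w - u).
  move=> /andP[t0 t1]; have := uv (t *: w + (1 - t) *: u).
  have t01 : 0 <= t <= 1 by rewrite ltW.
  have := convex_comb w u t01.
  have -> : t *: w + (1 - t) *: u - v = (u - v) + t *: (w - u).
    by apply/rowP => i; rewrite !mxE; ring.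
  rewrite (sqnormD (u - v)) (sqnormZ t) (dotZr t) -(ler_pM2l eta0) => h1 h2.
  rewrite -(pmulr_rge0 _ t0) /A; nra.
(* Small enough for A + t / 2 |w - u|^2 to be negative, against [key]. *)
pose t := Num.min 1 (- A / (1 + sqnorm (w - u))).
have q0 : 0 < 1 + sqnorm (w - u) by have := sqnorm_ge0 (w - u); lra.
have t0 : 0 < t by rewrite lt_min ltr01 divr_gt0 // oppr_gt0.
have t1 : t <= 1 by rewrite ge_min lexx.
have tA : t * (1 + sqnorm (w - u)) <= - A.
  by rewrite -ler_pdivlMr // ge_min lexx orbT.
have := key t; rewrite t0 t1 => /(_ isT); have := sqnorm_ge0 (w - u); nra.
Qed.

Hypothesis prox_ex : forall v, exists u, is_prox (fun x => eta * r x) v u.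

Let P v := prox (fun x => eta * r x) v.

Lemma proxP v : is_prox (fun x => eta * r x) v (P v).
Proof. by have [u uv] := prox_ex v; apply: (@xgetPex _ 0 [set x | is_prox _ v x]); exists u. Qed.

(** The proximal objective is 1-strongly convex, so it grows quadratically away from its
    minimiser. *)
Lemma prox_three_point v w :
  eta * r (P v) + 2^-1 * sqnorm (P v - v) + 2^-1 * sqnorm (w - P v)
    <= eta * r w + 2^-1 * sqnorm (w - v).
Proof.
have := is_prox_variational w (proxP v).
have -> : w - v = (w - P v) + (P v - v) by rewrite addrA subrK.
by rewrite (sqnormD (w - P v)) (dotC (w - P v)); lra.
Qed.

(** Each proximal point is tested in the variational inequality of the other; the sum is firm
    nonexpansiveness, |Pv - Pv'|^2 <= <v - v', Pv - Pv'>. *)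
Lemma prox_nonexpansive v v' : sqnorm (P v - P v') <= sqnorm (v - v').
Proof.
have h1 := is_prox_variational (P v') (proxP v).
have h2 := is_prox_variational (P v) (proxP v').
have h3 := dot_young (v - v') (P v - P v') ltr01.
have h4 a b : dot (a - v) (b - a) + dot (b - v') (a - b) = dot (v - v') (a - b) - sqnorm (a - b).
  by rewrite sqnormE !dotE; ring.
by have := h4 (P v) (P v'); lra.
Qed.

End Prox.

(** * Gradients and the descent lemma *)

Section Smooth.
Context (R : realType) (p : nat).
Implicit Types (f : 'rV[R]_p -> R) (x y : 'rV[R]_p).

Lemma derive_gradient f x d : differentiable (f : 'rV[R]_p -> R^o) x ->
  'D_d (f : 'rV[R]_p -> R^o) x = dot (gradient f x) d.
Proof.
move=> df; rewrite deriveE // {1}(row_sum_delta d) linear_sum /dot big_ord1.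
by apply: eq_bigr => j _; rewrite linearZ /= !mxE deriveE // mulrC.
Qed.

Lemma is_derive_line f x d t : differentiable (f : 'rV[R]_p -> R^o) (x + t *: d) ->
  is_derive t 1 (fun s => f (x + s *: d) : R^o) (dot (gradient f (x + t *: d)) d).
Proof.
move=> df; have e : (fun h : R => h^-1 *: (((fun s => f (x + s *: d) : R^o) \o shift t) (h *: 1)
     - f (x + t *: d))) = (fun h : R => h^-1 *: (((f : _ -> R^o) \o shift (x + t *: d)) (h *: d)
     - f (x + t *: d))).
  apply/funext => h /=; congr (_ *: (f _ - _)).
  by rewrite [h *: 1](mulr1 h) scalerDl addrCA.
split; first by rewrite /derivable e; exact: diff_derivable df.
by rewrite /derive e -derive_gradient.
Qed.

(** The mean value theorem stands in for the integral of the gradient along the segment: [g] is f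
    minus its claimed upper model, and its derivative is nonpositive on (0, 1). *)
Lemma descent_lemma f L x y : 0 < L ->
  (forall z, differentiable (f : 'rV[R]_p -> R^o) z) ->
  (forall a b, sqnorm (gradient f a - gradient f b) <= L ^+ 2 * sqnorm (a - b)) ->
  f y <= f x + dot (gradient f x) (y - x) + L / 2 * sqnorm (y - x).
Proof.
move=> L0 df lip; set d := y - x.
pose g (t : R) : R^o := f (x + t *: d) - t * dot (gradient f x) d - t ^+ 2 * (L / 2 * sqnorm d).
pose dg (t : R) : R := dot (gradient f (x + t *: d)) d - dot (gradient f x) d
   - 2 * t * (L / 2 * sqnorm d).
have gd (t : R) : is_derive t 1 g (dg t).
  rewrite /g; have h := is_derive_line (df (x + t *: d)).
  apply: is_derive_eq; rewrite /dg /GRing.scale /=; ring.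
have cg : {within `[0, 1], continuous g}.
  apply: continuous_subspaceT => t; apply: differentiable_continuous.
  by apply/derivable1_diffP; exact: (@ex_derive _ _ _ _ _ _ _ (gd t)).
have [c /andP[c0 c1] /eqP] := MVT ltr01 (fun t _ => gd t) cg.
rewrite subr0 mulr1 subr_eq /g scale1r scale0r addr0 !mul0r expr0n !mul0r !subr0 expr1n !mul1r.
have -> : x + d = y by rewrite /d subrKC.
move=> /eqP gy; suff : dg c <= 0 by move: gy; lra.
rewrite /dg; rewrite bnd_simp in c0.
(* With Young's weight 1 / (L c) both terms equal L c / 2 |d|^2, and their sum is exactly what
   [dg c] subtracts. *)
have Lc : 0 < (L * c)^-1 by rewrite invr_gt0 mulr_gt0.
have h2 := dot_young (gradient f (x + c *: d) - gradient f x) d Lc.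
have := lip (x + c *: d) x; rewrite addrAC subrr add0r sqnormZ => h1.
rewrite -dotNl -dotDl subr_le0; apply: le_trans h2 _.
apply: (@le_trans _ _ ((L * c)^-1 / 2 * (L ^+ 2 * (c ^+ 2 * sqnorm d)) +
    (2 * (L * c)^-1)^-1 * sqnorm d)).
  by rewrite lerD2r ler_wpM2l // divr_ge0 // ltW.
by apply: le_of_eq; field; rewrite !gt_eqF.
Qed.

End Smooth.

(** * Independence and measurability *)

Section Independence.
Context (R : realType) (dO : measure_display) (Om : measurableType dO).
Context (P : probability Om R).

(** Both sides are finite measures in [A] that agree on the pi-system [G], hence on the
    sigma-algebra it generates. *)
Lemma indep_generated (G : set (set Om)) (B : set Om) :
  G `<=` measurable -> setI_closed G -> G setT -> measurable B ->
  (forall A, G A -> P (A `&` B) = (P A * P B)%E) ->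
  forall A, <<s G >> A -> P (A `&` B) = (P A * P B)%E.
Proof.
move=> Gm GI GT mB PG.
have pB : (0 <= fine (P B))%R by rewrite fine_ge0.
pose b := NngNum pB.
have eB : P B = b%:num%:E by rewrite /= fineK // fin_num_measure.
have h : forall A, <<s G >> A -> mrestr P mB A = mscale b P A.
  apply: (g_sigma_algebra_measure_unique G Gm (fun _ => setT)) => //.
  - by apply/seteqP; split => // x _; exists 0%N.
  - by move=> A GA; rewrite [LHS](PG _ GA) muleC eB.
  - by move=> k; apply: le_lt_trans (probability_le1 P _) (ltry 1); exact: measurableI.
by move=> A sA; rewrite [LHS]h // eB muleC.
Qed.

Lemma sub_measurable_generated (G : set (set Om)) :
  G `<=` measurable -> <<s G >> `<=` measurable.
Proof. by move=> Gm; apply: smallest_sub => //; exact: sigma_algebra_measurable. Qed.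

Section Grouping.
Context (I : finType) (Ev : I -> set (set Om)).
Hypothesis EvT : forall i, Ev i setT.
Hypothesis EvI : forall i, setI_closed (Ev i).
Hypothesis Evm : forall i, Ev i `<=` measurable.
Hypothesis EvP : mutually_independent P Ev.

(** The finite intersections with one event per index form a pi-system; it generates the joint
    sigma-algebra of the group [J]. *)
Definition joint (J : {set I}) : set (set Om) :=
  [set A | exists B : I -> set Om, (forall i, i \in J -> Ev i (B i)) /\
     A = \bigcap_(i in [set` J]) B i].

Lemma jointT J : joint J setT.
Proof. by exists (fun _ => setT); split=> [i _|]; [exact: EvT|rewrite bigcapT]. Qed.

Lemma jointI J : setI_closed (joint J).
Proof.
move=> _ _ [A [EA ->]] [B [EB ->]]; exists (fun i => A i `&` B i).
by split=> [i iJ|]; [apply: EvI; [exact: EA|exact: EB]|rewrite bigcapI].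
Qed.

Lemma joint_measurable J : joint J `<=` measurable.
Proof.
move=> _ [A [EA ->]]; apply: fin_bigcap_measurable => // i iJ.
by apply: (@Evm i); exact: EA.
Qed.

Lemma joint_ev (J : {set I}) i : i \in J -> Ev i `<=` joint J.
Proof.
move=> iJ A EA; exists (fun k => if k == i then A else setT); split.
  by move=> k kJ; case: eqVneq => [->|_].
apply/seteqP; split=> [x Ax k /= kJ|x /(_ i iJ)]; last by rewrite /= eqxx.
by case: eqVneq.
Qed.

(** Disjoint groups of a mutually independent family are independent: the pi-system argument is
    applied to each side in turn, and on intersections the product over the union splits. *)
Lemma joint_indep (J1 J2 : {set I}) A B :
  (forall i, i \in J2 -> i \in J1 = false) ->
  <<s joint J1 >> A -> <<s joint J2 >> B -> P (A `&` B) = (P A * P B)%E.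
Proof.
move=> J12 sA sB.
have mA : measurable A by apply: sub_measurable_generated sA; exact: joint_measurable.
rewrite setIC muleC; apply: (indep_generated _ _ _ _ _ sB) => //;
  [exact: joint_measurable|exact: jointI|exact: jointT|].
move=> C JC; have mC := joint_measurable JC.
rewrite setIC muleC; apply: (indep_generated _ _ _ _ _ sA) => //;
  [exact: joint_measurable|exact: jointI|exact: jointT|].
case: JC => {C mC} C [EC ->] _ [D [ED ->]].
rewrite (EvP ED) (EvP EC) -EFinM.
pose F i := if i \in J1 then D i else C i.
have -> : \bigcap_(i in [set` J1]) D i `&` \bigcap_(i in [set` J2]) C i =
    \bigcap_(i in [set` (J1 :|: J2)%SET]) F i.
  apply/seteqP; split=> x /=.
    move=> [xD xC] i /=; rewrite inE /F => /orP[i1|i2].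
      by rewrite i1; exact: xD.
    by rewrite J12 //; exact: xC.
  move=> xF; split=> i /= iJ; have := xF i; rewrite /= inE iJ ?orbT /F => /(_ isT).
    by rewrite iJ.
  by rewrite J12.
rewrite EvP => [|i]; last first.
  by rewrite inE /F; case: ifP => [i1 _|_ /= i2]; [exact: ED|exact: EC].
rewrite (bigID (mem J1)) /=; congr (_ * _)%:E.
  apply: eq_big => i; first by rewrite inE andbC; case: (i \in J1).
  by move=> /andP[_ i1]; rewrite /F i1.
apply: eq_big => i.
  rewrite inE; case: (boolP (i \in J1)) => i1 /=; last by rewrite andbT.
  by apply/esym/negP => /J12; rewrite i1.
by move=> /andP[_ i1]; rewrite /F (negbTE i1).
Qed.

End Grouping.

Section Freezing.
Context (d1 dS : measure_display) (T1 : measurableType d1) (S : measurableType dS).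
Context (X : {RV P >-> T1}) (eta : {RV P >-> S}) (mu : probability S R).
Hypothesis eta_mu : has_law P eta mu.
Hypothesis eta_X : forall A B, measurable A -> measurable B ->
  P (X @^-1` A `&` eta @^-1` B) = (P (X @^-1` A) * P (eta @^-1` B))%E.

Let PX : probability T1 R := distribution P X.

Let pr (w : Om) := (X w, eta w).

Let mpr : measurable_fun setT pr.
Proof. exact: measurable_fun_pair. Qed.

HB.instance Definition _ := isMeasurableFun.Build _ _ _ _ pr mpr.

Let law_pr A : measurable A -> (PX \x mu)%E A = distribution P pr A.
Proof.
move=> mA; apply: product_measure_unique => // B C mB mC.
by have := eta_X mB mC; rewrite eta_mu.
Qed.

(** By independence on rectangles the pair (X, eta) has law PX x mu, and Tonelli integrates eta with
    X frozen. This plays the role of the tower property. *)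
Lemma ge0_freezing (h : T1 * S -> \bar R) : measurable_fun setT h ->
  (forall x, (0 <= h x)%E) ->
  (\int[P]_w h (X w, eta w) = \int[P]_w \int[mu]_s h (X w, s))%E.
Proof.
move=> mh h0.
have := @ge0_integral_distribution _ _ _ _ _ P pr h mh h0.
rewrite (eq_measure_integral (PX \x mu)%E) => [|A mA _]; last by rewrite [RHS]law_pr.
rewrite fubini_tonelli1 //= => <-; rewrite ge0_integral_distribution //.
  exact: measurable_fun_fubini_tonelli_F.
by move=> y; apply: integral_ge0.
Qed.

Lemma freezing (h : T1 * S -> \bar R) : measurable_fun setT h ->
  P.-integrable setT (fun w => h (X w, eta w)) ->
  (\int[P]_w h (X w, eta w) = \int[P]_w \int[mu]_s h (X w, s))%E.
Proof.
move=> mh ih.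
have ih' : (PX \x mu)%E.-integrable setT h.
  apply/integrableP; split => //.
  rewrite (eq_measure_integral (distribution P pr)) => [|A mA _]; last first.
    by rewrite [LHS]law_pr.
  rewrite ge0_integral_distribution //; last exact: measurableT_comp.
  by case/integrableP: ih.
have := @integral_distribution _ _ _ _ _ P pr h mh ih.
rewrite (eq_measure_integral (PX \x mu)%E) => [|A mA _]; last by rewrite [RHS]law_pr.
rewrite -integral12_prod_meas1 //= => <-.
have i1 := integrable_fubini_F ih'.
have m1 : measurable_fun setT (fubini_F mu h) by case/integrableP: i1.
rewrite integral_distribution //.
apply/integrableP; split; first exact: measurableT_comp.
case/integrableP: i1 => _; rewrite ge0_integral_distribution //.
exact: measurableT_comp.
Qed.

End Freezing.

End Independence.

(** * From Euclidean bounds to the sup-norm topology *)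

Section Continuity.
Context (R : realType) (p : nat).

Lemma ler_mx_norm (v : 'rV[R]_p) j : `|v 0 j| <= `|v|.
Proof.
rewrite [leRHS]/Num.Def.normr /= mx_normrE; apply/bigmax_geP; right => /=.
by exists (ord0, j).
Qed.

Lemma mx_norm_le (v : 'rV[R]_p) e : 0 <= e -> (forall j, `|v 0 j| <= e) -> `|v| <= e.
Proof.
move=> e0 h; rewrite [leLHS]/Num.Def.normr /= mx_normrE; apply/bigmax_leP; split => //= -[i j] _.
by rewrite ord1 h.
Qed.

Lemma sqnorm_le_norm (v : 'rV[R]_p) : sqnorm v <= p%:R * `|v| ^+ 2.
Proof.
rewrite /sqnorm big_ord1; apply: (@le_trans _ _ (\sum_(j < p) `|v| ^+ 2)).
  by apply: ler_sum => j _; rewrite -real_normK ?num_real // lerXn2r ?nnegrE // ler_mx_norm.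
by rewrite sumr_const card_ord mulr_natl.
Qed.

Lemma sqnorm_lipschitz_continuous (h : 'rV[R]_p -> R) C :
  (forall x y, (h x - h y) ^+ 2 <= C * sqnorm (x - y)) -> continuous h.
Proof.
(* The summand 1 keeps [c] positive, so that it can be divided by, even when [C] or [p] is zero. *)
move=> hC x; pose c := Num.sqrt (`|C| * p%:R) + 1.
have c0 : 0 < c by rewrite ltr_wpDl // sqrtr_ge0.
have key y : `|h x - h y| <= c * `|x - y|.
  have : `|h x - h y| ^+ 2 <= (c * `|x - y|) ^+ 2.
    rewrite real_normK ?num_real //; apply: le_trans (hC _ _) _.
    apply: (@le_trans _ _ (`|C| * sqnorm (x - y))).
      by rewrite ler_wpM2r ?sqnorm_ge0 ?ler_norm.
    apply: (@le_trans _ _ (`|C| * (p%:R * `|x - y| ^+ 2))).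
      by rewrite ler_wpM2l // sqnorm_le_norm.
    rewrite mulrA exprMn ler_wpM2r ?sqr_ge0 //.
    rewrite -[leLHS]sqr_sqrtr ?mulr_ge0 // lerXn2r ?nnegrE ?sqrtr_ge0 ?(ltW c0) //.
    by rewrite lerDl.
  by rewrite ler_pXn2r ?nnegrE ?mulr_ge0 ?(ltW c0).
apply/(@cvgrPdist_le R R^o _ (nbhs x) (nbhs_filter x)) => e e0; near=> y.
apply: le_trans (key y) _; rewrite -ler_pdivlMl // mulrC.
near: y; apply: (@cvgr_dist_le _ _ _ _ _ (fun y => y) x) => //; exact: divr_gt0.
Unshelve. all: by end_near. Qed.

End Continuity.

(** * Measurability of random matrices and of gradients *)

Section MatrixMeasurable.
Context (R : realType) (d : measure_display) (T : measurableType d).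

(** Measurability is entrywise, so that no sigma-algebra on matrices has to be chosen. *)
Definition mx_measurable m n (X : T -> 'M[R]_(m, n)) :=
  forall i j, measurable_fun setT (fun w => X w i j).

Lemma mx_measurable_cst m n (A : 'M[R]_(m, n)) : mx_measurable (fun _ => A).
Proof. by move=> i j; exact: measurable_cst. Qed.

Lemma mx_measurableD m n (X Y : T -> 'M[R]_(m, n)) :
  mx_measurable X -> mx_measurable Y -> mx_measurable (fun w => X w + Y w).
Proof.
move=> mX mY i j; under eq_fun do rewrite mxE.
exact: measurable_funD.
Qed.

Lemma mx_measurableZ m n c (X : T -> 'M[R]_(m, n)) :
  mx_measurable X -> mx_measurable (fun w => c *: X w).
Proof.
move=> mX i j; under eq_fun do rewrite mxE.
exact: measurable_funM.
Qed.

Lemma mx_measurableB m n (X Y : T -> 'M[R]_(m, n)) :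
  mx_measurable X -> mx_measurable Y -> mx_measurable (fun w => X w - Y w).
Proof.
move=> mX mY; apply: mx_measurableD => //.
by move=> i j; under eq_fun do rewrite mxE; exact: measurableT_comp.
Qed.

Lemma mx_measurable_mulmx m n q (A : 'M[R]_(m, n)) (X : T -> 'M[R]_(n, q)) :
  mx_measurable X -> mx_measurable (fun w => A *m X w).
Proof.
move=> mX i j; under eq_fun do rewrite mxE.
by apply: measurable_sum => k; exact: measurable_funM.
Qed.

Lemma mx_measurable_row m n (X : T -> 'M[R]_(m, n)) i :
  mx_measurable X -> mx_measurable (fun w => row i (X w)).
Proof. by move=> mX k j; under eq_fun do rewrite mxE; exact: mX. Qed.

Lemma mx_measurable_rows m n (X : T -> 'I_m -> 'rV[R]_n) :
  (forall i, mx_measurable (fun w => X w i)) ->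
  mx_measurable (fun w => \matrix_(i < m) X w i).
Proof. by move=> mX i j; under eq_fun do rewrite mxE; exact: mX. Qed.

Lemma mx_measurable_sum m n (I : Type) (s : seq I) (X : I -> T -> 'M[R]_(m, n)) :
  (forall i, mx_measurable (X i)) -> mx_measurable (fun w => \sum_(i <- s) X i w).
Proof.
move=> mX i j; under eq_fun do rewrite summxE.
by apply: measurable_sum => k; exact: mX.
Qed.

Lemma measurable_sqnorm m n (X : T -> 'M[R]_(m, n)) :
  mx_measurable X -> measurable_fun setT (fun w => sqnorm (X w)).
Proof.
move=> mX; apply: measurable_sum => i; apply: measurable_sum => j.
exact: measurable_funX.
Qed.

Lemma mx_measurable_perp N p (X : T -> 'M[R]_(N, p)) :
  mx_measurable X -> mx_measurable (fun w => perp (X w)).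
Proof. by move=> mX; apply: mx_measurableB => //; exact: mx_measurable_mulmx. Qed.

Lemma mx_measurable_mean_row N p (X : T -> 'M[R]_(N, p)) :
  mx_measurable X -> mx_measurable (fun w => mean_row (X w)).
Proof.
move=> mX; apply: mx_measurableZ; apply: mx_measurable_sum => i.
exact: mx_measurable_row.
Qed.

Lemma mx_measurable_cheb N (W : 'M[R]_N) t p (X : T -> 'M[R]_(N, p)) :
  mx_measurable X -> mx_measurable (fun w => cheb_mix W t (X w)).
Proof.
move=> mX; under eq_fun do rewrite cheb_mix_mulmx.
exact: mx_measurable_mulmx.
Qed.

Context (dS : measure_display) (S : measurableType dS) (p : nat).

(* Approximate X by the countably valued maps obtained by rounding its
   coordinates down to multiples of 1 / n. *)
Lemma caratheodory_measurable (g : 'rV[R]_p -> S -> R) (X : T -> 'rV[R]_p) (eta : T -> S) :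
  (forall s, continuous (g ^~ s)) -> (forall x, measurable_fun setT (g x)) ->
  mx_measurable X -> measurable_fun setT eta ->
  measurable_fun setT (fun w => g (X w) (eta w)).
Proof.
move=> cg mg mX meta.
pose Q (n : nat) (q : 'rV[int]_p) : 'rV[R]_p := \row_j ((q 0 j)%:~R / n.+1%:R).
pose q (n : nat) (w : T) : 'rV[int]_p := \row_j Num.floor (n.+1%:R * X w 0 j).
apply: (@measurable_fun_cvg _ _ _ _ (fun n w => g (Q n (q n w)) (eta w))).
  move=> n _ B mB; rewrite setTI.
  have -> : (fun w => g (Q n (q n w)) (eta w)) @^-1` B =
     \bigcup_(z : 'rV[int]_p) ([set w | q n w = z] `&` eta @^-1` (g (Q n z) @^-1` B)).
    apply/seteqP; split => [w /= Bw|w [z _ /= [<-]]//].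
    by exists (q n w).
  apply: countable_bigcupT_measurable => // z; apply: measurableI; last first.
    rewrite -[X in measurable X]setTI; apply: meta => //.
    by rewrite -[X in measurable X]setTI; exact: mg.
  have -> : [set w | q n w = z] =
     \bigcap_(j in [set` [set: 'I_p]%SET]) [set w | n.+1%:R * X w 0 j \in `[(z 0 j)%:~R, (z 0 j +
         1)%:~R[].
    apply/seteqP; split => w /=.
      by move=> <- j _ /=; rewrite in_itv /= mxE floor_itv.
    move=> h; apply/rowP => j; rewrite mxE; apply: floor_def.
    by have := h j; rewrite /= inE in_itv => /(_ isT).
  apply: fin_bigcap_measurable => // j _.
  rewrite -[X in measurable X]setTI.
  have mj : measurable_fun setT (fun w => n.+1%:R * X w 0 j) by exact: measurable_funM.
  exact: (mj measurableT _ (measurable_itv `[(z 0 j)%:~R, (z 0 j + 1)%:~R[)).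
move=> w _.
apply: (@cvg_comp _ _ _ (fun n => Q n (q n w)) (g ^~ (eta w)) \oo (nbhs (X w))); last exact: cg.
apply/(@cvgrPdist_le R 'rV[R]_p _ \oo _) => e e0; near=> n.
apply: (@le_trans _ _ n.+1%:R^-1); last first.
  by apply: ltW; near: n; apply: (near_infty_natSinv_lt (PosNum e0)).
apply: mx_norm_le => // j; rewrite !mxE.
have n0 : (0 : R) < n.+1%:R by [].
have /andP[h1 h2] := floor_itv (n.+1%:R * X w 0 j).
rewrite intrD in h2.
move: (n.+1%:R : R) (Num.floor _)%:~R n0 h1 h2 => c f n0 h1 h2.
have -> : X w 0 j - f / c = (c * X w 0 j - f) / c by field; rewrite gt_eqF.
rewrite normrM [`|c^-1|]ger0_norm ?invr_ge0 ?(ltW n0) // ler_piMl ?invr_ge0 ?(ltW n0) //.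
by rewrite ler_norml; lra.
Unshelve. all: by end_near. Qed.

(** Each partial derivative is the pointwise limit of difference quotients of increment 1 / (n + 1),
    and these are measurable because [g] is continuous in the point and measurable in the sample. *)
Lemma gradient_measurable (g : 'rV[R]_p -> S -> R) (X : T -> 'rV[R]_p) (eta : T -> S) :
  (forall s x, differentiable (g ^~ s : 'rV[R]_p -> R^o) x) ->
  (forall x, measurable_fun setT (g x)) ->
  mx_measurable X -> measurable_fun setT eta ->
  mx_measurable (fun w => gradient (g ^~ (eta w)) (X w)).
Proof.
move=> dg mg mX meta i j; under eq_fun do rewrite mxE.
have cg s : continuous (g ^~ s).
  by move=> x; apply: (differentiable_continuous (dg s x)).
apply: (@measurable_fun_cvg _ _ _ _ (fun n w => (n.+1%:R^-1)^-1 *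
   (g (n.+1%:R^-1 *: delta_mx 0 j + X w) (eta w) - g (X w) (eta w)))).
  move=> n; apply: measurable_funM => //; apply: measurable_funB.
    apply: caratheodory_measurable => //; apply: mx_measurableD => //.
  exact: caratheodory_measurable.
move=> w _.
have /cvgr_dnbhsP h : derivable (g ^~ (eta w) : _ -> R^o) (X w) (delta_mx 0 j).
  exact: diff_derivable.
apply: (h (fun n => n.+1%:R^-1)); split => //; exact: cvg_harmonic.
Qed.

End MatrixMeasurable.

Lemma continuous_mx_measurable (R : realType) d (T : measurableType d) p
    (h : 'rV[R]_p -> R) (X : T -> 'rV[R]_p) :
  continuous h -> mx_measurable X -> measurable_fun setT (fun w => h (X w)).
Proof.
by move=> ch mX; apply: (@caratheodory_measurable R d T d T p (fun x _ => h x) X id).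
Qed.

(** * Real-valued expectations and second moments *)

Section Moments.
Context (R : realType) (d : measure_display) (T : measurableType d).
Context (P : probability T R).
Implicit Types f g : T -> R.

Definition L1 f : Prop := P.-integrable setT (EFin \o f).

Definition Ex f : R := Rintegral P setT f.

Lemma L1_measurable f : L1 f -> measurable_fun setT f.
Proof. by move/measurable_int/measurable_EFinP. Qed.

Lemma L1_cst c : L1 (fun _ => c).
Proof. exact: finite_measure_integrable_cst. Qed.

Lemma L1D f g : L1 f -> L1 g -> L1 (fun w => f w + g w).
Proof. by move=> f1 g1; apply: eq_integrable (integrableD _ f1 g1). Qed.

Lemma L1Z c f : L1 f -> L1 (fun w => c * f w).
Proof. by move=> f1; apply: eq_integrable (integrableZl _ _ f1). Qed.

Lemma L1B f g : L1 f -> L1 g -> L1 (fun w => f w - g w).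
Proof. by move=> f1 g1; apply: eq_integrable (integrableB _ f1 g1). Qed.

Lemma L1_sum (I : Type) (s : seq I) (F : I -> T -> R) :
  (forall i, L1 (F i)) -> L1 (fun w => \sum_(i <- s) F i w).
Proof.
move=> F1; elim: s => [|i s IH].
  by under eq_fun do rewrite big_nil; exact: L1_cst.
by under eq_fun do rewrite big_cons; exact: L1D.
Qed.

Lemma L1_le f g : measurable_fun setT f -> (forall w, `|f w| <= g w) -> L1 g -> L1 f.
Proof.
move=> mf fg; apply: le_integrable => //; first exact/measurable_EFinP.
by move=> w _; rewrite /= lee_fin (le_trans (fg w)) // ler_norm.
Qed.

Lemma integral_Ex f : L1 f -> (\int[P]_w (f w)%:E)%E = (Ex f)%:E.
Proof. by move=> f1; rewrite /Ex /Rintegral fineK // integrable_fin_num. Qed.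

Lemma Ex_cst c : Ex (fun _ => c) = c.
Proof. by rewrite /Ex Rintegral_cst // [fine _](_ : _ = 1) ?mulr1 // [X in fine
    X](@probability_setT _ _ _ P). Qed.

Lemma ExD f g : L1 f -> L1 g -> Ex (fun w => f w + g w) = Ex f + Ex g.
Proof. by move=> f1 g1; rewrite /Ex RintegralD. Qed.

Lemma ExB f g : L1 f -> L1 g -> Ex (fun w => f w - g w) = Ex f - Ex g.
Proof. by move=> f1 g1; rewrite /Ex RintegralB. Qed.

Lemma ExZ c f : L1 f -> Ex (fun w => c * f w) = c * Ex f.
Proof. by move=> f1; rewrite /Ex RintegralZl. Qed.

Lemma Ex_sum (I : Type) (s : seq I) (F : I -> T -> R) :
  (forall i, L1 (F i)) -> Ex (fun w => \sum_(i <- s) F i w) = \sum_(i <- s) Ex (F i).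
Proof.
move=> F1; elim: s => [|i s IH].
  by under [in LHS]eq_fun do rewrite big_nil; rewrite Ex_cst big_nil.
under [in LHS]eq_fun do rewrite big_cons.
by rewrite ExD // ?IH ?big_cons //; exact: L1_sum.
Qed.

Lemma Ex_ge0 f : (forall w, 0 <= f w) -> 0 <= Ex f.
Proof. by move=> f0; apply: Rintegral_ge0 => w _. Qed.

Lemma Ex_le f g : L1 f -> L1 g -> (forall w, f w <= g w) -> Ex f <= Ex g.
Proof. by move=> f1 g1 fg; apply: le_Rintegral => // w _. Qed.

(** The assumptions bound extended-real integrals; here such a bound becomes integrability together
    with an inequality between reals. *)
Lemma ge0_L1 f c : measurable_fun setT f -> (forall w, 0 <= f w) ->
  (\int[P]_w (f w)%:E <= c%:E)%E -> L1 f /\ Ex f <= c.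
Proof.
move=> mf f0 fc; have f1 : L1 f.
  apply/integrableP; split; first exact/measurable_EFinP.
  apply: le_lt_trans (ltry c); apply: le_trans fc.
  by under eq_integral do rewrite /= ger0_norm //.
by split => //; rewrite -lee_fin -integral_Ex.
Qed.

Definition L2 f : Prop := measurable_fun setT f /\ L1 (fun w => f w ^+ 2).

Lemma L2_cst c : L2 (fun _ => c).
Proof. by split; [exact: measurable_cst|exact: L1_cst]. Qed.

Lemma L2M f g : L2 f -> L2 g -> L1 (fun w => f w * g w).
Proof.
move=> [mf f2] [mg g2]; apply: L1_le (L1D f2 g2); first exact: measurable_funM.
move=> w; rewrite ler_norml.
by have := sqr_ge0 (f w + g w); have := sqr_ge0 (f w - g w); rewrite sqrrB sqrrD; nra.
Qed.

Lemma L2_L1 f : L2 f -> L1 f.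
Proof. by move=> f2; have := L2M f2 (L2_cst 1); under eq_fun do rewrite mulr1. Qed.

Lemma L2D f g : L2 f -> L2 g -> L2 (fun w => f w + g w).
Proof.
move=> f2 g2; split; first exact: measurable_funD f2.1 g2.1.
under eq_fun do rewrite sqrrD -mulr_natl.
by apply: L1D g2.2; apply: L1D f2.2 _; apply: L1Z; exact: L2M.
Qed.

Lemma L2Z c f : L2 f -> L2 (fun w => c * f w).
Proof.
move=> f2; split; first exact: measurable_funM (measurable_cst _) f2.1.
by under eq_fun do rewrite exprMn; apply: L1Z f2.2.
Qed.

Lemma L2B f g : L2 f -> L2 g -> L2 (fun w => f w - g w).
Proof.
move=> f2 g2; under eq_fun do rewrite -mulN1r.
by apply: L2D => //; exact: L2Z.
Qed.

Lemma L2_sum (I : Type) (s : seq I) (F : I -> T -> R) :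
  (forall i, L2 (F i)) -> L2 (fun w => \sum_(i <- s) F i w).
Proof.
move=> F2; elim: s => [|i s IH].
  by under eq_fun do rewrite big_nil; exact: L2_cst.
by under eq_fun do rewrite big_cons; exact: L2D.
Qed.

(** Nonnegativity of the variance. *)
Lemma Ex_sqr_ge f : L2 f -> Ex f ^+ 2 <= Ex (fun w => f w ^+ 2).
Proof.
move=> f2; have f1 := L2_L1 f2; set m := Ex f.
have : 0 <= Ex (fun w => f w ^+ 2 - 2 * m * f w + m ^+ 2).
  by apply: Ex_ge0 => w; have := sqr_ge0 (f w - m); rewrite sqrrB; nra.
rewrite ExD ?ExB ?ExZ ?Ex_cst //; try exact: L1Z; try exact: L1_cst; first by rewrite -/m; nra.
- exact: f2.2.
- by apply: L1B; [exact: f2.2|exact: L1Z].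
Qed.

Definition mxL2 m n (X : T -> 'M[R]_(m, n)) := forall i j, L2 (fun w => X w i j).

Lemma mxL2_measurable m n (X : T -> 'M[R]_(m, n)) : mxL2 X -> mx_measurable X.
Proof. by move=> X2 i j; have [] := X2 i j. Qed.

Lemma mxL2P m n (X : T -> 'M[R]_(m, n)) :
  mx_measurable X -> L1 (fun w => sqnorm (X w)) -> mxL2 X.
Proof.
move=> mX X1 i j; split; first exact: mX.
apply: L1_le X1; first by apply: measurable_funX.
move=> w; rewrite ger0_norm ?sqr_ge0 // /sqnorm (bigD1 i) //= (bigD1 j) //= -addrA lerDl.
by rewrite addr_ge0 //; do ![apply: sumr_ge0 => ? _]; rewrite sqr_ge0.
Qed.

Lemma mxL2_dot m n (X Y : T -> 'M[R]_(m, n)) :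
  mxL2 X -> mxL2 Y -> L1 (fun w => dot (X w) (Y w)).
Proof. by move=> X2 Y2; apply: L1_sum => i; apply: L1_sum => j; exact: L2M. Qed.

Lemma mxL2_sqnorm m n (X : T -> 'M[R]_(m, n)) : mxL2 X -> L1 (fun w => sqnorm (X w)).
Proof. by move=> X2; apply: L1_sum => i; apply: L1_sum => j; exact: (X2 i j).2. Qed.

Lemma mxL2D m n (X Y : T -> 'M[R]_(m, n)) :
  mxL2 X -> mxL2 Y -> mxL2 (fun w => X w + Y w).
Proof. by move=> X2 Y2 i j; under eq_fun do rewrite mxE; exact: L2D. Qed.

Lemma mxL2Z m n c (X : T -> 'M[R]_(m, n)) : mxL2 X -> mxL2 (fun w => c *: X w).
Proof. by move=> X2 i j; under eq_fun do rewrite mxE; exact: L2Z. Qed.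

Lemma mxL2B m n (X Y : T -> 'M[R]_(m, n)) :
  mxL2 X -> mxL2 Y -> mxL2 (fun w => X w - Y w).
Proof. by move=> X2 Y2 i j; under eq_fun do rewrite !mxE; exact: L2B. Qed.

Lemma mxL2_sum m n (I : Type) (s : seq I) (X : I -> T -> 'M[R]_(m, n)) :
  (forall i, mxL2 (X i)) -> mxL2 (fun w => \sum_(i <- s) X i w).
Proof. by move=> X2 i j; under eq_fun do rewrite summxE; apply: L2_sum => k; exact: X2. Qed.

Lemma mxL2_row m n (X : T -> 'M[R]_(m, n)) i : mxL2 X -> mxL2 (fun w => row i (X w)).
Proof. by move=> X2 k j; under eq_fun do rewrite mxE; exact: X2. Qed.

Lemma mxL2_mean_row N p (X : T -> 'M[R]_(N, p)) :
  mxL2 X -> mxL2 (fun w => mean_row (X w)).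
Proof. by move=> X2; apply: mxL2Z; apply: mxL2_sum => i; exact: mxL2_row. Qed.

Lemma Ex_dot m n (X Y : T -> 'M[R]_(m, n)) : mxL2 X -> mxL2 Y ->
  Ex (fun w => dot (X w) (Y w)) = \sum_i \sum_j Ex (fun w => X w i j * Y w i j).
Proof.
move=> X2 Y2; rewrite Ex_sum => [|i]; last by apply: L1_sum => j; exact: L2M.
by apply: eq_bigr => i _; rewrite Ex_sum => // j; exact: L2M.
Qed.

Lemma Ex_sqnorm_rows m n (X : T -> 'M[R]_(m, n)) : mxL2 X ->
  Ex (fun w => sqnorm (X w)) = \sum_i Ex (fun w => sqnorm (row i (X w))).
Proof.
move=> X2; under [in LHS]eq_fun do rewrite sqnorm_rows.
by rewrite Ex_sum // => i; apply: mxL2_sqnorm; exact: mxL2_row.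
Qed.

End Moments.

(** * Bounds and orthogonality by freezing the past *)

Section Orthogonality.
Context (R : realType) (dO : measure_display) (Om : measurableType dO).
Context (P : probability Om R) (d1 dS : measure_display).
Context (T1 : measurableType d1) (S : measurableType dS).
Context (X : {RV P >-> T1}) (eta : {RV P >-> S}) (mu : probability S R).
Hypothesis eta_mu : has_law P eta mu.
Hypothesis eta_X : forall A B, measurable A -> measurable B ->
  P (X @^-1` A `&` eta @^-1` B) = (P (X @^-1` A) * P (eta @^-1` B))%E.

(** A bound that holds at every frozen value of [X] holds in mean at the random value. *)
Lemma freezing_le (h : T1 * S -> R) (c : T1 -> R) :
  measurable_fun setT h -> (forall z, 0 <= h z) -> measurable_fun setT c ->
  (forall t, (\int[mu]_s (h (t, s))%:E <= (c t)%:E)%E) ->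
  L1 P (fun w => c (X w)) ->
  L1 P (fun w => h (X w, eta w)) /\ Ex P (fun w => h (X w, eta w)) <= Ex P (fun w => c (X w)).
Proof.
move=> mh h0 mc hc c1; apply: ge0_L1 => //.
  exact: (measurableT_comp mh (measurable_fun_pair _ _)).
rewrite (@ge0_freezing _ _ _ P _ _ _ _ X eta mu eta_mu eta_X (fun z => (h z)%:E)) //;
    last exact/measurable_EFinP.
rewrite -integral_Ex //; apply: ge0_le_integral => //.
- by move=> w _; apply: integral_ge0 => s _; rewrite lee_fin.
- apply: (measurableT_comp (f := fun t => (\int[mu]_s (h (t, s))%:E)%E)) => //.
  apply: (@measurable_fun_fubini_tonelli_F _ _ _ _ _ _ (fun z => (h z)%:E)).
    exact/measurable_EFinP.
  by move=> z; rewrite lee_fin.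
- exact/measurable_EFinP/(measurableT_comp mc).
Qed.

(** With [X] frozen at t the factor [A t] is constant and h(t, eta) has mean [g t], so the inner
    integral vanishes. *)
Lemma freezing_orthogonal (A : T1 -> R) (h : T1 * S -> R) (g : T1 -> R) :
  measurable_fun setT A -> measurable_fun setT h -> measurable_fun setT g ->
  (forall t, (\int[mu]_s (h (t, s))%:E = (g t)%:E)%E) ->
  L2 P (fun w => A (X w)) -> L2 P (fun w => h (X w, eta w) - g (X w)) ->
  Ex P (fun w => A (X w) * (h (X w, eta w) - g (X w))) = 0.
Proof.
move=> mA mh mg hg A2 e2.
pose k (z : T1 * S) : R := A z.1 * (h z - g z.1).
have mk : measurable_fun setT k.
  apply: measurable_funM; first exact: (measurableT_comp mA).
  by apply: measurable_funB => //; exact: (measurableT_comp mg).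
have k1 : L1 P (fun w => k (X w, eta w)) by exact: L2M.
have mht t : measurable_fun setT (fun s => h (t, s)).
  by apply: (measurableT_comp mh); exact: pair1_measurable.
(* A finite value of the integral already forces integrability. *)
have hi t : L1 mu (fun s => h (t, s)).
  apply/integrableP; split; first exact/measurable_EFinP.
  have : (\int[mu]_s (h (t, s))%:E)%E \is a fin_num by rewrite hg.
  by rewrite integral_fin_num_abs.
rewrite /Ex /Rintegral.
rewrite (@freezing _ _ _ P _ _ _ _ X eta mu eta_mu eta_X (fun z => (k z)%:E)) //; last first.
  exact/measurable_EFinP.
rewrite integral0_eq // => w _; rewrite /k /=.
rewrite integral_Ex; last by apply: L1Z; apply: L1B => //; exact: L1_cst.
rewrite ExZ; last by apply: L1B => //; exact: L1_cst.
rewrite ExB //; last exact: L1_cst.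
rewrite Ex_cst; have := hg (X w); rewrite integral_Ex // => -[->].
by rewrite subrr mulr0.
Qed.

End Orthogonality.

(** * The deterministic step *)

Section Shift.
Context (R : realType) (N p : nat).
Hypothesis N0 : (0 < N)%N.
Implicit Types A Y : 'M[R]_(N, p).

Lemma mean_row_const (v : 'rV[R]_p) : mean_row (\matrix_(i < N) v) = v.
Proof.
rewrite /mean_row; under eq_bigr do rewrite rowK.
by rewrite sum_const_mx scalerA mulVf ?scale1r // pnatr_eq0 -lt0n.
Qed.

Lemma perp_shift A v : perp (A - \matrix_(i < N) v) = perp A.
Proof.
apply/row_matrixP => i; rewrite !row_perp mean_rowD mean_rowN rowB rowK mean_row_const.
by rewrite opprD opprK addrACA addNr addr0.
Qed.

(** Bilinear form of the parallel-axis identity: a common shift of the rows moves the mean and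
    leaves the deviations unchanged. *)
Lemma sum_dot_shift Y A v : \sum_i dot (row i Y) (row i A - v) =
  N%:R * dot (mean_row Y) (mean_row A - v) + dot (perp Y) (perp A).
Proof.
rewrite -{2}(mean_row_const v) -mean_rowN -mean_rowD -(perp_shift A v) -(dot_perp N0).
by rewrite dot_rows; apply: eq_bigr => i _; rewrite rowB rowK.
Qed.

Lemma sum_sqnorm_shift A v : \sum_i sqnorm (row i A - v) =
  N%:R * sqnorm (mean_row A - v) + sqnorm (perp A).
Proof.
rewrite -{2}(mean_row_const v) -mean_rowN -mean_rowD -(perp_shift A v).
rewrite -(sqnorm_perp N0).
by rewrite sqnorm_rows; apply: eq_bigr => i _; rewrite rowB rowK.
Qed.

Lemma sqnorm_perp_min A v : sqnorm (perp A) <= \sum_i sqnorm (row i A - v).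
Proof. by rewrite sum_sqnorm_shift lerDr mulr_ge0 ?sqnorm_ge0. Qed.

End Shift.

Section Problem.
Context (R : realType) (N p : nat) (dX : measure_display) (Xi : measurableType dX).
Context (D : 'I_N -> probability Xi R) (F : 'I_N -> 'rV[R]_p -> Xi -> R).
Context (r : 'rV[R]_p -> R) (L sigma phistar : R).
Hypothesis N0 : (0 < N)%N.
Hypothesis pb : problem_assumptions D F r L sigma phistar.

Let lgrad i x := gradient (local_loss D F i) x.

Let L0 : 0 < L. Proof. exact: smoothness_gt0 pb. Qed.
Let N0R : 0 < (N%:R : R). Proof. by rewrite ltr0n. Qed.

Lemma sgrad_measurable d (T : measurableType d) i (X : T -> 'rV[R]_p) (eta : T -> Xi) :
  mx_measurable X -> measurable_fun setT eta ->
  mx_measurable (fun w => sgrad F i (X w) (eta w)).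
Proof.
move=> mX meta; apply: gradient_measurable => //.
  by move=> s x; exact: (sample_loss_differentiable pb).
by move=> x; apply: L1_measurable; exact: (sample_loss_integrable pb).
Qed.

Let msg i a : mx_measurable (fun xi => sgrad F i a xi).
Proof. by apply: sgrad_measurable => //; exact: mx_measurable_cst. Qed.

Lemma sgrad_mxL2 i a : mxL2 (D i) (fun xi => sgrad F i a xi).
Proof.
have h : mxL2 (D i) (fun xi => (sgrad F i a xi - lgrad i a) + lgrad i a).
  apply: mxL2D; last by move=> ? ?; exact: L2_cst.
  have m1 : mx_measurable (fun xi => sgrad F i a xi - lgrad i a).
    by apply: mx_measurableB => //; exact: mx_measurable_cst.
  apply: mxL2P => //.
  by have [] := ge0_L1 (measurable_sqnorm m1) (fun=> sqnorm_ge0 _) (sgrad_variance pb i a).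
by move=> k j; have := h k j; under eq_fun do rewrite subrK.
Qed.

Lemma sgrad_Ex i a j : Ex (D i) (fun xi => sgrad F i a xi 0 j) = lgrad i a 0 j.
Proof.
have := sgrad_unbiased pb i a j; rewrite integral_Ex => [[]//|].
by apply: L2_L1; exact: sgrad_mxL2.
Qed.

(** By unbiasedness the difference of gradients is the mean of the sampled differences, and a
    squared mean is at most the mean square, entry by entry. *)
Lemma lgrad_lipschitz i a b : sqnorm (lgrad i a - lgrad i b) <= L ^+ 2 * sqnorm (a - b).
Proof.
have h2 : mxL2 (D i) (fun xi => sgrad F i a xi - sgrad F i b xi).
  by apply: mxL2B; exact: sgrad_mxL2.
have [_] := ge0_L1 (L1_measurable (mxL2_sqnorm h2)) (fun=> sqnorm_ge0 _)
    (mean_square_smooth pb i a b).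
apply: le_trans.
rewrite (_ : (fun w => sqnorm _) = (fun w => dot (sgrad F i a w - sgrad F i b w)
    (sgrad F i a w - sgrad F i b w))); last first.
  by apply/funext => w; rewrite sqnormE.
rewrite Ex_dot // sqnormE /dot; apply: ler_sum => k _; apply: ler_sum => j _.
rewrite (ord1 k) -!expr2.
have -> : (lgrad i a - lgrad i b) 0 j = Ex (D i) (fun xi => (sgrad F i a xi - sgrad F i b xi) 0 j).
  under eq_fun do rewrite mxBE.
  by rewrite mxBE ExB ?sgrad_Ex //; apply: L2_L1; exact: sgrad_mxL2.
exact: Ex_sqr_ge.
Qed.

Lemma lgrad_measurable d (T : measurableType d) i (X : T -> 'rV[R]_p) :
  mx_measurable X -> mx_measurable (fun w => lgrad i (X w)).
Proof.
move=> mX k j; apply: (@continuous_mx_measurable R d T p (fun x => lgrad i x k j) X) => //.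
apply: (@sqnorm_lipschitz_continuous _ _ _ (L ^+ 2)) => x y.
apply: le_trans (lgrad_lipschitz i x y).
rewrite /sqnorm (bigD1 k) //= (bigD1 j) //= mxBE -addrA lerDl.
by rewrite addr_ge0 //; do ![apply: sumr_ge0 => ? _]; rewrite sqr_ge0.
Qed.

Lemma avg_lossE : avg_loss D F = (N%:R^-1 : R) *: \sum_i (local_loss D F i : 'rV[R]_p -> R^o).
Proof. by apply/funext => x; rewrite /avg_loss fctE fct_sumE. Qed.

Let ldiff i x : differentiable (local_loss D F i : 'rV[R]_p -> R^o) x.
Proof. exact: (local_loss_differentiable pb). Qed.

Lemma avg_loss_differentiable x : differentiable (avg_loss D F : 'rV[R]_p -> R^o) x.
Proof. by rewrite avg_lossE; apply: differentiableZ; apply: differentiable_sum. Qed.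

Lemma gradient_avg_loss x :
  gradient (avg_loss D F) x = mean_row (\matrix_(i < N) lgrad i x).
Proof.
apply/rowP => j; rewrite mean_rowE mxE avg_lossE.
have dl i : derivable (local_loss D F i : 'rV[R]_p -> R^o) x (delta_mx 0 j).
  exact: diff_derivable.
rewrite deriveZ ?derive_sum //; last exact: derivable_sum.
by congr (_ * _); apply: eq_bigr => i _; rewrite !mxE.
Qed.

(** The factor 1 / N comes from Pythagoras: N |mean M|^2 <= |M|^2. *)
Lemma mean_lgrad_lipschitz (A B : 'M[R]_(N, p)) :
  sqnorm (mean_row (\matrix_(i < N) lgrad i (row i A)) - mean_row (\matrix_(i < N)
      lgrad i (row i B)))
   <= L ^+ 2 / N%:R * sqnorm (A - B).
Proof.
rewrite -mean_rowN -mean_rowD; set M := _ - _.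
have MM : sqnorm M <= L ^+ 2 * sqnorm (A - B).
  rewrite !sqnorm_rows mulr_sumr; apply: ler_sum => i _.
  by rewrite rowB !rowK rowB; exact: lgrad_lipschitz.
rewrite mulrAC ler_pdivlMr // mulrC; apply: le_trans MM.
by rewrite [leRHS](sqnorm_perp N0) lerDl sqnorm_ge0.
Qed.

Lemma avg_grad_lipschitz x y :
  sqnorm (gradient (avg_loss D F) x - gradient (avg_loss D F) y) <= L ^+ 2 * sqnorm (x - y).
Proof.
have e z : gradient (avg_loss D F) z =
    mean_row (\matrix_(i < N) lgrad i (row i (\matrix_(i < N) z))).
  by rewrite gradient_avg_loss; congr mean_row; apply/row_matrixP => i; rewrite !rowK.
rewrite !e; apply: le_trans (mean_lgrad_lipschitz _ _) _.
rewrite [X in _ * X]sqnorm_rows (eq_bigr (fun _ => sqnorm (x - y))) => [|i _]; last first.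
  by rewrite rowB !rowK.
rewrite sumr_const card_ord -[sqnorm _ *+ N]mulr_natl mulrA divfK //.
by rewrite gt_eqF.
Qed.

Lemma avg_grad_mean_le (X : 'M[R]_(N, p)) :
  sqnorm (gradient (avg_loss D F) (mean_row X) - mean_row (\matrix_(i < N) lgrad i (row i X)))
    <= L ^+ 2 / N%:R * sqnorm (perp X).
Proof.
rewrite gradient_avg_loss.
have -> : \matrix_(i < N) lgrad i (mean_row X) =
    \matrix_(i < N) lgrad i (row i (avgmx R N *m X)).
  by apply/row_matrixP => i; rewrite !rowK row_avgmx.
apply: le_trans (mean_lgrad_lipschitz _ _) _.
by rewrite -[X in sqnorm X]opprB sqnormN.
Qed.

Lemma objectiveE x : objective D F r x = avg_loss D F x + r x.
Proof.
rewrite /objective /local_objective big_split mulrDr sumr_const card_ord.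
by rewrite -[r x *+ N]mulr_natl mulrA mulVf ?mul1r // gt_eqF.
Qed.

(** * One iteration along a fixed path *)

Section Step.
Context (E : rel 'I_N) (W : 'M[R]_N) (T : nat) (a : R).
Hypotheses (mixW : mixing_matrix E W) (a0 : 0 < a).
Let d : R := 1 - mix_rho_tilde W T.
Hypotheses (T0 : (0 < T)%N) (aL : a * L <= d ^+ 2 / 64).

Let d01 : 0 < d <= 1.
Proof. by rewrite subr_gt0 (mix_rho_tilde_lt1 N0 mixW) //= gerBl mix_rho_tilde_ge0. Qed.

Context (X Y Dm : 'M[R]_(N, p)).
Hypothesis YD : mean_row Y = mean_row Dm.

Let Z := cheb_mix W T X.
Let P v := prox (fun u => a * r u) v.
Let X' := \matrix_(i < N) P (row i Z - a *: row i Y).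
Let res := \matrix_(i < N) (row i Dm - lgrad i (row i X)).

Let three := prox_three_point (regularizer_convex pb) a0 (fun v => regularizer_prox pb v a0).
Let nonexp := prox_nonexpansive (regularizer_convex pb) a0 (fun v => regularizer_prox pb v a0).

Let meanZ : mean_row Z = mean_row X. Proof. exact: (mean_row_cheb N0 mixW). Qed.

Let perpZ_le : sqnorm (perp Z) <= (1 - d) ^+ 2 * sqnorm (perp X).
Proof. by rewrite subKr; exact: (perp_cheb N0 mixW). Qed.

(** Deviations from the mean are the smallest deviations from a common point. Choosing that point as
    the proximal image of the mean argument lets nonexpansiveness reduce everything to the
    deviations of Z - a Y. *)
Lemma perp_step : sqnorm (perp X') <= (1 - d) * sqnorm (perp X) + a ^+ 2 / d * sqnorm (perp Y).
Proof.
apply: le_trans (sqnorm_perp_min N0 _ (P (mean_row Z - a *: mean_row Y))) _.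
apply: (@le_trans _ _ (sqnorm (perp (Z - a *: Y)))).
  rewrite [leRHS]sqnorm_rows; apply: ler_sum => i _; rewrite rowK.
  apply: le_trans (nonexp _ _) _.
  by rewrite row_perp // mean_rowD mean_rowN mean_rowZ rowB rowZ.
rewrite perpD perpN perpZ.
have /sqnormD_conv := perpZ_le; move/(_ (- (a *: perp Y)) (a ^+ 2 * sqnorm (perp Y)) d01).
rewrite sqnormN sqnormZ lexx => /(_ isT)/le_trans; apply.
by rewrite mulrA (mulrC d^-1).
Qed.

Lemma mean_res : mean_row res = mean_row Y - mean_row (\matrix_(i < N) lgrad i (row i X)).
Proof.
rewrite YD -mean_rowN -mean_rowD; congr mean_row.
by apply/row_matrixP => i; rewrite rowB !rowK.
Qed.

(* The proximal inequality of agent i is tested at the mean iterate. *)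
Lemma prox_descent : r (mean_row X') <= r (mean_row X) - dot (mean_row Y) (mean_row X' - mean_row X)
   - N%:R^-1 * dot (perp Y) (perp X')
   + (2 * a * N%:R)^-1 * (sqnorm (perp Z) - sqnorm (X' - Z) - sqnorm (perp X'))
   - (2 * a)^-1 * sqnorm (mean_row X' - mean_row X).
Proof.
apply: le_trans (convex_mean_row (regularizer_convex pb) _ N0) _.
set x := mean_row X.
have key i : r (row i X') <= r x + dot (row i Y) (x - row i X') + (2 * a)^-1 *
    (sqnorm (x - row i Z) - sqnorm (row i X' - row i Z) - sqnorm (row i X' - x)).
  have := three (row i Z - a *: row i Y) x.
  rewrite -[prox _ _]/(P _).
  have -> : P (row i Z - a *: row i Y) = row i X' by rewrite rowK.
  move: (row i X') (row i Z) (row i Y) => x' z y.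
  have -> : x' - (z - a *: y) = (x' - z) + a *: y by rewrite opprD opprK addrA.
  have -> : x - (z - a *: y) = (x - z) + a *: y by rewrite opprD opprK addrA.
  rewrite (sqnormD (x' - z)) (sqnormD (x - z)) !sqnormZ !dotZr => h.
  have -> : sqnorm (x' - x) = sqnorm (x - x') by rewrite -sqnormN opprB.
  have e : dot (x - z) y - dot (x' - z) y = dot y (x - x').
    by rewrite -dotNl -dotDl opprB addrA subrK dotC.
  rewrite -(ler_pM2l a0).
  have -> : a * (r x + dot y (x - x') + (2 * a)^-1 *
     (sqnorm (x - z) - sqnorm (x' - z) - sqnorm (x - x'))) =
     a * r x + a * dot y (x - x') + 2^-1 * (sqnorm (x - z) - sqnorm (x' - z) - sqnorm (x - x')).
    by field; rewrite gt_eqF.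
  by rewrite -e; lra.
apply: (@le_trans _ _ (N%:R^-1 * \sum_i (r x + dot (row i Y) (x - row i X') + (2 * a)^-1 *
    (sqnorm (x - row i Z) - sqnorm (row i X' - row i Z) - sqnorm (row i X' - x))))).
  by rewrite ler_wpM2l ?invr_ge0 ?(ltW N0R) //; apply: ler_sum.
have sum_const (c : R) : \sum_(i < N) c = N%:R * c by rewrite sumr_const card_ord mulr_natl.
rewrite !big_split /= sum_const -mulr_sumr !big_split /= !sumrN.
have -> : \sum_i sqnorm (x - row i Z) = sqnorm (perp Z).
  rewrite sqnorm_rows; apply: eq_bigr => i _.
  by rewrite row_perp // meanZ -sqnormN opprB.
have -> : \sum_i sqnorm (row i X' - row i Z) = sqnorm (X' - Z).
  by rewrite sqnorm_rows; apply: eq_bigr => i _; rewrite rowB.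
rewrite (sum_sqnorm_shift N0).
have -> : \sum_i dot (row i Y) (x - row i X') =
    - (N%:R * dot (mean_row Y) (mean_row X' - x) + dot (perp Y) (perp X')).
  rewrite -(sum_dot_shift N0) -sumrN.
  by apply: eq_bigr => i _; rewrite -dotNr opprB.
apply: le_of_eq.
by field; rewrite !gt_eqF.
Qed.

Lemma objective_descent : objective D F r (mean_row X') <= objective D F r (mean_row X)
  + 3 * a / 2 * sqnorm (mean_row res) + 6 * a * L ^+ 2 / N%:R * sqnorm (perp X)
  + (L / 2 + 5 / (24 * a) - (2 * a)^-1) * sqnorm (mean_row X' - mean_row X)
  + 3 * a / N%:R * sqnorm (perp Y)
  + (2 * a * N%:R)^-1 * (sqnorm (perp Z) - sqnorm (X' - Z) - 5 / 6 * sqnorm (perp X')).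
Proof.
rewrite !objectiveE; have h1 := prox_descent.
have h2 := descent_lemma (mean_row X) (mean_row X') L0 avg_loss_differentiable avg_grad_lipschitz.
set dx := mean_row X' - mean_row X in h1 h2 *.
set g := gradient (avg_loss D F) (mean_row X) - mean_row (\matrix_(i < N) lgrad i (row i X)).
have gX : sqnorm g <= L ^+ 2 / N%:R * sqnorm (perp X) by exact: avg_grad_mean_le.
(* Young's weights: 3a and 12a charge 1 / (6a) + 1 / (24a) = 5 / (24a) to |dx|^2, and 6a uses up one
   sixth of the available 1 / (2a) in front of |X'_perp|^2. *)
have a3 : 0 < 3 * a by rewrite mulr_gt0.
have a12 : 0 < 12 * a by rewrite mulr_gt0.
have a6 : 0 < 6 * a by rewrite mulr_gt0.
have h3 := dot_young (- mean_row res) dx a3.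
have h4 := dot_young g dx a12.
have h5 := dot_young (- perp Y) (perp X') a6.
have e : dot (gradient (avg_loss D F) (mean_row X)) dx - dot (mean_row Y) dx =
    dot g dx + dot (- mean_row res) dx.
  by rewrite -dotNl -!dotDl mean_res; congr (dot _ _); rewrite opprB addrA subrK.
rewrite sqnormN dotNl in h3; rewrite sqnormN dotNl in h5; rewrite dotNl in e.
have h4' : dot g dx <= 6 * a * (L ^+ 2 / N%:R * sqnorm (perp X)) + (24 * a)^-1 * sqnorm dx.
  apply: le_trans h4 _; apply: lerD.
    have -> : 12 * a / 2 = 6 * a by field.
    by rewrite ler_pM2l.
  by rewrite mulrA -natrM.
have h5' : - (N%:R^-1 * dot (perp Y) (perp X')) <= N%:R^-1 * (3 * a * sqnorm (perp Y) +
    (12 * a)^-1 * sqnorm (perp X')).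
  rewrite -mulrN ler_wpM2l ?invr_ge0 ?(ltW N0R) //; apply: le_trans h5 _.
  have -> : 6 * a / 2 = 3 * a by field.
  by rewrite mulrA -natrM.
have -> : (L / 2 + 5 / (24 * a) - (2 * a)^-1) * sqnorm dx =
   L / 2 * sqnorm dx + (24 * a)^-1 * sqnorm dx + (2 * (3 * a))^-1 * sqnorm dx - (2 * a)^-1 *
       sqnorm dx.
  by field; rewrite gt_eqF.
have -> : (2 * a * N%:R)^-1 * (sqnorm (perp Z) - sqnorm (X' - Z) - 5 / 6 * sqnorm (perp X')) =
  (2 * a * N%:R)^-1 * (sqnorm (perp Z) - sqnorm (X' - Z) - sqnorm (perp X')) +
  N%:R^-1 * ((12 * a)^-1 * sqnorm (perp X')).
  by field; rewrite !gt_eqF.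
have -> : 6 * a * L ^+ 2 / N%:R * sqnorm (perp X) = 6 * a * (L ^+ 2 / N%:R * sqnorm (perp X)).
  by rewrite !mulrA.
have -> : 3 * a / N%:R * sqnorm (perp Y) = N%:R^-1 * (3 * a * sqnorm (perp Y)) by ring.
rewrite mulrDr in h5'.
lra.
Qed.

(** The proximal gradient map at z_i differs from (z_i - x'_i) / a only by having the gradient of f
    at z_i in place of y_i. Nonexpansiveness bounds the effect by their distance, split into
    tracking error, mean residual, [g], and the variation of the gradient from the mean iterate to
    z_i. The constant 17 is 8 from [g], 8 from that variation and 1 from the consensus term of the
    gap. *)
Lemma stationarity_gap_le : stationarity_gap D F r L a Z <=
  2 / (a ^+ 2 * N%:R) * sqnorm (X' - Z) + 8 / N%:R * sqnorm (perp Y)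
  + 8 * sqnorm (mean_row res) + 17 * L ^+ 2 / N%:R * sqnorm (perp X).
Proof.
have ZX : sqnorm (perp Z) <= sqnorm (perp X).
  have /andP[d0 d1] := d01.
  by apply: le_trans perpZ_le _; rewrite ler_piMl ?sqnorm_ge0 // expr_le1 //; lra.
set gf := gradient (avg_loss D F).
set g := mean_row (\matrix_(i < N) lgrad i (row i X)) - gf (mean_row X).
have gX : sqnorm g <= L ^+ 2 / N%:R * sqnorm (perp X).
  by rewrite /g -opprB sqnormN; exact: avg_grad_mean_le.
have key i : sqnorm (prox_grad_map r (row i Z) (gf (row i Z)) a) <=
   2 / a ^+ 2 * sqnorm (row i (X' - Z)) + 8 * sqnorm (row i (perp Y)) + 8 * sqnorm (mean_row res)
   + 8 * sqnorm g + 8 * L ^+ 2 * sqnorm (row i (perp Z)).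
  rewrite /prox_grad_map -/(P _).
  have -> : row i Z - P (row i Z - a *: gf (row i Z)) =
     (row i Z - row i X') + (P (row i Z - a *: row i Y) - P (row i Z - a *: gf (row i Z))).
    by rewrite rowK addrA subrK.
  rewrite sqnormZ; set u := row i Z - row i X'; set v := P _ - P _.
  have vle : sqnorm v <= a ^+ 2 * sqnorm (row i Y - gf (row i Z)).
    apply: le_trans (nonexp _ _) _; rewrite opprD opprK addrACA subrr add0r addrC.
    by rewrite -scalerBr sqnormZ -[in leLHS]opprB sqnormN.
  have yle : sqnorm (row i Y - gf (row i Z)) <= 4 * sqnorm (row i (perp Y)) +
      4 * sqnorm (mean_row res)
     + 4 * sqnorm g + 4 * (L ^+ 2 * sqnorm (row i (perp Z))).
    have -> : row i Y - gf (row i Z) = (row i (perp Y) + mean_row res) + (g + (gf (mean_row X)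
        - gf (row i Z))).
      rewrite row_perp // mean_res /g.
      move: (row i Y) (gf (row i Z)) (gf (mean_row X)) (mean_row Y) => u1 u2 u3 u4.
      by move: (mean_row _) => u5; apply/rowP => j; rewrite !mxE; ring.
    apply: le_trans (sqnormD4_le _ _ _ _) _; rewrite lerD2l ler_pM2l //.
    apply: le_trans (avg_grad_lipschitz (mean_row X) (row i Z)) _.
    by rewrite ler_pM2l ?exprn_gt0 // row_perp // meanZ -(sqnormN (row i Z - _)) opprB.
  have uE : sqnorm u = sqnorm (row i (X' - Z)) by rewrite /u -sqnormN opprB rowB.
  have l1 := sqnormD_le u v.
  have a2 : 0 < a ^+ 2 by rewrite exprn_gt0.
  rewrite exprVn -(ler_pM2l a2) mulrA mulfV ?gt_eqF // mul1r.
  apply: le_trans l1 _; rewrite uE.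
  have -> : a ^+ 2 * (2 / a ^+ 2 * sqnorm (row i (X' - Z)) + 8 * sqnorm (row i (perp Y)) +
     8 * sqnorm (mean_row res) + 8 * sqnorm g + 8 * L ^+ 2 * sqnorm (row i (perp Z))) =
     2 * sqnorm (row i (X' - Z)) + 2 * (a ^+ 2 * (4 * sqnorm (row i (perp Y)) +
     4 * sqnorm (mean_row res) + 4 * sqnorm g + 4 * (L ^+ 2 * sqnorm (row i (perp Z))))).
    by field; rewrite gt_eqF.
  by rewrite lerD2l ler_pM2l //; apply: le_trans vle _; rewrite ler_pM2l.
rewrite /stationarity_gap.
apply: (@le_trans _ _ (N%:R^-1 * \sum_i (2 / a ^+ 2 * sqnorm (row i (X' - Z)) +
    8 * sqnorm (row i (perp Y)) + 8 * sqnorm (mean_row res)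
   + 8 * sqnorm g + 8 * L ^+ 2 * sqnorm (row i (perp Z))) + L ^+ 2 / N%:R * sqnorm (perp Z))).
  by rewrite lerD2r ler_wpM2l ?invr_ge0 ?(ltW N0R) //; apply: ler_sum.
have sum_const (c : R) : \sum_(i < N) c = N%:R * c by rewrite sumr_const card_ord mulr_natl.
rewrite !big_split /= !sum_const -!mulr_sumr -!sqnorm_rows.
have -> : N%:R^-1 * (2 / a ^+ 2 * sqnorm (X' - Z) + 8 * sqnorm (perp Y) +
    N%:R * (8 * sqnorm (mean_row res)) +
   N%:R * (8 * sqnorm g) + 8 * L ^+ 2 * sqnorm (perp Z)) + L ^+ 2 / N%:R * sqnorm (perp Z) =
   2 / (a ^+ 2 * N%:R) * sqnorm (X' - Z) + 8 / N%:R * sqnorm (perp Y) + 8 * sqnorm (mean_row res)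
   + (8 * sqnorm g + 9 * (L ^+ 2 / N%:R * sqnorm (perp Z))).
  by field; rewrite !gt_eqF.
rewrite lerD2l.
have : L ^+ 2 / N%:R * sqnorm (perp Z) <= L ^+ 2 / N%:R * sqnorm (perp X).
  by rewrite ler_wpM2l // divr_ge0 // ?sqr_ge0 // ltW.
have -> : 17 * L ^+ 2 / N%:R * sqnorm (perp X) = 17 * (L ^+ 2 / N%:R * sqnorm (perp X))
    by rewrite !mulrA.
lra.
Qed.

(** Adding a / 8 times the gap costs |X' - Z|^2 / (4aN), half of what the proximal inequality leaves
    available. *)
Lemma step_inequality :
  objective D F r (mean_row X') + a / 8 * stationarity_gap D F r L a Z <=
  objective D F r (mean_row X) - (4 * a * N%:R)^-1 * sqnorm (X' - X)
  + 5 * a / 2 * sqnorm (mean_row res) + 2 / (a * N%:R) * sqnorm (perp X)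
  + (8 * N%:R * L)^-1 * sqnorm (perp Y).
Proof.
have h1 := objective_descent; have h2 := stationarity_gap_le; have h3 := perp_step.
have /andP[d0 d1] := d01.
have h4 : sqnorm (X' - X) <= N%:R * sqnorm (mean_row X' - mean_row X) + 2 * sqnorm (perp X') +
    2 * sqnorm (perp X).
  rewrite (sqnorm_perp N0 (X' - X)) mean_rowD mean_rowN -addrA lerD2l.
  by rewrite perpD perpN; exact: sqnormB_le.
have h5 : sqnorm (perp Z) <= sqnorm (perp X).
  by apply: le_trans perpZ_le _; rewrite ler_piMl ?sqnorm_ge0 // expr_le1 //; lra.
move: (objective D F r (mean_row X')) (objective D F r (mean_row X)) h1 => phi' phi h1.
move: (stationarity_gap D F r L a Z) h2 => gap h2.
have x0 := sqnorm_ge0 (perp X); have y0 := sqnorm_ge0 (perp Y).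
have x'0 := sqnorm_ge0 (perp X').
have v0 := sqnorm_ge0 (mean_row X' - mean_row X).
have u0 := sqnorm_ge0 (X' - Z).
move: (sqnorm (perp X)) (sqnorm (perp Y)) (sqnorm (perp X')) (sqnorm (perp Z))
  (sqnorm (X' - Z)) (sqnorm (X' - X)) (sqnorm (mean_row X' - mean_row X))
  (sqnorm (mean_row res)) h1 h2 h3 h4 h5 x0 y0 x'0 v0 u0.
move=> x y x' z u m v b h1 h2 h3 h4 h5 x0 y0 x'0 v0 u0.
have d2 : d ^+ 2 <= d by rewrite expr2 ler_piMl // ltW.
pose k := (a * N%:R)^-1; have k0 : 0 < k by rewrite invr_gt0 mulr_gt0.
pose j := a / N%:R; have j0 : 0 < j by rewrite divr_gt0.
have aL0 : 0 < a * L by rewrite mulr_gt0.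
have aL1 : a * L <= d / 64 by apply: le_trans aL _; rewrite ler_pM2r // invr_gt0.
have aL2 : a * L <= 64^-1 by apply: le_trans aL1 _; rewrite ler_piMl // invr_ge0.
(* As a L <= 1/64, the coefficient of |dx|^2 is at most -1 / (4a); [h4] then trades |dx|^2 for |X' -
   X|^2, at the cost of the consensus errors of X and X'. *)
have f1 : (L / 2 + 5 / (24 * a) - (2 * a)^-1) * v <= - (k * m / 4) + k * (x' + x) / 2.
  apply: (@le_trans _ _ (- (4 * a)^-1 * v)).
    rewrite ler_wpM2r // -(ler_pM2l a0).
    have -> : a * (L / 2 + 5 / (24 * a) - (2 * a)^-1) = a * L / 2 + 5 / 24 - 1 / 2 by field;
        rewrite gt_eqF.
    have -> : a * - (4 * a)^-1 = - (1 / 4) by field; rewrite gt_eqF.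
    lra.
  have -> : - (4 * a)^-1 * v = - (k * (N%:R * v)) / 4 by rewrite /k; field; rewrite !gt_eqF.
  have := ler_wpM2l (ltW k0) h4; lra.
have f2 : a / 8 * gap <= k * u / 4 + j * y + a * b + 17 / 8 * (a * L ^+ 2 / N%:R * x).
  apply: (le_trans (ler_wpM2l _ h2)); first by rewrite divr_ge0 // ltW.
  apply: le_of_eq.
  by rewrite /k /j; field; rewrite !gt_eqF.
have f3 : k * x' <= k * x + j / d * y.
  apply: (@le_trans _ _ (k * ((1 - d) * x + a ^+ 2 / d * y))); first by rewrite ler_wpM2l // ltW.
  have -> : k * ((1 - d) * x + a ^+ 2 / d * y) = k * x - k * (d * x) + j / d * y.
    by rewrite /k /j; field; rewrite !gt_eqF.
  by rewrite lerD2r lerBlDr lerDl mulr_ge0 ?(ltW k0) // mulr_ge0 // ltW.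
have f4 : a * L ^+ 2 / N%:R * x <= k * x / 64.
  have -> : a * L ^+ 2 / N%:R * x = (a * L) ^+ 2 * (k * x) by rewrite /k; field; rewrite !gt_eqF.
  rewrite [leRHS]mulrC ler_wpM2r ?mulr_ge0 ?(ltW k0) //.
  by rewrite expr2; nra.
(* The tracking error is charged 3j by the descent, j by the gap, and j / (12d) through [perp_step],
   because (1/2 - 5/12) k x' = k x' / 12 is left over. *)
have f5 : (4 * j + j / d / 12) * y <= (8 * N%:R * L)^-1 * y.
  rewrite ler_wpM2r // .
  have -> : (8 * N%:R * L)^-1 = j / d * (d / (8 * (a * L))).
    by rewrite /j; field; rewrite !gt_eqF.
  have -> : 4 * j + j / d / 12 = j / d * (4 * d + 12^-1) by field; rewrite gt_eqF.
  rewrite ler_pM2l ?divr_gt0 // ler_pdivlMr ?mulr_gt0 //.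
  have : d * (a * L) <= a * L by rewrite ler_piMl // ltW.
  by move: aL1 d0; move: (a * L) d => s t; lra.
have e1 : (2 * a * N%:R)^-1 * (z - u - 5 / 6 * x') = k * z / 2 - k * u / 2 - 5 / 12 * (k * x').
  by rewrite /k; field; rewrite !gt_eqF.
have e2 : 3 * a / N%:R * y = 3 * (j * y) by rewrite /j; ring.
have e3 : 6 * a * L ^+ 2 / N%:R * x = 6 * (a * L ^+ 2 / N%:R * x) by rewrite !mulrA.
have e4 : (4 * a * N%:R)^-1 * m = k * m / 4 by rewrite /k; field; rewrite !gt_eqF.
have e5 : 2 / (a * N%:R) * x = 2 * (k * x) by rewrite /k; ring.
have kz : k * z <= k * x by rewrite ler_wpM2l // ltW.
have kx : 0 <= k * x by rewrite mulr_ge0 // ltW.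
have ku : 0 <= k * u by rewrite mulr_ge0 // ltW.
have e6 : (4 * j + j / d / 12) * y = 4 * (j * y) + (j / d * y) / 12 by ring.
have e7 : 3 * a / 2 * b = 3 / 2 * (a * b) by ring.
have e8 : 5 * a / 2 * b = 5 / 2 * (a * b) by ring.
have e9 : k * (x' + x) / 2 = (k * x' + k * x) / 2 by ring.
rewrite e1 e2 e3 e7 in h1; rewrite e9 in f1; rewrite e6 in f5; rewrite e4 e5 e8.
move: h1 f1 f2 f3 f4 f5 kz kx ku.
move: (_ * v) (a * b) (a * L ^+ 2 / N%:R * x) (k * x') (k * x) (k * z) (k * u) (k * m)
  (j * y) (j / d * y) (_ * gap) (_^-1 * y) => q1 q2 q3 q4 q5 q6 q7 q8 q9 q10 q11 q12.
move=> h1 f1 f2 f3 f4 f5 kz kx ku.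
lra.
Qed.

Lemma perp_tracking (D' : 'M[R]_(N, p)) :
  sqnorm (perp (cheb_mix W T (Y + D' - Dm))) <=
  (1 - d) * sqnorm (perp Y) + d^-1 * sqnorm (D' - Dm).
Proof.
apply: le_trans (perp_cheb N0 mixW _ _) _; rewrite -[mix_rho_tilde W T](subKr 1) -/d.
rewrite -addrA perpD -sqnormZ scalerDr; have /andP[d0 d1] := d01.
apply: sqnormD_conv => //; first by rewrite sqnormZ.
rewrite sqnormZ; apply: le_trans (sqnorm_perp_le N0 _).
by rewrite ler_piMl ?sqnorm_ge0 // expr_le1 //; lra.
Qed.

End Step.

End Problem.

(** The bookkeeping of the Lyapunov argument: s is shat^2, M and DD stand for |X' - X|^2 and |D' -
    D|^2, and x, y, r, c for the squared consensus error, tracking error, residual and mean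
    residual. In units of [k] for M and x, [j] for y and a for c: M is charged 1/8 + 1/24 + 1/24
    against 1/4, y is charged 1/4 + 1/8 against 1, x is charged 2 against 16, c is charged 5/2
    against 3, and the charge on r is balanced exactly. The noise is 9 + 6 + 6 = 21 times [q], and
    21 x 144 = 3024. *)
Lemma lyapunov_step_arith (R : realType) (a L d n b s x y r c M DD x' y' r' c' : R) :
  0 < a -> 0 < L -> 0 < d <= 1 -> 1 <= n -> a * L <= d ^+ 2 / 64 ->
  b = 144 * (a * L) ^+ 2 / n -> 0 <= s -> 0 <= x -> 0 <= y -> 0 <= r -> 0 <= c -> 0 <= M ->
  x' <= (1 - d) * x + a ^+ 2 / d * y ->
  y' <= (1 - d) * y + d^-1 * DD ->
  DD <= 4 * b ^+ 2 * r + 8 * L ^+ 2 * M + 4 * b ^+ 2 * n * s ->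
  r' <= (1 - b) * r + 2 * L ^+ 2 * M + 2 * b ^+ 2 * n * s ->
  c' <= (1 - b) * c + n^-1 ^+ 2 * (2 * L ^+ 2 * M + 2 * b ^+ 2 * n * s) ->
  (n * L * d)^-1 * y' + 16 / (n * d * a) * x' + (48 * n * L ^+ 2 * a)^-1 * r'
   + n / (48 * L ^+ 2 * a) * c'
   + (- ((4 * a * n)^-1 * M) + 5 * a / 2 * c + 2 / (a * n) * x + (8 * n * L)^-1 * y)
  <= (n * L * d)^-1 * y + 16 / (n * d * a) * x + (48 * n * L ^+ 2 * a)^-1 * r
   + n / (48 * L ^+ 2 * a) * c + 3024 * a ^+ 3 * L ^+ 2 / n ^+ 2 * s.
Proof.
move=> a0 L0 /andP[d0 d1] n1 aL bE s0 x0 y0 r0 c0 M0 hx hy hD hr hc.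
have n0 : 0 < n by lra.
have aL0 : 0 < a * L by rewrite mulr_gt0.
have d2 : d ^+ 2 <= 1 by rewrite expr_le1 // ltW.
have aL1 : a * L <= 64^-1 by apply: le_trans aL _; rewrite ler_piMl // invr_ge0.
have b0 : 0 <= b by rewrite bE !mulr_ge0 ?invr_ge0 ?sqr_ge0 // ltW.
have b1 : b <= 1 / 3.
  rewrite bE ler_pdivrMr //; apply: (@le_trans _ _ (1 / 3 * 1));
      last by rewrite ler_pM2l // divr_gt0.
  by rewrite expr2; nra.
pose k := (a * n)^-1; have k0 : 0 < k by rewrite invr_gt0 mulr_gt0.
pose j := (n * L)^-1; have j0 : 0 < j by rewrite invr_gt0 mulr_gt0.
pose q := a * b / n * s.
have ad : 0 < d ^+ 2 by rewrite exprn_gt0.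
(* The contraction gap enters once in a weight and once in a recursion, hence the factors 1 / d^2;
   this bound absorbs them. *)
have Ld : L / d ^+ 2 <= a^-1 / 64.
  rewrite ler_pdivrMr //; have -> : a^-1 / 64 * d ^+ 2 = a^-1 * (d ^+ 2 / 64) by ring.
  by rewrite ler_pdivlMl.
have bd : b / (L * d ^+ 2) <= 9 * a / (4 * n).
  have -> : b / (L * d ^+ 2) = 144 * a ^+ 2 / n * (L / d ^+ 2).
    by rewrite bE; field; rewrite !gt_eqF.
  apply: (@le_trans _ _ (144 * a ^+ 2 / n * (a^-1 / 64))).
    by rewrite ler_wpM2l // divr_ge0 ?(ltW n0) // mulr_ge0 // sqr_ge0.
  by apply: le_of_eq; field; rewrite !gt_eqF.
have A1 : (n * L * d)^-1 * y' <= (n * L * d)^-1 * y - j * y + (n * L * d ^+ 2)^-1 * DD.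
  apply: (@le_trans _ _ ((n * L * d)^-1 * ((1 - d) * y + d^-1 * DD))).
    by rewrite ler_pM2l // invr_gt0 !mulr_gt0.
  by apply: le_of_eq; rewrite /j; field; rewrite !gt_eqF.
have A2 : (n * L * d ^+ 2)^-1 * DD <= 3 * a / n ^+ 2 * r + k * M / 8 + 9 * q.
  apply: (@le_trans _ _ ((n * L * d ^+ 2)^-1 * (4 * b ^+ 2 * r + 8 * L ^+ 2 * M + 4 * b ^+
      2 * n * s))).
    by rewrite ler_pM2l // invr_gt0 !mulr_gt0.
  have -> : (n * L * d ^+ 2)^-1 * (4 * b ^+ 2 * r + 8 * L ^+ 2 * M + 4 * b ^+ 2 * n * s) =
     b / (L * d ^+ 2) * (4 * b / n * r) + L / d ^+ 2 * (8 / n * M) + b / (L * d ^+ 2) * (4 * b * s).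
    by field; rewrite !gt_eqF.
  have t1 : b / (L * d ^+ 2) * (4 * b / n * r) <= 3 * a / n ^+ 2 * r.
    apply: (@le_trans _ _ (9 * a / (4 * n) * (4 * b / n * r))).
      by rewrite ler_wpM2r // !mulr_ge0 ?invr_ge0 // ltW.
    have -> : 9 * a / (4 * n) * (4 * b / n * r) = 9 * a / n ^+ 2 * r * b by field; rewrite !gt_eqF.
    have -> : 3 * a / n ^+ 2 * r = 9 * a / n ^+ 2 * r * (1 / 3) by field; rewrite !gt_eqF.
    rewrite ler_wpM2l // mulr_ge0 // divr_ge0 ?sqr_ge0 // mulr_ge0 // ltW //.
  have t2 : L / d ^+ 2 * (8 / n * M) <= k * M / 8.
    apply: (@le_trans _ _ (a^-1 / 64 * (8 / n * M))).
      by rewrite ler_wpM2r // mulr_ge0 // divr_ge0 // ltW.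
    by apply: le_of_eq; rewrite /k; field; rewrite !gt_eqF.
  have t3 : b / (L * d ^+ 2) * (4 * b * s) <= 9 * q.
    apply: (@le_trans _ _ (9 * a / (4 * n) * (4 * b * s))).
      by rewrite ler_wpM2r // !mulr_ge0.
    by apply: le_of_eq; rewrite /q; field; rewrite !gt_eqF.
  lra.
have A3 : 16 / (n * d * a) * x' <= 16 / (n * d * a) * x - 16 * (k * x) + j * y / 4.
  apply: (@le_trans _ _ (16 / (n * d * a) * ((1 - d) * x + a ^+ 2 / d * y))).
    by rewrite ler_pM2l // divr_gt0 // !mulr_gt0.
  have -> : 16 / (n * d * a) * ((1 - d) * x + a ^+ 2 / d * y) =
     16 / (n * d * a) * x - 16 * (k * x) + 16 * a / (n * L) * y * (L / d ^+ 2).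
    by rewrite /k; field; rewrite !gt_eqF.
  rewrite lerD2l; apply: (@le_trans _ _ (16 * a / (n * L) * y * (a^-1 / 64))).
    by rewrite ler_wpM2l // mulr_ge0 // divr_ge0 ?mulr_ge0 // ltW.
  by apply: le_of_eq; rewrite /j; field; rewrite !gt_eqF.
have A4 : (48 * n * L ^+ 2 * a)^-1 * r' <= (48 * n * L ^+ 2 * a)^-1 * r - 3 * a / n ^+ 2 * r +
    k * M / 24 + 6 * q.
  apply: (@le_trans _ _ ((48 * n * L ^+ 2 * a)^-1 * ((1 - b) * r + 2 * L ^+ 2 * M + 2 * b ^+
      2 * n * s))).
    by rewrite ler_pM2l // invr_gt0 !mulr_gt0 // exprn_gt0.
  apply: le_of_eq; rewrite /k /q bE.
  by field; rewrite !gt_eqF.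
have A5 : n / (48 * L ^+ 2 * a) * c' <= n / (48 * L ^+ 2 * a) * c - 3 * (a * c) + k * M / 24 +
    6 * q.
  apply: (@le_trans _ _ (n / (48 * L ^+ 2 * a) * ((1 - b) * c + n^-1 ^+ 2 * (2 * L ^+ 2 * M +
      2 * b ^+ 2 * n * s)))).
    by rewrite ler_pM2l // divr_gt0 // !mulr_gt0 // exprn_gt0.
  apply: le_of_eq; rewrite /k /q bE.
  by field; rewrite !gt_eqF.
have e1 : (4 * a * n)^-1 * M = k * M / 4 by rewrite /k; field; rewrite !gt_eqF.
have e2 : 5 * a / 2 * c = 5 / 2 * (a * c) by ring.
have e3 : 2 / (a * n) * x = 2 * (k * x) by rewrite /k; ring.
have e4 : (8 * n * L)^-1 * y = j * y / 8 by rewrite /j; field; rewrite !gt_eqF.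
have e5 : 3024 * a ^+ 3 * L ^+ 2 / n ^+ 2 * s = 21 * q.
  by rewrite /q bE; field; rewrite !gt_eqF.
rewrite e1 e2 e3 e4 e5.
have kM : 0 <= k * M by rewrite mulr_ge0 // ltW.
have kx : 0 <= k * x by rewrite mulr_ge0 // ltW.
have jy : 0 <= j * y by rewrite mulr_ge0 // ltW.
have ac : 0 <= a * c by rewrite mulr_ge0 // ltW.
move: A1 A2 A3 A4 A5 kM kx jy ac.
move: (_ * y') (_ * x') (_ * r') (_ * c') (_ * DD) (k * M) (k * x) (j * y) (a * c)
  (3 * a / n ^+ 2 * r) ((n * L * d)^-1 * y) => p1 p2 p3 p4 p5 p6 p7 p8 p9 p10 p11.
lra.
Qed.

(** * The random run *)

Lemma sqnorm_momentum_le (R : realType) m n (A B E C : 'M[R]_(m, n)) (b c : R) :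
  0 <= b <= 1 -> sqnorm C <= c ->
  sqnorm (((1 - b) *: A + b *: B) + (b *: C - b *: E)) <=
  4 * sqnorm A + 4 * b ^+ 2 * sqnorm B + 4 * c + 4 * b ^+ 2 * sqnorm E.
Proof.
move=> /andP[b0 b1] Cc; apply: le_trans (sqnormD4_le _ _ _ _) _.
rewrite sqnormN !sqnormZ -(mulrA 4 (b ^+ 2) (sqnorm B)) -(mulrA 4 (b ^+ 2) (sqnorm E));
    apply: lerD => //; apply: lerD; last first.
  rewrite ler_pM2l //; apply: le_trans Cc.
  by rewrite ler_piMl ?sqnorm_ge0 // expr_le1.
rewrite lerD2r ler_pM2l // ler_piMl ?sqnorm_ge0 // expr_le1 ?subr_ge0 //.
by rewrite gerBl.
Qed.

(** * Laws, batches and transfer of second moments *)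

Section RVs.
Context (R : realType) (dO : measure_display) (Om : measurableType dO).
Context (P : probability Om R).

Definition mkRV dS (S : measurableType dS) (f : Om -> S) (mf : measurable_fun setT f) :
  {RV P >-> S} := HB.pack f (isMeasurableFun.Build _ _ _ _ f mf).

Lemma L2_law dS (S : measurableType dS) (X : {RV P >-> S}) (mu : probability S R) f :
  has_law P X mu -> L2 mu f -> L2 P (fun w => f (X w)).
Proof.
move=> hX [mf f2]; split; first exact: measurableT_comp.
have m2 : measurable_fun setT (fun s => f s ^+ 2) by exact: measurable_funX.
apply: (proj1 (@ge0_L1 _ _ _ _ (fun w => f (X w) ^+ 2) (Ex mu (fun s => f s ^+ 2)) _ _ _)).
- exact: (measurableT_comp m2).
- by move=> w; exact: sqr_ge0.
rewrite -integral_Ex //.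
rewrite -(@ge0_integral_distribution _ _ _ _ _ P X (fun s => (f s ^+ 2)%:E)) //; last 2 first.
- exact/measurable_EFinP.
- by move=> s; rewrite lee_fin sqr_ge0.
by rewrite (eq_measure_integral mu) // => A mA _; exact: hX.
Qed.

Lemma mxL2_mulmx d (T : measurableType d) (Q : probability T R) m n q
    (A : 'M[R]_(m, n)) (X : T -> 'M[R]_(n, q)) :
  mxL2 Q X -> mxL2 Q (fun w => A *m X w).
Proof.
move=> X2 i j; under eq_fun do rewrite mxE.
by apply: L2_sum => k; exact: L2Z.
Qed.

Lemma mxL2_rows d (T : measurableType d) (Q : probability T R) m n
    (X : T -> 'I_m -> 'rV[R]_n) :
  (forall i, mxL2 Q (fun w => X w i)) -> mxL2 Q (fun w => \matrix_(i < m) X w i).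
Proof. by move=> X2 i j; under eq_fun do rewrite mxE; exact: X2. Qed.

Lemma mxL2_cst d (T : measurableType d) (Q : probability T R) m n (A : 'M[R]_(m, n)) :
  mxL2 Q (fun _ => A).
Proof. by move=> i j; exact: L2_cst. Qed.

Lemma mxL2_le d (T : measurableType d) (Q : probability T R) m n m' n'
    (X : T -> 'M[R]_(m, n)) (Y : T -> 'M[R]_(m', n')) c c' :
  mx_measurable X -> (forall w, sqnorm (X w) <= c * sqnorm (Y w) + c') ->
  mxL2 Q Y -> mxL2 Q X.
Proof.
move=> mX XY Y2; apply: mxL2P => //.
apply: (@L1_le _ _ _ _ _ (fun w => c * sqnorm (Y w) + c')).
- exact: measurable_sqnorm.
- by move=> w; rewrite ger0_norm ?sqnorm_ge0.
- by apply: L1D (L1_cst _ _); apply: L1Z; exact: mxL2_sqnorm.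
Qed.

Lemma integral_distribution_fin dS (S : measurableType dS) (X : {RV P >-> S}) (f : S -> R) c :
  measurable_fun setT f -> (\int[P]_w (f (X w))%:E = c%:E)%E ->
  (\int[distribution P X]_s (f s)%:E = c%:E)%E.
Proof.
move=> mf fc; rewrite (@integral_distribution _ _ _ _ _ P X (fun s => (f s)%:E)) //.
  exact/measurable_EFinP.
have mfX : measurable_fun setT (fun w => f (X w)) by exact: measurableT_comp.
apply/integrableP; split; first exact/measurable_EFinP.
have : (\int[P]_w (f (X w))%:E)%E \is a fin_num by rewrite fc.
by rewrite integral_fin_num_abs.
Qed.

(** Convexity of the square: a batch mean obeys the second-moment bound of its members. *)
Lemma Ex_sqnorm_mean_le d (T : measurableType d) (Q : probability T R) q m n
    (B : 'I_q -> T -> 'M[R]_(m, n)) c : (0 < q)%N ->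
  (forall j, mxL2 Q (B j) /\ Ex Q (fun w => sqnorm (B j w)) <= c) ->
  mxL2 Q (fun w => q%:R^-1 *: \sum_j B j w) /\
  Ex Q (fun w => sqnorm (q%:R^-1 *: \sum_j B j w)) <= c.
Proof.
move=> q0 Bc; have B2 j := (Bc j).1.
have q0R : (0 : R) < q%:R by rewrite ltr0n.
have S2 : mxL2 Q (fun w => q%:R^-1 *: \sum_j B j w) by apply: mxL2Z; exact: mxL2_sum.
split => //.
have S1 : L1 Q (fun w => \sum_j sqnorm (B j w)) by apply: L1_sum => j; exact: mxL2_sqnorm.
apply: (@le_trans _ _ (Ex Q (fun w => q%:R^-1 * \sum_j sqnorm (B j w)))).
  apply: Ex_le; [exact: mxL2_sqnorm|exact: L1Z|move=> w].
  rewrite sqnormZ; apply: (le_trans (ler_wpM2l (sqr_ge0 _) (sqnorm_sum_le _))).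
  by rewrite card_ord expr2 -!mulrA mulKf // gt_eqF.
rewrite ExZ // Ex_sum => [|j]; last exact: mxL2_sqnorm.
rewrite ler_pdivrMl //; apply: (@le_trans _ _ (\sum_(j < q) c)).
  by apply: ler_sum => j _; case: (Bc j).
by rewrite sumr_const card_ord mulr_natl.
Qed.

Lemma sigma_of_T dS (S : measurableType dS) (X : Om -> S) : sigma_of X setT.
Proof. by exists setT => //; rewrite setTI. Qed.

Lemma sigma_of_I dS (S : measurableType dS) (X : Om -> S) : setI_closed (sigma_of X).
Proof.
move=> _ _ [A mA <-] [B mB <-]; exists (A `&` B); first exact: measurableI.
by rewrite !setTI.
Qed.

Lemma sigma_of_measurable dS (S : measurableType dS) (X : {RV P >-> S}) :
  sigma_of X `<=` measurable.
Proof. by move=> _ [A mA <-]; exact: measurable_funPT. Qed.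

End RVs.

Lemma telescope_step (R : realType) (v1 v2 v3 u1 u2 c n : R) :
  v1 + u1 <= v2 + c -> v2 + u2 <= v3 + n -> v1 + (u2 + u1) <= v3 + (n + c).
Proof. lra. Qed.

Lemma telescope_end (R : realType) (v v0 u n x y g : R) :
  v + u <= v0 + n -> 0 <= v -> x + g <= y + u -> g <= y - x + v0 + n.
Proof. lra. Qed.

Section NullSet.
Import HBNNSimple.

(** [f] is left without measurability because it will read the run at the random index [tau], which
    may exceed K. Its integral is a supremum over simple functions below [f], and each of them is
    compared with [g] off the null set. *)
Lemma integral_le_null (R : realType) d (S : measurableType d) (Q : probability S R)
    (f g : S -> \bar R) (A : set S) :
  (forall w, 0 <= f w)%E -> (forall w, 0 <= g w)%E -> measurable_fun setT g ->
  measurable A -> Q A = 0%E -> (forall w, ~ A w -> (f w <= g w)%E) ->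
  (\int[Q]_w f w <= \int[Q]_w g w)%E.
Proof.
move=> f0 g0 mg mA QA fg; rewrite [leLHS]ge0_integralTE //.
apply: ge_ereal_sup => _ /= [h hf <-].
rewrite -integralT_nnsfun; have mh : measurable_fun setT (fun w => (h w)%:E)
    by exact/measurable_EFinP.
rewrite (ge0_negligible_integral mA) //; last by move=> w _; rewrite lee_fin.
apply: (@le_trans _ _ (\int[Q]_(w in setT `\` A) g w)%E).
  apply: ge0_le_integral => //.
  - exact: measurableD.
  - by move=> w _; rewrite lee_fin.
  - exact: measurable_funTS.
  - exact: measurable_funTS.
  - by move=> w [_ Aw]; exact: le_trans (hf w) (fg w Aw).
by apply: ge0_subset_integral => //; exact: measurableD.
Qed.

End NullSet.

Section Run.
Context (R : realType) (N p : nat) (dX : measure_display) (Xi : measurableType dX).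
Context (D : 'I_N -> probability Xi R) (F : 'I_N -> 'rV[R]_p -> Xi -> R).
Context (r : 'rV[R]_p -> R) (L sigma phistar : R).
Hypothesis N0 : (0 < N)%N.
Hypothesis pb : problem_assumptions D F r L sigma phistar.
Context (dO : measure_display) (Om : measurableType dO) (P : probability Om R).
Context (m0 m K : nat) (W : 'M[R]_N) (T0 T : nat) (a b : R) (X0 : 'M[R]_(N, p)).
Context (xi0 : 'I_N -> 'I_m0 -> {RV P >-> Xi}) (xi : nat -> 'I_N -> 'I_m -> {RV P >-> Xi}).
Context (est : estimator N p Xi P m) (shat : R) (tau : {RV P >-> nat}).
Hypotheses (a0 : 0 < a) (b01 : 0 <= b <= 1) (mpos : (0 < m)%N).

Let run := deepstorm F r W T0 T (fun _ => a) (fun _ => b) X0 xi0 xi est.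
Let lgrad i x := gradient (local_loss D F i) x.
Let Xk k w := st_X (run w k).
Let Yk k w := st_Y (run w k).
Let Dk k w := st_D (run w k).
Let Zk k w := st_Z (run w k).
Let Rk k w := residual D F (run w k).

Hypothesis laws : samples_law D xi0 xi K.
Hypothesis indep : randomness_independent xi0 xi est K tau.
Hypothesis estP : estimator_assumptions D F r W T0 T (fun _ => a) (fun _ => b) X0 xi0 xi est K shat.

Let P_ v := prox (fun u => a * r u) v.

Lemma st_XS k w : Xk k.+1 w = \matrix_(i < N) P_ (row i (Zk k w) - a *: row i (Yk k w)).
Proof. by []. Qed.

Lemma st_ZE k w : Zk k w = cheb_mix W T (Xk k w).
Proof. by case: k. Qed.

Let Vn k w := \matrix_(i < N) minibatch_grad F i (realize (xi k i) w) (row i (Xk k.+1 w)).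
Let Vo k w := \matrix_(i < N) minibatch_grad F i (realize (xi k i) w) (row i (Xk k w)).
Let Vt k w := \matrix_(i < N) estimate F xi est k i (row i (Xk k.+1 w)) w.

Lemma st_DS k w : Dk k.+1 w = (1 - b) *: (Dk k w + Vn k w - Vo k w) + b *: Vt k w.
Proof. by []. Qed.

Lemma st_YS k w : Yk k.+1 w = cheb_mix W T (Yk k w + Dk k.+1 w - Dk k w).
Proof. by []. Qed.

Lemma minibatch_gradE i q (s : 'I_q -> {RV P >-> Xi}) w x :
  minibatch_grad F i (realize s w) x = q%:R^-1 *: \sum_(j < q) sgrad F i x (s j w).
Proof.
rewrite /minibatch_grad size_tuple big_tuple; congr (_ *: _).
by apply: eq_bigr => j _; rewrite tnth_mktuple.
Qed.

Lemma prox_measurable d (S : measurableType d) (x : S -> 'rV[R]_p) :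
  mx_measurable x -> mx_measurable (fun w => P_ (x w)).
Proof.
move=> mx i j; apply: (@continuous_mx_measurable R d S p (fun v => P_ v i j) x) => //.
apply: (@sqnorm_lipschitz_continuous _ _ _ 1) => v v'; rewrite mul1r.
apply: le_trans (prox_nonexpansive (regularizer_convex pb) a0
  (fun v => regularizer_prox pb v a0) v v').
rewrite /sqnorm (bigD1 i) //= (bigD1 j) //= mxBE -addrA lerDl.
by rewrite addr_ge0 //; do ![apply: sumr_ge0 => ? _]; rewrite sqr_ge0.
Qed.

(** * Measurability of the run with respect to any sigma-algebra of samples *)

Section Measurability.
Context (d : measure_display) (S : measurableType d) (iota : S -> Om).

(** Taking [S] to be [Om] under some sigma-algebra and [iota] the identity, one proof covers the
    full sigma-algebra, the past of a draw and the samples without [tau]. *)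
Definition sample_measurable k i :=
  (forall j, measurable_fun setT (fun w => xi k i j (iota w))) /\
  match est with
  | SeparateBatch _ xit => forall j, measurable_fun setT (fun w => xit k i j (iota w))
  | SameBatch => True
  end.

Hypothesis m_xi0 : forall i j, measurable_fun setT (fun w => xi0 i j (iota w)).

Lemma minibatch_measurable i q (s : 'I_q -> {RV P >-> Xi}) (x : S -> 'rV[R]_p) :
  (forall j, measurable_fun setT (fun w => s j (iota w))) -> mx_measurable x ->
  mx_measurable (fun w => minibatch_grad F i (realize s (iota w)) (x w)).
Proof.
move=> ms mx; rewrite (_ : (fun w => _) = (fun w => q%:R^-1 *: \sum_(j < q) sgrad F i (x w)
    (s j (iota w)))); last first.
  by apply/funext => w; rewrite minibatch_gradE.
by apply: mx_measurableZ; apply: mx_measurable_sum => j; exact: (sgrad_measurable pb).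
Qed.

Lemma estimate_measurable k i (x : S -> 'rV[R]_p) : (k < K)%N ->
  sample_measurable k i -> mx_measurable x ->
  mx_measurable (fun w => estimate F xi est k i (x w) (iota w)).
Proof.
move: estP; rewrite /sample_measurable /estimator_assumptions /estimate.
case: est => [G xit|] [e1 _] kK [m1 m2] mx; last exact: minibatch_measurable.
case: e1 => mG _ _ c l; rewrite (ord1 c).
have mt : measurable_fun setT (fun w => ([tuple x w 0 j | j < p], realize (xit k i) (iota w))).
  apply: measurable_fun_pair; apply/measurable_fun_tnthP => j.
    by rewrite (_ : _ \o _ = (fun w => x w 0 j)) //; apply/funext => w /=; rewrite tnth_mktuple.
  by rewrite (_ : _ \o _ = (fun w => xit k i j (iota w))) //; apply/funext => w /=;
      rewrite tnth_mktuple.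
have := measurableT_comp (mG k i l kK) mt.
congr (measurable_fun _ _); apply/funext => w /=; congr (G _ _ _ _ _ _).
by apply/rowP => j; rewrite mxE tnth_mktuple.
Qed.

(** The iterate [Xk k.+1] is listed with the state k: it is computed from X^(k) and Y^(k) before the
    batches of step k are drawn, so it belongs to their past. *)
Lemma state_measurable k : (k <= K)%N ->
  (forall k' i, (k' < k)%N -> sample_measurable k' i) ->
  [/\ mx_measurable (fun w => Xk k (iota w)), mx_measurable (fun w => Dk k (iota w)),
      mx_measurable (fun w => Yk k (iota w)) & mx_measurable (fun w => Xk k.+1 (iota w))].
Proof.
have next k' : mx_measurable (fun w => Xk k' (iota w)) -> mx_measurable (fun w => Yk k' (iota w)) ->
    mx_measurable (fun w => Xk k'.+1 (iota w)).
  move=> mX mY; under eq_fun do rewrite st_XS.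
  apply: mx_measurable_rows => i; apply: prox_measurable; apply: mx_measurableB.
    by apply: mx_measurable_row; under eq_fun do rewrite st_ZE; exact: mx_measurable_cheb.
  by apply: mx_measurableZ; exact: mx_measurable_row.
elim: k => [|k IH] kK ms.
  have mX : mx_measurable (fun w : S => Xk 0 (iota w)) by exact: mx_measurable_cst.
  have mD : mx_measurable (fun w : S => Dk 0 (iota w)).
    apply: mx_measurable_rows => i; apply: minibatch_measurable => //.
  have mY : mx_measurable (fun w : S => Yk 0 (iota w)) by exact: mx_measurable_cheb.
  by split; [exact: mX|exact: mD|exact: mY|exact: next mX mY].
have [|mX mD mY mX1] := IH (ltnW kK).
  by move=> k' i kk'; apply: ms; exact: ltnW.
have mD1 : mx_measurable (fun w => Dk k.+1 (iota w)).
  under eq_fun do rewrite st_DS.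
  apply: mx_measurableD; apply: mx_measurableZ; last first.
    apply: mx_measurable_rows => i; apply: estimate_measurable => //; first exact: ms.
    exact: mx_measurable_row.
  apply: mx_measurableB; first apply: mx_measurableD => //.
    apply: mx_measurable_rows => i; apply: minibatch_measurable; first by case: (ms k i (ltnSn k)).
    exact: mx_measurable_row.
  apply: mx_measurable_rows => i; apply: minibatch_measurable; first by case: (ms k i (ltnSn k)).
  exact: mx_measurable_row.
have mY1 : mx_measurable (fun w => Yk k.+1 (iota w)).
  under eq_fun do rewrite st_YS.
  by apply: mx_measurable_cheb; apply: mx_measurableB => //; exact: mx_measurableD.
by split; [exact: mX1|exact: mD1|exact: mY1|exact: next mX1 mY1].
Qed.

End Measurability.

(** * Noise of one agent at one step, given its past *)

Section Noise.

Let idx : finType := (unit + 'I_N * 'I_m0 + 'I_K * 'I_N * 'I_m + 'I_K * 'I_N * 'I_m)%type.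

(** Convertible to the family inside [randomness_independent], so that hypothesis applies to it as
    it stands. *)
Definition sample_ev (s : idx) : set (set Om) :=
  match s with
  | inl (inl (inl _)) => sigma_of tau
  | inl (inl (inr (i, j))) => sigma_of (xi0 i j)
  | inl (inr (k, i, j)) => sigma_of (xi k i j)
  | inr (k, i, j) =>
      match est with
      | SeparateBatch _ xit => sigma_of (xit k i j)
      | SameBatch => [set set0; [set: Om]]
      end
  end.

Lemma sample_evP s : [/\ sample_ev s setT, setI_closed (sample_ev s) &
  sample_ev s `<=` measurable].
Proof.
have h dS (S : measurableType dS) (X : {RV P >-> S}) :
    [/\ sigma_of X setT, setI_closed (sigma_of X) & sigma_of X `<=` measurable].
  by split; [exact: sigma_of_T|exact: sigma_of_I|exact: sigma_of_measurable].
case: s => [[[u|[i j]]|[[k i] j]]|[[k i] j]] /=; try exact: h.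
case: est => [G xit|]; first exact: h.
split; first by right.
- by move=> A B [] -> [] ->; rewrite ?set0I ?setTI; [left|left|left|right].
- by move=> A [] ->.
Qed.

Lemma joint_sample_measurable (J : {set idx}) : joint sample_ev J `<=` measurable.
Proof. by apply: joint_measurable => s; case: (sample_evP s). Qed.

Lemma joint_measurable_fun (J : {set idx}) s (X : {RV P >-> Xi}) :
  s \in J -> sample_ev s = sigma_of X ->
  measurable_fun setT (fun w : g_sigma_algebraType (joint sample_ev J) => X w).
Proof.
move=> sJ sX _ B mB; apply: sub_sigma_algebra.
apply: (@joint_ev _ _ _ _ _ J s sJ); first by move=> t; case: (sample_evP t).
by rewrite sX; exists B.
Qed.

Context (k : nat) (i : 'I_N) (kK : (k < K)%N).

(* What is known before agent i draws its batches of step k: the samples of all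
   the earlier steps, and those of the other agents at step k. *)
Definition past : {set idx} := [set s : idx | match s with
  | inl (inl (inl _)) => false
  | inl (inl (inr _)) => true
  | inl (inr (k', i', _)) => (k' < k)%N || (k' == k :> nat) && (i' != i)
  | inr (k', i', _) => (k' < k)%N || (k' == k :> nat) && (i' != i)
  end]%SET.

Definition fresh : {set idx} := [set s : idx | match s with
  | inl (inl _) => false
  | inl (inr (k', i', _)) => (k' == k :> nat) && (i' == i)
  | inr (k', i', _) => (k' == k :> nat) && (i' == i)
  end]%SET.

Lemma fresh_past s : s \in fresh -> s \in past = false.
Proof.
rewrite !inE; case: s => [[[u|//]|[[k' i'] j]]|[[k' i'] j]] //;
  by move=> /andP[/eqP -> /eqP ->]; rewrite ltnn !eqxx.
Qed.

Let S1 : measurableType _ := g_sigma_algebraType (joint sample_ev past).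
Let S2 : measurableType _ := g_sigma_algebraType (joint sample_ev fresh).

Let id1 : Om -> S1 := id.

Let mid1 : measurable_fun setT id1.
Proof.
move=> _ A mA; rewrite setTI.
exact: (sub_measurable_generated (@joint_sample_measurable past)).
Qed.

Lemma fresh_independent dS (S : measurableType dS) (eta : {RV P >-> S}) :
  measurable_fun setT (fun w : S2 => eta w) ->
  forall A B, measurable A -> measurable B ->
  P (mkRV P mid1 @^-1` A `&` eta @^-1` B) = (P (mkRV P mid1 @^-1` A) * P (eta @^-1` B))%E.
Proof.
move=> meta A B mA mB.
apply: (joint_indep _ _ _ indep fresh_past) => //.
- by move=> s; case: (sample_evP s).
- by move=> s; case: (sample_evP s).
- by move=> s; case: (sample_evP s).
- by have := meta measurableT B mB; rewrite setTI.
Qed.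

Lemma past_xi0 i' j : measurable_fun setT (fun w : S1 => xi0 i' j w).
Proof. by apply: (@joint_measurable_fun _ (inl (inl (inr (i', j))))); rewrite ?inE. Qed.

Lemma past_sample k' i' : (k' < k)%N || (k' == k) && (i' != i) ->
  sample_measurable (fun w : S1 => w) k' i'.
Proof.
move=> k'k; have k'K : (k' < K)%N.
  case/orP: k'k => [h|/andP[/eqP -> _]//]; exact: ltn_trans kK.
rewrite /sample_measurable; split.
  by move=> j; apply: (@joint_measurable_fun _ (inl (inr (Ordinal k'K, i', j)))); rewrite ?inE.
case e: est => [G xit|//] j.
apply: (@joint_measurable_fun _ (inr (Ordinal k'K, i', j))); rewrite ?inE //.
by rewrite /= e.
Qed.

Lemma fresh_xi j : measurable_fun setT (fun w : S2 => xi k i j w).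
Proof. by apply: (@joint_measurable_fun _ (inl (inr (Ordinal kK, i, j)))); rewrite ?inE ?eqxx. Qed.

Lemma past_state : [/\ mx_measurable (fun w : S1 => Xk k w), mx_measurable (fun w : S1 => Dk k w),
   mx_measurable (fun w : S1 => Yk k w) & mx_measurable (fun w : S1 => Xk k.+1 w)].
Proof.
apply: (@state_measurable _ S1 (fun w => w)).
- by move=> i' j; exact: past_xi0.
- exact: ltnW.
- by move=> k' i' k'k; apply: past_sample; rewrite k'k.
Qed.

Section Sample.
Context (j : 'I_m).

Let lawj : has_law P (xi k i j) (D i). Proof. by case: laws => _; apply. Qed.

Let indj := fresh_independent (fresh_xi j).

(** The variance assumption concerns a fixed point; freezing extends it to a point determined by the
    past. Unbiasedness and mean-square smoothness are transferred below in the same way. *)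
Lemma sample_noise_L2 (x : S1 -> 'rV[R]_p) : mx_measurable x ->
  mxL2 P (fun w => sgrad F i (x w) (xi k i j w) - lgrad i (x w)).
Proof.
move=> mx; apply: mxL2P.
  apply: mx_measurableB; first apply: (sgrad_measurable pb) => //.
    by move=> c l; exact: (measurableT_comp (mx c l) mid1).
  by apply: (lgrad_measurable pb) => c l; exact: (measurableT_comp (mx c l) mid1).
have [] := @freezing_le _ _ _ P _ _ S1 _ (mkRV P mid1) (xi k i j) (D i) lawj indj
   (fun z => sqnorm (sgrad F i (x z.1) z.2 - lgrad i (x z.1))) (fun _ => sigma ^+ 2).
- apply: measurable_sqnorm; apply: mx_measurableB.
    apply: (sgrad_measurable pb) => //.
    by move=> c l; exact: (measurableT_comp (mx c l) measurable_fst).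
  apply: (lgrad_measurable pb).
  by move=> c l; exact: (measurableT_comp (mx c l) measurable_fst).
- by move=> z; exact: sqnorm_ge0.
- exact: measurable_cst.
- by move=> t /=; exact: (sgrad_variance pb i (x t)).
- exact: L1_cst.
- by [].
Qed.

Lemma sample_noise_orthogonal (A : S1 -> R) (x : S1 -> 'rV[R]_p) l :
  measurable_fun setT A -> L2 P A -> mx_measurable x ->
  Ex P (fun w => A w * (sgrad F i (x w) (xi k i j w) - lgrad i (x w)) 0 l) = 0.
Proof.
move=> mA A2 mx; have e2 := sample_noise_L2 mx.
under eq_fun do rewrite mxBE.
apply: (@freezing_orthogonal _ _ _ P _ _ S1 _ (mkRV P mid1) (xi k i j) (D i) lawj indj
   A (fun z => sgrad F i (x z.1) z.2 0 l) (fun t => lgrad i (x t) 0 l)) => //.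
- have : mx_measurable (fun z : S1 * Xi => sgrad F i (x z.1) z.2); last exact.
  apply: (sgrad_measurable pb) => //.
  by move=> c l'; exact: (measurableT_comp (mx c l') measurable_fst).
- exact: (lgrad_measurable pb i mx 0 l).
- by move=> t /=; exact: (sgrad_unbiased pb i (x t) l).
- by have := e2 0 l; under eq_fun do rewrite mxBE.
Qed.

Lemma sample_lipschitz (x x' : S1 -> 'rV[R]_p) : mx_measurable x -> mx_measurable x' ->
  mxL2 P (fun w => x w - x' w) ->
  mxL2 P (fun w => sgrad F i (x w) (xi k i j w) - sgrad F i (x' w) (xi k i j w)) /\
  Ex P (fun w => sqnorm (sgrad F i (x w) (xi k i j w) - sgrad F i (x' w) (xi k i j w)))
    <= L ^+ 2 * Ex P (fun w => sqnorm (x w - x' w)).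
Proof.
move=> mx mx' d2.
have [] := @freezing_le _ _ _ P _ _ S1 _ (mkRV P mid1) (xi k i j) (D i) lawj indj
   (fun z => sqnorm (sgrad F i (x z.1) z.2 - sgrad F i (x' z.1) z.2))
   (fun t => L ^+ 2 * sqnorm (x t - x' t)).
- apply: measurable_sqnorm; apply: mx_measurableB; apply: (sgrad_measurable pb) => //.
    by move=> c l; exact: (measurableT_comp (mx c l) measurable_fst).
  by move=> c l; exact: (measurableT_comp (mx' c l) measurable_fst).
- by move=> z; exact: sqnorm_ge0.
- apply: measurable_funM => //; apply: measurable_sqnorm; exact: mx_measurableB.
- by move=> t /=; exact: (mean_square_smooth pb i (x t) (x' t)).
- by apply: L1Z; exact: mxL2_sqnorm.
move=> h1 h2; split; last by rewrite -ExZ //; exact: mxL2_sqnorm.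
apply: mxL2P => //; apply: mx_measurableB; apply: (sgrad_measurable pb) => //.
  by move=> c l; exact: (measurableT_comp (mx c l) mid1).
by move=> c l; exact: (measurableT_comp (mx' c l) mid1).
Qed.

End Sample.

Let xn w := row i (Xk k.+1 w).
Let xo w := row i (Xk k w).

Let mxn : mx_measurable (fun w : S1 => xn w).
Proof. by apply: mx_measurable_row; case: past_state. Qed.

Let mxo : mx_measurable (fun w : S1 => xo w).
Proof. by apply: mx_measurable_row; case: past_state. Qed.

(** Noise of the momentum correction: both gradients are sampled on the same batch, so its size is
    governed by the displacement of the iterate and not by the variance. *)
Let e1 w := (row i (Vn k w) - row i (Vo k w)) - (lgrad i (xn w) - lgrad i (xo w)).
Let e2 w := row i (Vt k w) - lgrad i (xn w).
Let G j w := sgrad F i (xn w) (xi k i j w) - lgrad i (xn w).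
Let H j w := sgrad F i (xo w) (xi k i j w) - lgrad i (xo w).

Let G2 j : mxL2 P (G j). Proof. exact: (sample_noise_L2 j mxn). Qed.
Let H2 j : mxL2 P (H j). Proof. exact: (sample_noise_L2 j mxo). Qed.

Let mean_sub (B : 'I_m -> 'rV[R]_p) v :
  m%:R^-1 *: \sum_j B j - v = m%:R^-1 *: \sum_j (B j - v).
Proof.
rewrite sumrB scalerBr sumr_const card_ord -[v *+ m]scaler_nat scalerA mulVf ?scale1r //.
by rewrite pnatr_eq0 -lt0n.
Qed.

Let rowVn w : row i (Vn k w) = m%:R^-1 *: \sum_j sgrad F i (xn w) (xi k i j w).
Proof. by rewrite rowK minibatch_gradE. Qed.

Let rowVo w : row i (Vo k w) = m%:R^-1 *: \sum_j sgrad F i (xo w) (xi k i j w).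
Proof. by rewrite rowK minibatch_gradE. Qed.

Let e1E w : e1 w = m%:R^-1 *: \sum_j (G j w - H j w).
Proof.
have hG := mean_sub (fun j => sgrad F i (xn w) (xi k i j w)) (lgrad i (xn w)).
have hH := mean_sub (fun j => sgrad F i (xo w) (xi k i j w)) (lgrad i (xo w)).
pose u1 := m%:R^-1 *: \sum_j sgrad F i (xn w) (xi k i j w).
pose u2 := m%:R^-1 *: \sum_j sgrad F i (xo w) (xi k i j w).
transitivity ((u1 - u2) - (lgrad i (xn w) - lgrad i (xo w))).
  by congr (_ - _ - _); [exact: rowVn|exact: rowVo].
transitivity ((u1 - lgrad i (xn w)) - (u2 - lgrad i (xo w))).
  move: u1 u2 (lgrad _ _) (lgrad _ _) {hG hH} => u1 u2 u3 u4.
  by apply/rowP => j; rewrite !mxE; ring.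
transitivity (m%:R^-1 *: \sum_j G j w - m%:R^-1 *: \sum_j H j w).
  by congr (_ - _); [exact: hG|exact: hH].
by rewrite -scalerBr -sumrB.
Qed.

Let e2E w : e2 w = estimate F xi est k i (xn w) w - lgrad i (xn w).
Proof. by congr (_ - _); rewrite rowK. Qed.

Let mean_orthogonal (B : 'I_m -> Om -> 'rV[R]_p) (A : Om -> R) l : L2 P A ->
  (forall j, mxL2 P (B j)) -> (forall j, Ex P (fun w => A w * B j w 0 l) = 0) ->
  Ex P (fun w => A w * (m%:R^-1 *: \sum_j B j w) 0 l) = 0.
Proof.
move=> A2 B2 AB.
rewrite (_ : (fun w => _) = (fun w => m%:R^-1 * \sum_j A w * B j w 0 l)); last first.
  by apply/funext => w; rewrite mxE summxE mulrCA mulr_sumr.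
have h j : L1 P (fun w => A w * B j w 0 l) by apply: L2M => //; exact: B2.
rewrite ExZ; last exact: L1_sum.
by rewrite Ex_sum // big1 ?mulr0.
Qed.

Lemma diff_noise_L2 : mxL2 P e1.
Proof.
rewrite (funext e1E); apply: mxL2Z; apply: mxL2_sum => j.
by apply: mxL2B; [exact: G2|exact: H2].
Qed.

Let GH_orthogonal j (A : S1 -> R) l : measurable_fun setT A -> L2 P A ->
  Ex P (fun w => A w * (G j w - H j w) 0 l) = 0.
Proof.
move=> mA A2.
rewrite (_ : (fun w => _) = (fun w => A w * G j w 0 l - A w * H j w 0 l)); last first.
  by apply/funext => w; rewrite mxBE mulrBr.
rewrite ExB; [|by apply: L2M => //; exact: G2|by apply: L2M => //; exact: H2].
transitivity (0 - 0 : R); last exact: subrr.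
congr (_ - _); [exact: (sample_noise_orthogonal j l mA A2 mxn)|exact: (sample_noise_orthogonal j
    l mA A2 mxo)].
Qed.

Lemma diff_noise_orthogonal (A : S1 -> R) l : measurable_fun setT A -> L2 P A ->
  Ex P (fun w => A w * e1 w 0 l) = 0.
Proof.
move=> mA A2; rewrite (funext e1E); apply: mean_orthogonal => // j.
  by apply: mxL2B; [exact: G2|exact: H2].
exact: GH_orthogonal.
Qed.

(** With a separate batch, [Gs] is unbiased only as a function of the whole batch, which is
    therefore frozen against as one random tuple. With the same batch the error is a mean of
    single-sample noises. *)
Lemma estimate_noise_orthogonal (A : S1 -> R) l : measurable_fun setT A -> L2 P A ->
  mxL2 P e2 -> Ex P (fun w => A w * e2 w 0 l) = 0.
Proof.
move=> mA A2 e22.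
case e : est => [Gs xit|].
  have [h _] := estP; rewrite e in h; case: h => mG _ uG.
  have mt : measurable_fun setT (fun w => realize (xit k i) w).
    apply/measurable_fun_tnthP => j.
    by rewrite (_ : _ \o _ = xit k i j) //; apply/funext => w /=; rewrite tnth_mktuple.
  pose eta := mkRV P mt.
  have metaS2 : measurable_fun setT (fun w : S2 => eta w).
    apply/measurable_fun_tnthP => j.
    rewrite (_ : _ \o _ = (fun w => xit k i j w)); last first.
      by apply/funext => w /=; rewrite tnth_mktuple.
    apply: (@joint_measurable_fun _ (inr (Ordinal kK, i, j))); rewrite ?inE ?eqxx //.
    by rewrite /= e.
  have mh : measurable_fun setT (fun z : S1 * m.-tuple Xi => Gs k i (xn z.1) z.2 0 l).
    have mt' : measurable_fun setT (fun z : S1 * m.-tuple Xi => ([tuple xn z.1 0 j | j < p], z.2)).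
      apply: measurable_fun_pair => //; apply/measurable_fun_tnthP => j.
      rewrite (_ : _ \o _ = (fun z => xn z.1 0 j)); last first.
        by apply/funext => z /=; rewrite tnth_mktuple.
      exact: (measurableT_comp (mxn 0 j) measurable_fst).
    have := measurableT_comp (mG k i l kK) mt'.
    congr (measurable_fun _ _); apply/funext => z /=; congr (Gs _ _ _ _ _ _).
    by apply/rowP => j; rewrite mxE tnth_mktuple.
  rewrite (_ : (fun w => _) = (fun w => A w * (Gs k i (xn w) (realize (xit k i) w)
      0 l - lgrad i (xn w) 0 l))); last first.
    by apply/funext => w; rewrite e2E mxBE /estimate e.
  (* The law of the tuple is taken to be its own distribution; unbiasedness, an integral over [P],
     is transported to it. *)
  apply: (@freezing_orthogonal _ _ _ P _ _ S1 _ (mkRV P mid1) eta (distribution P eta) _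
    (fresh_independent metaS2) A (fun z => Gs k i (xn z.1) z.2 0 l) (fun t => lgrad i (xn t) 0 l)).
  - by [].
  - exact: mA.
  - exact: mh.
  - exact: (lgrad_measurable pb i mxn 0 l).
  - move=> t /=; apply: integral_distribution_fin; last exact: (uG k i (xn t) l kK).
    exact: (measurableT_comp mh (pair1_measurable t)).
  - exact: A2.
  - have := e22 0 l; congr (L2 _ _); apply/funext => w.
    by rewrite e2E mxBE /estimate e.
have e2G w : e2 w = m%:R^-1 *: \sum_j G j w.
  by rewrite e2E /estimate e minibatch_gradE mean_sub.
rewrite (funext e2G); apply: mean_orthogonal => // j.
exact: (sample_noise_orthogonal j l mA A2 mxn).
Qed.

Lemma estimate_noise_le : mxL2 P e2 /\ Ex P (fun w => sqnorm (e2 w)) <= shat ^+ 2.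
Proof.
have me2 : mx_measurable e2.
  apply: mx_measurableB; last first.
    by apply: (lgrad_measurable pb) => c l; exact: (measurableT_comp (mxn c l) mid1).
  apply: mx_measurable_row; apply: mx_measurable_rows => i'.
  apply: (@estimate_measurable _ Om (fun w => w)) => //.
    rewrite /sample_measurable; split; first by move=> j; exact: measurable_funPT.
    by case: est => [Gs xit j|//]; exact: measurable_funPT.
  apply: mx_measurable_row; case: past_state => _ _ _ h c l.
  exact: (measurableT_comp (h c l) mid1).
have h0 : (\int[P]_w (sqnorm (e2 w))%:E <= (shat ^+ 2)%:E)%E.
  have := estP.2 k i kK; congr (_ <= _)%E; apply: eq_integral => w _.
  by rewrite e2E.
have [h1 h2] := ge0_L1 (measurable_sqnorm me2) (fun w => sqnorm_ge0 (e2 w)) h0.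
by split; [exact: mxL2P|exact: h2].
Qed.

Hypothesis X2 : mxL2 P (Xk k).
Hypothesis Xn2 : mxL2 P (Xk k.+1).

Let dx2 : mxL2 P (fun w => xn w - xo w).
Proof. by apply: mxL2B; exact: mxL2_row. Qed.

Lemma batch_diff_le : mxL2 P (fun w => row i (Vn k w - Vo k w)) /\
  Ex P (fun w => sqnorm (row i (Vn k w - Vo k w))) <= L ^+ 2 * Ex P (fun w => sqnorm (xn w - xo w)).
Proof.
pose B (j : 'I_m) w := sgrad F i (xn w) (xi k i j w) - sgrad F i (xo w) (xi k i j w).
have BE w : row i (Vn k w - Vo k w) = m%:R^-1 *: \sum_j B j w.
  rewrite rowB; transitivity (m%:R^-1 *: \sum_j sgrad F i (xn w) (xi k i j w) -
      m%:R^-1 *: \sum_j sgrad F i (xo w) (xi k i j w)).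
    by congr (_ - _); [exact: rowVn|exact: rowVo].
  by rewrite -scalerBr -sumrB.
have [h1 h2] := @Ex_sqnorm_mean_le _ _ _ P m 1 p B _ mpos
  (fun j => sample_lipschitz j mxn mxo dx2).
split; first by rewrite (funext BE).
rewrite (_ : (fun w => sqnorm (row i (Vn k w - Vo k w))) = (fun w =>
    sqnorm (m%:R^-1 *: \sum_j B j w))) //.
by apply/funext => w; rewrite BE.
Qed.

(** A conditional variance is at most the conditional second moment: the sampled difference is [g]
    plus its noise, and [g], being determined by the past, is orthogonal to that noise. *)
Lemma diff_noise_le : Ex P (fun w => sqnorm (e1 w)) <= L ^+ 2 * Ex P (fun w =>
    sqnorm (xn w - xo w)).
Proof.
rewrite (funext e1E).
suff h j : mxL2 P (fun w => G j w - H j w) /\ Ex P (fun w => sqnorm (G j w - H j w))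
    <= L ^+ 2 * Ex P (fun w => sqnorm (xn w - xo w)).
  by have [] := Ex_sqnorm_mean_le mpos h.
have GH2 : mxL2 P (fun w => G j w - H j w) by apply: mxL2B; [exact: G2|exact: H2].
split => //.
have [d2 dle] := sample_lipschitz j mxn mxo dx2; apply: le_trans dle.
pose g w := lgrad i (xn w) - lgrad i (xo w).
have mg : mx_measurable (fun w : S1 => g w).
  by apply: mx_measurableB; [exact: (lgrad_measurable pb i mxn)|exact: (lgrad_measurable pb i mxo)].
have g2 : mxL2 P g.
  apply: (@mxL2_le _ _ _ P _ _ _ _ g (fun w => xn w - xo w) (L ^+ 2) 0) => //.
    by move=> c l; exact: (measurableT_comp (mg c l) mid1).
  by move=> w; rewrite addr0; exact: (lgrad_lipschitz pb).
have gGH : Ex P (fun w => dot (g w) (G j w - H j w)) = 0.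
  rewrite Ex_dot //; apply: big1 => c _; apply: big1 => l _; rewrite (ord1 c).
  have gl : L2 P (fun w => g w 0 l) by exact: g2.
  exact: (GH_orthogonal j l (mg 0 l) gl).
rewrite (_ : (fun w => sqnorm (sgrad _ _ _ _ - _)) = (fun w => sqnorm (g w) + 2 * dot (g w)
    (G j w - H j w) + sqnorm (G j w - H j w))); last first.
  apply/funext => w; rewrite -sqnormD; congr sqnorm; rewrite /g /G /H.
  move: (sgrad _ _ _ _) (sgrad _ _ _ _) (lgrad _ _) (lgrad _ _) => u1 u2 u3 u4.
  by apply/rowP => c; rewrite !mxE; ring.
have L1g := mxL2_sqnorm g2; have L1d := mxL2_dot g2 GH2.
rewrite ExD; [|by apply: L1D => //; exact: L1Z|exact: mxL2_sqnorm].
rewrite ExD //; last exact: L1Z.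
rewrite ExZ // gGH mulr0 addr0 lerDr.
by apply: Ex_ge0 => w; exact: sqnorm_ge0.
Qed.

Let nz w := (1 - b) *: e1 w + b *: e2 w.

Lemma noise_le : mxL2 P nz /\ Ex P (fun w => sqnorm (nz w)) <=
  2 * L ^+ 2 * Ex P (fun w => sqnorm (xn w - xo w)) + 2 * b ^+ 2 * shat ^+ 2.
Proof.
have [e22 e2le] := estimate_noise_le; have e12 := diff_noise_L2.
have n2 : mxL2 P nz by apply: mxL2D; exact: mxL2Z.
split => //; apply: (@le_trans _ _ (Ex P (fun w => 2 * sqnorm (e1 w) + 2 * b ^+
    2 * sqnorm (e2 w)))).
  apply: Ex_le; [exact: mxL2_sqnorm| |].
    by apply: L1D; apply: L1Z; exact: mxL2_sqnorm.
  move=> w; apply: le_trans (sqnormD_le _ _) _; rewrite !sqnormZ mulrA -[2 * b ^+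
      2 * _]mulrA lerD2r.
  rewrite -mulrA ler_pM2l // ler_piMl ?sqnorm_ge0 // expr_le1 //; case/andP: b01 => *; lra.
rewrite ExD; [|by apply: L1Z; exact: mxL2_sqnorm|by apply: L1Z; exact: mxL2_sqnorm].
rewrite !ExZ; [|exact: mxL2_sqnorm|exact: mxL2_sqnorm].
apply: lerD; first by rewrite -mulrA ler_pM2l //; exact: diff_noise_le.
by rewrite ler_wpM2l // mulr_ge0 // sqr_ge0.
Qed.

Lemma noise_orthogonal (A : S1 -> R) l : measurable_fun setT A -> L2 P A ->
  Ex P (fun w => A w * nz w 0 l) = 0.
Proof.
move=> mA A2; have [e22 _] := estimate_noise_le; have e12 := diff_noise_L2.
rewrite (_ : (fun w => _) = (fun w => (1 - b) * (A w * e1 w 0 l) + b * (A w * e2 w 0 l)));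
    last first.
  apply/funext => w; rewrite /nz; move: (e1 w) (e2 w) => u v; rewrite !mxE; ring.
have h1 : L1 P (fun w => A w * e1 w 0 l) by apply: L2M => //; exact: e12.
have h2 : L1 P (fun w => A w * e2 w 0 l) by apply: L2M => //; exact: e22.
rewrite ExD ?ExZ //; try exact: L1Z.
by rewrite diff_noise_orthogonal // estimate_noise_orthogonal // !mulr0 addr0.
Qed.

End Noise.

Lemma mxL2_of_rows d (S : measurableType d) (Q : probability S R) q n (X : S -> 'M[R]_(q, n)) :
  (forall i, mxL2 Q (fun w => row i (X w))) -> mxL2 Q X.
Proof. by move=> X2 i j; have := X2 i 0 j; under eq_fun do rewrite mxE. Qed.

Lemma sample_measurable_id k i : sample_measurable (fun w : Om => w) k i.
Proof.
split; first by move=> j; exact: measurable_funPT.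
by case: est => [Gs xit j|//]; exact: measurable_funPT.
Qed.

Lemma lgrad_mxL2 i (x : Om -> 'rV[R]_p) : mxL2 P x -> mxL2 P (fun w => lgrad i (x w)).
Proof.
move=> x2; have mg : mx_measurable (fun w => lgrad i (x w)).
  by apply: (lgrad_measurable pb); exact: mxL2_measurable.
apply: (@mxL2_le _ _ _ P _ _ _ _ _ x (2 * L ^+ 2) (2 * sqnorm (lgrad i 0))) => // w.
have -> : lgrad i (x w) = (lgrad i (x w) - lgrad i 0) + lgrad i 0 by rewrite subrK.
apply: le_trans (sqnormD_le _ _) _; rewrite lerD2r -mulrA ler_pM2l //.
by have := lgrad_lipschitz pb i (x w) 0; rewrite subr0.
Qed.

Lemma prox_mxL2 (x : Om -> 'rV[R]_p) : mxL2 P x -> mxL2 P (fun w => P_ (x w)).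
Proof.
move=> x2; have mP : mx_measurable (fun w => P_ (x w)).
  by apply: prox_measurable; exact: mxL2_measurable.
apply: (@mxL2_le _ _ _ P _ _ _ _ _ x 2 (2 * sqnorm (P_ 0))) => // w.
have -> : P_ (x w) = (P_ (x w) - P_ 0) + P_ 0 by rewrite subrK.
apply: le_trans (sqnormD_le _ _) _; rewrite lerD2r ler_pM2l //.
have := prox_nonexpansive (regularizer_convex pb) a0 (fun v => regularizer_prox pb v a0) (x w) 0.
by rewrite subr0.
Qed.

Lemma cheb_mxL2 t n (X : Om -> 'M[R]_(N, n)) : mxL2 P X -> mxL2 P (fun w => cheb_mix W t (X w)).
Proof.
move=> X2; rewrite (_ : (fun w => _) = (fun w => cheb_mix W t 1%:M *m X w));
    first exact: mxL2_mulmx.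
by apply/funext => w; rewrite cheb_mix_mulmx.
Qed.

(** Prox, mixing and local gradients are Lipschitz and so keep second moments finite. The batches
    enter D only through [Vn k w - Vo k w], controlled by the displacement of X, and the estimator
    through its error. *)
Lemma state_L2 k : (k <= K)%N ->
  [/\ mxL2 P (Xk k), mxL2 P (Dk k), mxL2 P (Yk k) & mxL2 P (Xk k.+1)].
Proof.
have next k' : mxL2 P (Xk k') -> mxL2 P (Yk k') -> mxL2 P (Xk k'.+1).
  move=> X2 Y2; rewrite (funext (st_XS k')); apply: mxL2_rows => i; apply: prox_mxL2.
  apply: mxL2B; last by apply: mxL2Z; exact: mxL2_row.
  by apply: mxL2_row; rewrite (funext (st_ZE k')); exact: cheb_mxL2.
elim: k => [|k IH] kK.
  have X2 : mxL2 P (Xk 0) by exact: mxL2_cst.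
  have D2 : mxL2 P (Dk 0).
    apply: mxL2_rows => i.
    rewrite (_ : (fun w => _) = (fun w => m0%:R^-1 *: \sum_(j < m0) sgrad F i (row i X0)
        (xi0 i j w))).
      apply: mxL2Z; apply: mxL2_sum => j c l; rewrite (ord1 c).
      apply: (L2_law (f := fun s => sgrad F i (row i X0) s 0 l) (proj1 laws i j)).
      exact: (sgrad_mxL2 pb).
    by apply/funext => w; rewrite minibatch_gradE.
  have Y2 : mxL2 P (Yk 0) by exact: cheb_mxL2.
  by split; [exact: X2|exact: D2|exact: Y2|exact: next].
have [X2 D2 Y2 Xn2] := IH (ltnW kK).
have D2' : mxL2 P (Dk k.+1).
  rewrite (funext (st_DS k)); apply: mxL2D; apply: mxL2Z; last first.
    apply: mxL2_of_rows => i.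
    rewrite (_ : (fun w => _) = (fun w => (row i (Vt k w) - lgrad i (row i (Xk k.+1 w))) +
        lgrad i (row i (Xk k.+1 w)))).
      by apply: mxL2D; [exact: (estimate_noise_le i kK).1|apply: lgrad_mxL2; exact: mxL2_row].
    by apply/funext => w; rewrite subrK.
  rewrite (_ : (fun w => _) = (fun w => Dk k w + (Vn k w - Vo k w))); last first.
    by apply/funext => w; rewrite addrA.
  by apply: mxL2D => //; apply: mxL2_of_rows => i; exact: (batch_diff_le i kK X2 Xn2).1.
have Y2' : mxL2 P (Yk k.+1).
  rewrite (funext (st_YS k)); apply: cheb_mxL2; apply: mxL2B; last exact: D2.
  by apply: mxL2D; [exact: Y2|exact: D2'].
by split; [exact: Xn2|exact: D2'|exact: Y2'|exact: next].
Qed.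

Let gradmx (X : 'M[R]_(N, p)) := \matrix_(i < N) lgrad i (row i X).

Lemma residualE k w : Rk k w = Dk k w - gradmx (Xk k w).
Proof. by apply/row_matrixP => i; rewrite rowB !rowK. Qed.

Let dif k w := Vn k w - Vo k w.
Let gdif k w := gradmx (Xk k.+1 w) - gradmx (Xk k w).
Let err k w := Vt k w - gradmx (Xk k.+1 w).

Let noise k w := (1 - b) *: (dif k w - gdif k w) + b *: err k w.

(** With true gradients in place of the sampled ones, the update of D would give exactly (1 - b) R;
    [noise] collects the deviations. *)
Lemma residualS k w : Rk k.+1 w = (1 - b) *: Rk k w + noise k w.
Proof.
rewrite !residualE st_DS /noise /dif /gdif /err.
move: (Dk k w) (Vn k w) (Vo k w) (Vt k w) (gradmx (Xk k w)) (gradmx (Xk k.+1 w)).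
by move=> u1 u2 u3 u4 u5 u6; apply/matrixP => i j; rewrite !mxE; ring.
Qed.

(** Each of the four terms is small: the two differences of gradients scale with the displacement of
    X, while the estimator error and the residual carry a factor b. *)
Lemma D_diffE k w : Dk k.+1 w - Dk k w = ((1 - b) *: dif k w + b *: err k w) +
    (b *: gdif k w - b *: Rk k w).
Proof.
rewrite !residualE st_DS /dif /gdif /err.
move: (Dk k w) (Vn k w) (Vo k w) (Vt k w) (gradmx (Xk k w)) (gradmx (Xk k.+1 w)).
by move=> u1 u2 u3 u4 u5 u6; apply/matrixP => i j; rewrite !mxE; ring.
Qed.

Let row_gradmx i X : row i (gradmx X) = lgrad i (row i X). Proof. by rewrite rowK. Qed.

Let row_noise i k w : row i (noise k w) = (1 - b) *: ((row i (Vn k w) - row i (Vo k w)) -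
   (lgrad i (row i (Xk k.+1 w)) - lgrad i (row i (Xk k w)))) +
   b *: (row i (Vt k w) - lgrad i (row i (Xk k.+1 w))).
Proof.
rewrite -!row_gradmx /noise /dif /gdif /err.
move: (Vn k w) (Vo k w) (Vt k w) (gradmx (Xk k w)) (gradmx (Xk k.+1 w)).
by move=> u1 u2 u3 u4 u5; apply/rowP => j; rewrite !mxE.
Qed.

Lemma residual_L2 k : (k <= K)%N -> mxL2 P (Rk k).
Proof.
move=> kK; have [X2 D2 _ _] := state_L2 kK.
rewrite (funext (residualE k)); apply: mxL2B => //; apply: mxL2_rows => i.
by apply: lgrad_mxL2; exact: mxL2_row.
Qed.

(** * Second-moment recursions over one step *)

Section OneStep.
Context (k : nat) (kK : (k < K)%N).

Let X2 : mxL2 P (Xk k). Proof. by case: (state_L2 (ltnW kK)). Qed.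
Let Xn2 : mxL2 P (Xk k.+1). Proof. by case: (state_L2 (ltnW kK)). Qed.

Let dX2 : mxL2 P (fun w => Xk k.+1 w - Xk k w).
Proof. exact: mxL2B. Qed.

Let sum_dx c : \sum_i c * Ex P (fun w => sqnorm (row i (Xk k.+1 w) - row i (Xk k w))) =
  c * Ex P (fun w => sqnorm (Xk k.+1 w - Xk k w)).
Proof.
rewrite (Ex_sqnorm_rows dX2) mulr_sumr; apply: eq_bigr => i _; congr (_ * Ex P _).
by apply/funext => w; rewrite rowB.
Qed.

Lemma noise_L2 : mxL2 P (noise k).
Proof.
apply: mxL2_of_rows => i; rewrite (funext (row_noise i k)).
exact: (noise_le i kK X2 Xn2).1.
Qed.

Lemma noise_sqnorm_le : Ex P (fun w => sqnorm (noise k w)) <=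
  2 * L ^+ 2 * Ex P (fun w => sqnorm (Xk k.+1 w - Xk k w)) + 2 * b ^+ 2 * N%:R * shat ^+ 2.
Proof.
rewrite (Ex_sqnorm_rows noise_L2).
apply: (@le_trans _ _ (\sum_i (2 * L ^+ 2 * Ex P (fun w => sqnorm (row i (Xk k.+1 w)
    - row i (Xk k w)))
   + 2 * b ^+ 2 * shat ^+ 2))).
  apply: ler_sum => i _; apply: le_trans (noise_le i kK X2 Xn2).2.
  by apply: le_of_eq; congr (Ex P _); apply/funext => w; rewrite row_noise.
rewrite big_split /= sum_dx lerD2l sumr_const card_ord -[_ * shat ^+ 2 *+ N]mulr_natl.
by rewrite mulrA [N%:R * _]mulrC.
Qed.

Lemma noise_orth i l (A : g_sigma_algebraType (joint sample_ev (past k i)) -> R) :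
  measurable_fun setT A -> L2 P A -> Ex P (fun w => A w * noise k w i l) = 0.
Proof.
move=> mA A2; have := noise_orthogonal kK l mA A2; congr (_ = _); congr (Ex P _).
by apply/funext => w; rewrite -row_noise; congr (_ * _); rewrite mxE.
Qed.

Let past_residual i i' l : measurable_fun setT
  (fun w : g_sigma_algebraType (joint sample_ev (past k i)) => Rk k w i' l).
Proof.
have [mX mD _ _] := @past_state k i kK.
have : mx_measurable (fun w : g_sigma_algebraType (joint sample_ev (past k i)) =>
    Dk k w - gradmx (Xk k w)).
  apply: mx_measurableB => //; apply: mx_measurable_rows => i''.
  by apply: (lgrad_measurable pb); exact: mx_measurable_row.
by move=> /(_ i' l); under eq_fun do rewrite -residualE.
Qed.

Let past_noise i i' l : i' != i -> measurable_fun setT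
  (fun w : g_sigma_algebraType (joint sample_ev (past k i)) => noise k w i' l).
Proof.
move=> i'i; have [mX _ _ mXn] := @past_state k i kK.
have sm := @past_sample k i kK k i'; rewrite eqxx i'i orbT in sm.
have := sm isT => {}sm.
pose S := g_sigma_algebraType (joint sample_ev (past k i)).
have mr : mx_measurable (fun w : S => row i' (noise k w)); last first.
  by have := mr 0 l; under eq_fun do rewrite mxE.
under eq_fun do rewrite row_noise.
apply: mx_measurableD; apply: mx_measurableZ.
  apply: mx_measurableB; apply: mx_measurableB.
  - under eq_fun do rewrite rowK; apply: minibatch_measurable; first by case: sm.
    exact: mx_measurable_row.
  - under eq_fun do rewrite rowK; apply: minibatch_measurable; first by case: sm.
    exact: mx_measurable_row.
  - by apply: (lgrad_measurable pb); exact: mx_measurable_row.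
  - by apply: (lgrad_measurable pb); exact: mx_measurable_row.
apply: mx_measurableB.
  under eq_fun do rewrite rowK; apply: estimate_measurable => //.
  exact: mx_measurable_row.
by apply: (lgrad_measurable pb); exact: mx_measurable_row.
Qed.

Let R2 : mxL2 P (Rk k). Proof. exact: residual_L2 (ltnW kK). Qed.

Let onemb2 : (1 - b) ^+ 2 <= 1 - b.
Proof. by case/andP: b01 => b0 b1; rewrite expr2 ler_piMl // ?subr_ge0 // gerBl. Qed.

Lemma residual_le : Ex P (fun w => sqnorm (Rk k.+1 w)) <= (1 - b) * Ex P (fun w => sqnorm (Rk k w))
  + 2 * L ^+ 2 * Ex P (fun w => sqnorm (Xk k.+1 w - Xk k w)) + 2 * b ^+ 2 * N%:R * shat ^+ 2.
Proof.
have N2 := noise_L2.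
have E : Ex P (fun w => sqnorm (Rk k.+1 w)) = Ex P (fun w => (1 - b) ^+ 2 * sqnorm (Rk k w) +
   2 * (1 - b) * dot (Rk k w) (noise k w) + sqnorm (noise k w)).
  by congr (Ex P _); apply/funext => w; rewrite residualS sqnormD sqnormZ dotZl mulrA.
apply: (le_trans (le_of_eq E)).
have R1 := mxL2_sqnorm R2; have RN1 := mxL2_dot R2 N2.
have orth : Ex P (fun w => dot (Rk k w) (noise k w)) = 0.
  rewrite Ex_dot //; apply: big1 => i _; apply: big1 => l _.
  by apply: noise_orth; [exact: past_residual|exact: R2].
rewrite ExD; [|by apply: L1D; exact: L1Z|exact: mxL2_sqnorm].
rewrite ExD; [|exact: L1Z|exact: L1Z].
rewrite !ExZ // orth mulr0 addr0 -addrA; apply: lerD; last exact: noise_sqnorm_le.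
by rewrite ler_wpM2r // Ex_ge0 // => w; exact: sqnorm_ge0.
Qed.

(* For i <> i' the row i' of the noise belongs to the past of the row i, so
   the rows are orthogonal in L2. *)
Lemma mean_noiseE : Ex P (fun w => sqnorm (mean_row (noise k w))) =
  N%:R^-1 ^+ 2 * Ex P (fun w => sqnorm (noise k w)).
Proof.
have N2 := noise_L2.
transitivity (\sum_l N%:R^-1 ^+ 2 * \sum_i Ex P (fun w => noise k w i l ^+ 2)); last first.
  rewrite -mulr_sumr exchange_big /=; congr (_ * _).
  rewrite (_ : (fun w => sqnorm (noise k w)) = (fun w => dot (noise k w) (noise k w))); last first.
    by apply/funext => w; rewrite sqnormE.
  by rewrite Ex_dot //; apply: eq_bigr => i _; apply: eq_bigr => l _; rewrite -expr2.
rewrite (_ : (fun w => _) = (fun w => \sum_l N%:R^-1 ^+ 2 * \sum_i \sum_i' noise k w i' l * noise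
    k w i l)); last first.
  apply/funext => w; rewrite /sqnorm big_ord1; apply: eq_bigr => l _.
  rewrite mean_rowE exprMn; congr (_ * _); rewrite expr2 mulr_sumr; apply: eq_bigr => i _.
  by rewrite mulr_suml.
have l1 i i' l : L1 P (fun w => noise k w i' l * noise k w i l) by apply: L2M; exact: N2.
have l1' i l : L1 P (fun w => \sum_i' noise k w i' l * noise k w i l) by apply: L1_sum.
have l1'' l : L1 P (fun w => \sum_i \sum_i' noise k w i' l * noise k w i l) by apply: L1_sum.
rewrite Ex_sum => [|l]; last exact: L1Z.
apply: eq_bigr => l _; rewrite ExZ //; congr (_ * _).
rewrite Ex_sum //; apply: eq_bigr => i _; rewrite Ex_sum // (bigD1 i) //= big1 ?addr0 => [|i' i'i].
  by congr (Ex P _); apply/funext => w; rewrite expr2.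
by apply: noise_orth; [exact: past_noise|exact: N2].
Qed.

Lemma mean_residual_le : Ex P (fun w => sqnorm (mean_row (Rk k.+1 w))) <=
  (1 - b) * Ex P (fun w => sqnorm (mean_row (Rk k w)))
  + N%:R^-1 ^+ 2 * (2 * L ^+ 2 * Ex P (fun w => sqnorm (Xk k.+1 w - Xk k w)) + 2 * b ^+
      2 * N%:R * shat ^+ 2).
Proof.
have N2 := noise_L2.
have Rm2 : mxL2 P (fun w => mean_row (Rk k w)) by exact: mxL2_mean_row.
have Nm2 : mxL2 P (fun w => mean_row (noise k w)) by exact: mxL2_mean_row.
have E : Ex P (fun w => sqnorm (mean_row (Rk k.+1 w))) = Ex P (fun w => (1 - b) ^+
    2 * sqnorm (mean_row (Rk k w)) +
   2 * (1 - b) * dot (mean_row (Rk k w)) (mean_row (noise k w)) + sqnorm (mean_row (noise k w))).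
  by congr (Ex P _); apply/funext => w; rewrite residualS mean_rowD mean_rowZ sqnormD sqnormZ
      dotZl mulrA.
apply: (le_trans (le_of_eq E)).
have R1 := mxL2_sqnorm Rm2; have RN1 := mxL2_dot Rm2 Nm2.
have orth : Ex P (fun w => dot (mean_row (Rk k w)) (mean_row (noise k w))) = 0.
  rewrite Ex_dot //; apply: big1 => c _; apply: big1 => l _; rewrite (ord1 c).
  rewrite (_ : (fun w => _) = (fun w => N%:R^-1 * \sum_i mean_row (Rk k w) 0 l * noise k w i l));
      last first.
    by apply/funext => w; rewrite (mean_rowE (noise k w)) mulrCA mulr_sumr.
  have h i : L1 P (fun w => mean_row (Rk k w) 0 l * noise k w i l).
    by apply: L2M; [exact: Rm2|exact: N2].
  rewrite ExZ; last exact: L1_sum.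
  rewrite Ex_sum // big1 ?mulr0 // => i _; apply: noise_orth; last exact: Rm2.
  have mR : mx_measurable (fun w : g_sigma_algebraType (joint sample_ev (past k i)) => Rk k w).
    by move=> i' l'; exact: past_residual.
  exact: (mx_measurable_mean_row mR 0 l).
rewrite ExD; [|by apply: L1D; exact: L1Z|exact: mxL2_sqnorm].
rewrite ExD; [|exact: L1Z|exact: L1Z].
rewrite !ExZ // orth mulr0 addr0; apply: lerD.
  by rewrite ler_wpM2r // Ex_ge0 // => w; exact: sqnorm_ge0.
by rewrite mean_noiseE ler_wpM2l ?sqr_ge0 //; exact: noise_sqnorm_le.
Qed.

Lemma D_diff_le : Ex P (fun w => sqnorm (Dk k.+1 w - Dk k w)) <=
  4 * b ^+ 2 * Ex P (fun w => sqnorm (Rk k w))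
  + 8 * L ^+ 2 * Ex P (fun w => sqnorm (Xk k.+1 w - Xk k w)) + 4 * b ^+ 2 * N%:R * shat ^+ 2.
Proof.
have dif2 : mxL2 P (dif k) by apply: mxL2_of_rows => i; exact: (batch_diff_le i kK X2 Xn2).1.
have err2' i : mxL2 P (fun w => row i (Vt k w) - lgrad i (row i (Xk k.+1 w))).
  exact: (estimate_noise_le i kK).1.
have row_err i : (fun w => row i (err k w)) = (fun w => row i (Vt k w)
    - lgrad i (row i (Xk k.+1 w))).
  by apply/funext => w; rewrite rowB row_gradmx.
have err2 : mxL2 P (err k) by apply: mxL2_of_rows => i; rewrite row_err.
have difle : Ex P (fun w => sqnorm (dif k w)) <= L ^+ 2 * Ex P (fun w =>
    sqnorm (Xk k.+1 w - Xk k w)).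
  rewrite (Ex_sqnorm_rows dif2) -sum_dx; apply: ler_sum => i _.
  exact: (batch_diff_le i kK X2 Xn2).2.
have errle : Ex P (fun w => sqnorm (err k w)) <= N%:R * shat ^+ 2.
  rewrite (Ex_sqnorm_rows err2); apply: (@le_trans _ _ (\sum_(i < N) shat ^+ 2)).
    apply: ler_sum => i _; apply: le_trans (estimate_noise_le i kK).2.
    by rewrite (_ : (fun w => sqnorm (row i (err k w))) =
      (fun w => sqnorm (row i (Vt k w) - lgrad i (row i (Xk k.+1 w))))) //;
       apply/funext => w; rewrite rowB row_gradmx.
  by rewrite sumr_const card_ord mulr_natl.
have gdifle w : sqnorm (gdif k w) <= L ^+ 2 * sqnorm (Xk k.+1 w - Xk k w).
  rewrite !sqnorm_rows mulr_sumr; apply: ler_sum => i _.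
  by rewrite !rowB !row_gradmx; exact: (lgrad_lipschitz pb).
have d1 := mxL2_sqnorm dif2; have e1 := mxL2_sqnorm err2; have r1 := mxL2_sqnorm R2.
have x1 := mxL2_sqnorm dX2.
have Dd2 : mxL2 P (fun w => Dk k.+1 w - Dk k w).
  by apply: mxL2B; [case: (state_L2 kK)|case: (state_L2 (ltnW kK))].
apply: (@le_trans _ _ (Ex P (fun w => 4 * sqnorm (dif k w) + 4 * b ^+ 2 * sqnorm (err k w)
   + 4 * L ^+ 2 * sqnorm (Xk k.+1 w - Xk k w) + 4 * b ^+ 2 * sqnorm (Rk k w)))).
  apply: Ex_le; [exact: mxL2_sqnorm| |].
    by do 3 (apply: L1D; last exact: L1Z); exact: L1Z.
  move=> w; rewrite D_diffE.
  by have := sqnorm_momentum_le (dif k w) (err k w) (Rk k w) b01 (gdifle w); rewrite mulrA.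
rewrite ExD; [|by do 2 (apply: L1D; last exact: L1Z); exact: L1Z|exact: L1Z].
rewrite ExD; [|by apply: L1D; exact: L1Z|exact: L1Z].
rewrite ExD; [|exact: L1Z|exact: L1Z].
rewrite !ExZ //.
have errle' := ler_wpM2l (sqr_ge0 b) errle.
move: difle errle'.
move: (Ex P _) (Ex P _) (Ex P _) (Ex P _) => q1 q2 q3 q4 difle errle'.
rewrite -!mulrA; rewrite -!mulrA in difle errle'; lra.
Qed.

End OneStep.

(** * The random output index *)

Section Tau.

Let idx : finType := (unit + 'I_N * 'I_m0 + 'I_K * 'I_N * 'I_m + 'I_K * 'I_N * 'I_m)%type.

Definition samples : {set idx} := [set s : idx | if s is inl (inl (inl _))
    then false else true]%SET.

Let S0 : measurableType _ := g_sigma_algebraType (joint sample_ev samples).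

Let id0 : Om -> S0 := id.

Let mid0 : measurable_fun setT id0.
Proof.
move=> _ A mA; rewrite setTI.
exact: (sub_measurable_generated (@joint_sample_measurable samples)).
Qed.

Lemma samples_state k : (k <= K)%N ->
  [/\ mx_measurable (fun w : S0 => Xk k w), mx_measurable (fun w : S0 => Dk k w),
   mx_measurable (fun w : S0 => Yk k w) & mx_measurable (fun w : S0 => Xk k.+1 w)].
Proof.
move=> kK; apply: (@state_measurable _ S0 (fun w => w)) => //.
  by move=> i j; apply: (@joint_measurable_fun _ (inl (inl (inr (i, j))))); rewrite ?inE.
move=> k' i k'k; have k'K := leq_trans k'k kK; split.
  by move=> j; apply: (@joint_measurable_fun _ (inl (inr (Ordinal k'K, i, j)))); rewrite ?inE.
case e: est => [Gs xit|//] j.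
apply: (@joint_measurable_fun _ (inr (Ordinal k'K, i, j))); rewrite ?inE //.
by rewrite /= e.
Qed.

Let tau_independent A B : measurable A -> measurable B ->
  P (mkRV P mid0 @^-1` A `&` tau @^-1` B) = (P (mkRV P mid0 @^-1` A) * P (tau @^-1` B))%E.
Proof.
move=> mA mB.
apply: (@joint_indep _ _ _ P _ _ _ _ _ indep samples (~: samples)%SET) => //.
- by move=> s; case: (sample_evP s).
- by move=> s; case: (sample_evP s).
- by move=> s; case: (sample_evP s).
- by move=> s; rewrite inE => /negbTE.
- apply: sub_sigma_algebra; apply: (@joint_ev _ _ _ _ _ _ (inl (inl (inl tt)))).
  + by move=> s; case: (sample_evP s).
  + by rewrite !inE.
  + by exists B => //; rewrite setTI.
Qed.

(* [tau] may take values outside {0, ..., K - 1}, but only on a null set. *)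
Lemma tau_average (f : nat -> Om -> R) : (0 < K)%N -> uniform_index K tau ->
  (forall k w, 0 <= f k w) ->
  (forall k, (k < K)%N -> measurable_fun setT (fun w : S0 => f k w)) ->
  (forall k, (k < K)%N -> L1 P (f k)) ->
  (\int[P]_w (f (tau w) w)%:E <= (K%:R^-1 * \sum_(k < K) Ex P (f k))%:E)%E.
Proof.
move=> K0 unif f0 mf f1; pose mu : probability nat R := distribution P tau.
have mu1 k : (k < K)%N -> mu [set k] = (K%:R^-1)%:E by move=> kK; exact: unif.
(* The average is split over the values of [tau]; as [tau] is independent of all the samples, the
   mean of [g k] is that of [f k] divided by K. *)
pose g k w : R := f k w * \1_[set k] (tau w).
have m1 k : measurable_fun setT (\1_[set k] : nat -> R) by [].
have g0 k w : 0 <= g k w by rewrite mulr_ge0.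
have gle k w : `|g k w| <= f k w.
  by rewrite ger0_norm // ler_piMr // indicE; case: (_ \in _).
have mg k : (k < K)%N -> measurable_fun setT (g k).
  move=> kK; apply: measurable_funM; first exact: L1_measurable (f1 k kK).
  exact: (measurableT_comp (m1 k)).
have g1 k : (k < K)%N -> L1 P (g k).
  by move=> kK; apply: L1_le (f1 k kK); [exact: mg|exact: gle].
have Eg k : (k < K)%N -> Ex P (g k) = K%:R^-1 * Ex P (f k).
  move=> kK; rewrite -ExZ; last exact: f1.
  have i1 : L1 mu (\1_[set k] : nat -> R).
    apply: (@L1_le _ _ _ _ _ (fun=> 1)); [exact: m1| |exact: L1_cst].
    by move=> s; rewrite ger0_norm // indicE; case: (_ \in _).
  have := @ge0_freezing _ _ _ P _ _ S0 _ (mkRV P mid0) tau mu (fun _ _ => erefl) tau_independent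
    (fun z => (f k z.1 * \1_[set k] z.2)%:E).
  rewrite /= => h; rewrite /Ex /Rintegral h.
  - congr fine; apply: eq_integral => w _.
    rewrite integral_Ex; last exact: L1Z.
    rewrite ExZ // mulrC; congr (_ * _)%:E.
    apply: EFin_inj; rewrite -integral_Ex // integral_indic // setIT.
    exact: mu1.
  - apply/measurable_EFinP; apply: measurable_funM.
      exact: (measurableT_comp (mf k kK) measurable_fst).
    exact: (measurableT_comp (m1 k) measurable_snd).
  - by move=> z; rewrite lee_fin mulr_ge0.
pose A := tau @^-1` [set n | (K <= n)%N].
have mA : measurable A.
  by rewrite /A -[X in measurable X]setTI; exact: measurable_funPT.
(* The K atoms of mass 1 / K already exhaust the total probability. *)
have PA : P A = 0%E.
  have muK : mu [set n | (n < K)%N] = 1%E.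
    have -> : [set n | (n < K)%N] = \big[setU/set0]_(k < K) [set (k : nat)].
      rewrite -(bigcup_mkord K (fun k => [set k])); apply/seteqP; split => n /=.
        by move=> nK; exists n.
      by move=> [k kK ->].
    rewrite measure_bigsetU_ord //; last first.
      by move=> i j _ _ [n [/= ni nj]]; apply: val_inj; rewrite /= -ni -nj.
    rewrite (eq_bigr (fun _ => (K%:R^-1)%:E)) => [|k _]; last exact: mu1.
    rewrite sumEFin sumr_const card_ord -[_ *+ K]mulr_natl mulfV // pnatr_eq0 -lt0n //.
  have -> : P A = mu (~` [set n | (n < K)%N]).
    congr (P _); apply/seteqP; split => w /= => [h1 h2|/negP]; last by rewrite -leqNgt.
    by have := leq_ltn_trans h1 h2; rewrite ltnn.
  rewrite probability_setC // muK subee //.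
have L1s : L1 P (fun w => \sum_(k < K) g k w) by apply: L1_sum => k; exact: g1.
apply: (@le_trans _ _ (\int[P]_w (\sum_(k < K) g k w)%:E)%E).
  apply: (@integral_le_null _ _ _ _ _ _ A) => //.
  - by move=> w; rewrite lee_fin.
  - by move=> w; rewrite lee_fin; apply: sumr_ge0 => k _; exact: g0.
  - by apply/measurable_EFinP; exact: L1_measurable L1s.
  - move=> w; rewrite /A /= => /negP; rewrite -ltnNge => tK; rewrite lee_fin.
    rewrite (bigD1 (Ordinal tK)) //= /g indicE mem_set // mulr1 lerDl.
    by apply: sumr_ge0 => k _; rewrite mulr_ge0.
rewrite integral_Ex // Ex_sum => [|k]; last exact: g1.
by rewrite mulr_sumr lee_fin; apply: ler_sum => k _; rewrite Eg.
Qed.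

End Tau.

(** * Summation over the run *)

Section Telescope.
Context (E : rel 'I_N) (mixW : mixing_matrix E W) (Tpos : (0 < T)%N).
Let d : R := 1 - mix_rho_tilde W T.
Hypotheses (aL : a * L <= d ^+ 2 / 64) (bE : b = 144 * (a * L) ^+ 2 / N%:R).

Let d01 : 0 < d <= 1.
Proof. by rewrite subr_gt0 (mix_rho_tilde_lt1 N0 mixW) //= gerBl mix_rho_tilde_ge0. Qed.

Let phi k w := objective D F r (mean_row (Xk k w)).
Let gap k w := stationarity_gap D F r L a (Zk k w).

Lemma mean_tracking k w : mean_row (Yk k w) = mean_row (Dk k w).
Proof.
elim: k => [|k IH]; first exact: (mean_row_cheb N0 mixW).
rewrite st_YS (mean_row_cheb N0 mixW) -addrA mean_rowD mean_rowD mean_rowN IH.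
by rewrite addrC subrK.
Qed.

Let q k w := - ((4 * a * N%:R)^-1 * sqnorm (Xk k.+1 w - Xk k w))
  + 5 * a / 2 * sqnorm (mean_row (Rk k w)) + 2 / (a * N%:R) * sqnorm (perp (Xk k w))
  + (8 * N%:R * L)^-1 * sqnorm (perp (Yk k w)).

Let XZ k w : Xk k.+1 w =
  \matrix_(i < N) P_ (row i (cheb_mix W T (Xk k w)) - a *: row i (Yk k w)).
Proof. by apply/row_matrixP => i; rewrite st_XS !rowK st_ZE. Qed.

Lemma pathwise_descent k w : phi k.+1 w + a / 8 * gap k w <= phi k w + q k w.
Proof.
have := step_inequality N0 pb mixW a0 Tpos aL (Xk k w) (mean_tracking k w).
rewrite /phi /gap /q (XZ k w) (st_ZE k w) => h; apply: (le_trans h).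
by rewrite -!addrA.
Qed.

Lemma perp_X_le k w : sqnorm (perp (Xk k.+1 w)) <=
  (1 - d) * sqnorm (perp (Xk k w)) + a ^+ 2 / d * sqnorm (perp (Yk k w)).
Proof.
by rewrite (XZ k w); exact: (perp_step N0 pb mixW a0 Tpos (Xk k w) (Yk k w)).
Qed.

Lemma perp_Y_le k w : sqnorm (perp (Yk k.+1 w)) <=
  (1 - d) * sqnorm (perp (Yk k w)) + d^-1 * sqnorm (Dk k.+1 w - Dk k w).
Proof. by rewrite st_YS; exact: (perp_tracking N0 mixW Tpos). Qed.

Lemma gap_ge0 k w : 0 <= gap k w.
Proof.
rewrite addr_ge0 // mulr_ge0 ?invr_ge0 ?sqnorm_ge0 // ?divr_ge0 ?sqr_ge0 //.
by apply: sumr_ge0 => i _; exact: sqnorm_ge0.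
Qed.

Lemma gap_measurable dS (S : measurableType dS) (Z : S -> 'M[R]_(N, p)) : mx_measurable Z ->
  measurable_fun setT (fun w => stationarity_gap D F r L a (Z w)).
Proof.
move=> mZ; apply: measurable_funD; last first.
  by apply: measurable_funM => //; apply: measurable_sqnorm; exact: mx_measurable_perp.
apply: measurable_funM => //; apply: measurable_sum => i; apply: measurable_sqnorm.
have mz : mx_measurable (fun w => row i (Z w)) by exact: mx_measurable_row.
apply: mx_measurableZ; apply: mx_measurableB => //; apply: prox_measurable.
apply: mx_measurableB => //; apply: mx_measurableZ.
rewrite (_ : (fun w => _) = (fun w => mean_row (\matrix_(i' < N) lgrad i' (row i (Z w)))));
    last first.
  by apply/funext => w; rewrite (gradient_avg_loss pb).
apply: mx_measurable_mean_row; apply: mx_measurable_rows => i'.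
exact: (lgrad_measurable pb).
Qed.

Section Moments.
Context (k : nat) (kK : (k <= K)%N).

Let X2 : mxL2 P (Xk k). Proof. by case: (state_L2 kK). Qed.
Let D2 : mxL2 P (Dk k). Proof. by case: (state_L2 kK). Qed.
Let Y2 : mxL2 P (Yk k). Proof. by case: (state_L2 kK). Qed.
Let Xn2 : mxL2 P (Xk k.+1). Proof. by case: (state_L2 kK). Qed.
Let R2 : mxL2 P (Rk k). Proof. exact: residual_L2. Qed.

Lemma mxL2_perp (X : Om -> 'M[R]_(N, p)) : mxL2 P X -> mxL2 P (fun w => perp (X w)).
Proof. by move=> XX2; apply: mxL2B => //; exact: mxL2_mulmx. Qed.

Lemma perp_X_L1 : L1 P (fun w => sqnorm (perp (Xk k w))).
Proof. by apply: mxL2_sqnorm; exact: mxL2_perp. Qed.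

Lemma perp_Y_L1 : L1 P (fun w => sqnorm (perp (Yk k w))).
Proof. by apply: mxL2_sqnorm; exact: mxL2_perp. Qed.

Lemma residual_L1 : L1 P (fun w => sqnorm (Rk k w)).
Proof. exact: mxL2_sqnorm. Qed.

Lemma mean_residual_L1 : L1 P (fun w => sqnorm (mean_row (Rk k w))).
Proof. by apply: mxL2_sqnorm; exact: mxL2_mean_row. Qed.

Lemma dX_L1 : L1 P (fun w => sqnorm (Xk k.+1 w - Xk k w)).
Proof. by apply: mxL2_sqnorm; exact: mxL2B. Qed.

(** Dominated on every path by the right-hand side of [stationarity_gap_le], whose terms are all
    integrable. *)
Lemma gap_L1 : L1 P (gap k).
Proof.
have mZ : mx_measurable (Zk k).
  rewrite (funext (st_ZE k)); apply: mx_measurable_cheb; exact: mxL2_measurable.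
have Z2 : mxL2 P (Zk k) by rewrite (funext (st_ZE k)); exact: cheb_mxL2.
apply: (@L1_le _ _ _ _ _ (fun w => 2 / (a ^+ 2 * N%:R) * sqnorm (Xk k.+1 w - Zk k w)
   + 8 / N%:R * sqnorm (perp (Yk k w))
   + 8 * sqnorm (mean_row (Rk k w)) + 17 * L ^+ 2 / N%:R * sqnorm (perp (Xk k w)))).
- exact: (gap_measurable mZ).
- move=> w; rewrite ger0_norm ?gap_ge0 //.
  rewrite /gap (XZ k w) (st_ZE k w).
  exact: (stationarity_gap_le N0 pb mixW a0 Tpos (Xk k w) (mean_tracking k w)).
apply: L1D; last by apply: L1Z; exact: perp_X_L1.
apply: L1D; last by apply: L1Z; exact: mean_residual_L1.
apply: L1D; last by apply: L1Z; exact: perp_Y_L1.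
by apply: L1Z; apply: mxL2_sqnorm; exact: mxL2B.
Qed.

Lemma q_L1 : L1 P (q k).
Proof.
apply: L1D; last by apply: L1Z; exact: perp_Y_L1.
apply: L1D; last by apply: L1Z; exact: perp_X_L1.
apply: L1D; last by apply: L1Z; exact: mean_residual_L1.
by under eq_fun do rewrite -mulNr; apply: L1Z; exact: dX_L1.
Qed.

Lemma Ex_q : Ex P (q k) = - ((4 * a * N%:R)^-1 * Ex P (fun w => sqnorm (Xk k.+1 w - Xk k w)))
  + 5 * a / 2 * Ex P (fun w => sqnorm (mean_row (Rk k w)))
  + 2 / (a * N%:R) * Ex P (fun w => sqnorm (perp (Xk k w)))
  + (8 * N%:R * L)^-1 * Ex P (fun w => sqnorm (perp (Yk k w))).
Proof.
have l1 := perp_Y_L1; have l2 := perp_X_L1; have l3 := mean_residual_L1; have l4 := dX_L1.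
rewrite /q; under eq_fun do rewrite -mulNr.
rewrite ExD; [|by do 2 (apply: L1D; last exact: L1Z); exact: L1Z|exact: L1Z].
rewrite ExD; [|by apply: L1D; exact: L1Z|exact: L1Z].
rewrite ExD; [|exact: L1Z|exact: L1Z].
by rewrite !ExZ // mulNr.
Qed.

End Moments.

(** The expected Lyapunov function without its objective term; the weights are the gamma_i rewritten
    in terms of the step size a. *)
Let V k := (N%:R * L * d)^-1 * Ex P (fun w => sqnorm (perp (Yk k w)))
  + 16 / (N%:R * d * a) * Ex P (fun w => sqnorm (perp (Xk k w)))
  + (48 * N%:R * L ^+ 2 * a)^-1 * Ex P (fun w => sqnorm (Rk k w))
  + N%:R / (48 * L ^+ 2 * a) * Ex P (fun w => sqnorm (mean_row (Rk k w))).

Lemma Ex_sqnorm_ge0 m' n' (X : Om -> 'M[R]_(m', n')) : 0 <= Ex P (fun w => sqnorm (X w)).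
Proof. by apply: Ex_ge0 => w; exact: sqnorm_ge0. Qed.

Let L0 : 0 < L. Proof. exact: smoothness_gt0 pb. Qed.
Let N0R : 0 < (N%:R : R). Proof. by rewrite ltr0n. Qed.

Lemma potential_ge0 k : 0 <= V k.
Proof.
have /andP[d0 _] := d01; have a0' := ltW a0; have L0' := ltW L0; have d0' := ltW d0.
have L2' : 0 <= L ^+ 2 by rewrite sqr_ge0.
rewrite /V !addr_ge0 // mulr_ge0 ?Ex_sqnorm_ge0 // ?invr_ge0 ?divr_ge0 // !mulr_ge0 //.
Qed.

Lemma potential_step k : (k < K)%N ->
  V k.+1 + Ex P (q k) <= V k + 3024 * a ^+ 3 * L ^+ 2 / N%:R ^+ 2 * shat ^+ 2.
Proof.
move=> kK; rewrite (Ex_q (ltnW kK)) /V.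
have hx : Ex P (fun w => sqnorm (perp (Xk k.+1 w))) <=
    (1 - d) * Ex P (fun w => sqnorm (perp (Xk k w))) + a ^+ 2 / d * Ex P (fun w =>
        sqnorm (perp (Yk k w))).
  have l1 := perp_X_L1 (ltnW kK); have l2 := perp_Y_L1 (ltnW kK).
  rewrite -!ExZ // -ExD; [|exact: L1Z|exact: L1Z].
  apply: Ex_le; [exact: perp_X_L1|by apply: L1D; exact: L1Z|].
  by move=> w; exact: perp_X_le.
have hy : Ex P (fun w => sqnorm (perp (Yk k.+1 w))) <=
    (1 - d) * Ex P (fun w => sqnorm (perp (Yk k w))) + d^-1 * Ex P (fun w =>
        sqnorm (Dk k.+1 w - Dk k w)).
  have l1 := perp_Y_L1 (ltnW kK).
  have l2 : L1 P (fun w => sqnorm (Dk k.+1 w - Dk k w)).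
    by apply: mxL2_sqnorm; apply: mxL2B; [case: (state_L2 kK)|case: (state_L2 (ltnW kK))].
  rewrite -!ExZ // -ExD; [|exact: L1Z|exact: L1Z].
  apply: Ex_le; [exact: perp_Y_L1|by apply: L1D; exact: L1Z|].
  by move=> w; exact: perp_Y_le.
have N1 : (1 : R) <= N%:R by rewrite ler1n.
apply: (lyapunov_step_arith a0 L0 d01 N1 aL bE (sqr_ge0 shat) (Ex_sqnorm_ge0 _) (Ex_sqnorm_ge0 _)
  (Ex_sqnorm_ge0 _) (Ex_sqnorm_ge0 _) (Ex_sqnorm_ge0 _) hx hy (D_diff_le kK)
  (residual_le kK) (mean_residual_le kK)).
Qed.

(* [r], hence [objective], is not known to be integrable along the run: the
   objective is telescoped pathwise, and only the moments [q] and [gap] are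
   integrated. *)
Lemma gap_sum_le : a / 8 * \sum_(k < K) Ex P (gap k) <=
  phi 0%N point - phistar + V 0%N + K%:R * (3024 * a ^+ 3 * L ^+ 2 / N%:R ^+ 2 * shat ^+ 2).
Proof.
set c := 3024 * a ^+ 3 * L ^+ 2 / N%:R ^+ 2 * shat ^+ 2.
have step k : (k < K)%N -> V k.+1 + Ex P (q k) <= V k + c by exact: potential_step.
(* X^(0) is deterministic, so [phi 0%N] is constant and its value at [point] serves for every
   path. *)
have path n w : phi n w + \sum_(k < n) a / 8 * gap k w <= phi 0%N point + \sum_(k < n) q k w.
  elim: n => [|n IH]; first by rewrite !big_ord0 !addr0.
  by rewrite !big_ord_recr /=; have := pathwise_descent n w; lra.
have sum_q n : (n <= K)%N -> V n + Ex P (fun w => \sum_(k < n) q k w) <=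
    V 0%N + n%:R * c.
  elim: n => [|n IH] nK.
    by rewrite (_ : (fun w => _) = (fun=> 0)) ?Ex_cst ?mul0r //; apply/funext => w;
        rewrite big_ord0.
  rewrite (_ : (fun w => _) = (fun w => \sum_(k < n) q k w + q n w)); last first.
    by apply/funext => w; rewrite big_ord_recr.
  have l1 : L1 P (fun w => \sum_(k < n) q k w).
    apply: L1_sum => k; apply: q_L1; apply: ltnW; exact: ltn_trans (ltn_ord k) nK.
  rewrite ExD //; last exact: q_L1 (ltnW nK).
  rewrite -[n.+1%:R]natr1 mulrDl mul1r.
  exact: (telescope_step (step n nK) (IH (ltnW nK))).
have h := sum_q K (leqnn K); have VK := potential_ge0 K.
have l1 : L1 P (fun w => \sum_(k < K) q k w).
  by apply: L1_sum => k; apply: q_L1; apply: ltnW.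
have l2 k : (k < K)%N -> L1 P (fun w => a / 8 * gap k w).
  by move=> kK; apply: L1Z; apply: gap_L1; exact: ltnW.
have l3 : L1 P (fun w => \sum_(k < K) a / 8 * gap k w) by apply: L1_sum => k; exact: l2.
have : Ex P (fun w => phistar + \sum_(k < K) a / 8 * gap k w) <=
    Ex P (fun w => phi 0%N point + \sum_(k < K) q k w).
  apply: Ex_le; [by apply: L1D => //; exact: L1_cst|by apply: L1D => //; exact: L1_cst|].
  move=> w; apply: le_trans (path K w); rewrite lerD2r.
  exact: (objective_lower_bound pb).
rewrite ExD //; last exact: L1_cst.
rewrite ExD //; last exact: L1_cst.
rewrite !Ex_cst Ex_sum => [|k]; last exact: l2.
rewrite (eq_bigr (fun k : 'I_K => a / 8 * Ex P (gap k))) => [|k _]; last first.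
  by rewrite ExZ //; apply: gap_L1; exact: ltnW.
rewrite -mulr_sumr => main.
exact: (telescope_end h VK main).
Qed.

(** Nonnegativity of [Delta] is returned as well, since the tuning takes the square root of L
    Delta. *)
Lemma stationarity_bound Delta : (0 < K)%N -> uniform_index K tau ->
  ('E_P[fun w : Om => lyapunov D F r (N%:R * L * d)^-1 (16 / (N%:R * d * a))
      (48 * N%:R * L ^+ 2 * a)^-1 (N%:R / (48 * L ^+ 2 * a)) (run w 0%N)] - phistar%:E
    = Delta%:E)%E ->
  0 <= Delta /\
  ('E_P[stationarity_gap D F r L a \o (fun w => st_Z (run w (tau w)))] <=
    (8 * Delta / (a * K%:R) + 8 * (3024 * a ^+ 2 * L ^+ 2 / N%:R ^+ 2 * shat ^+ 2))%:E)%E.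
Proof.
move=> K0 unif; have l1 := perp_Y_L1 (leq0n K); have l2 := perp_X_L1 (leq0n K).
have l3 := residual_L1 (leq0n K); have l4 := mean_residual_L1 (leq0n K).
pose c1 := (N%:R * L * d)^-1; pose c2 := 16 / (N%:R * d * a).
pose c3 := (48 * N%:R * L ^+ 2 * a)^-1; pose c4 := N%:R / (48 * L ^+ 2 * a).
rewrite -/c1 -/c2 -/c3 -/c4.
have lyap : ('E_P[fun w : Om => lyapunov D F r c1 c2 c3 c4 (run w 0%N)] = (phi 0%N point +
    V 0%N)%:E)%E.
  rewrite unlock.
  have e : (fun w => lyapunov D F r c1 c2 c3 c4 (run w 0%N)) = (fun w => phi 0%N point
     + c1 * sqnorm (perp (Yk 0 w)) + c2 * sqnorm (perp (Xk 0 w)) + c3 * sqnorm (Rk 0 w)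
     + c4 * sqnorm (mean_row (Rk 0 w))) by [].
  have L1' : L1 P (fun w => lyapunov D F r c1 c2 c3 c4 (run w 0%N)).
    rewrite e; do 4 (apply: L1D; last exact: L1Z); exact: L1_cst.
  rewrite integral_Ex //; congr EFin; rewrite e.
  rewrite ExD; [|by do 3 (apply: L1D; last exact: L1Z); exact: L1_cst|exact: L1Z].
  rewrite ExD; [|by do 2 (apply: L1D; last exact: L1Z); exact: L1_cst|exact: L1Z].
  rewrite ExD; [|by apply: L1D; [exact: L1_cst|exact: L1Z]|exact: L1Z].
  rewrite ExD; [|exact: L1_cst|exact: L1Z].
  by rewrite Ex_cst !ExZ // -!addrA; congr (_ + _); rewrite /V -/c1 -/c2 -/c3 -/c4 !addrA.
rewrite lyap -EFinB => -[DE].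
have D0 : 0 <= Delta.
  rewrite -DE subr_ge0 -[phistar]addr0; apply: lerD; last exact: potential_ge0.
  exact: (objective_lower_bound pb).
split => //; rewrite unlock.
have := tau_average K0 unif gap_ge0 _ (fun k kK => gap_L1 (ltnW kK)).
move=> h; apply: le_trans (h _) _.
  move=> k kK; apply: gap_measurable; rewrite (funext (st_ZE k)).
  by apply: mx_measurable_cheb; case: (samples_state (ltnW kK)).
rewrite lee_fin; have K0R : 0 < (K%:R : R) by rewrite ltr0n.
rewrite mulrC ler_pdivrMr //.
have a8 : 0 < a / 8 by rewrite divr_gt0.
rewrite -(ler_pM2l a8); apply: le_trans gap_sum_le _.
apply: le_of_eq.
have -> : phi 0%N point - phistar + V 0%N = Delta by rewrite -DE addrAC.
by field; rewrite !gt_eqF.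
Qed.

End Telescope.

End Run.

(** * Tuning *)

Section Powers.
Context (R : realType).
Implicit Types x y : R.

Lemma cbrt_exprK x : 0 <= x -> (x `^ 3^-1) ^+ 3 = x.
Proof. by move=> x0; rewrite -powR_mulrn ?powR_ge0// -powRrM mulVf ?powRr1// pnatr_eq0. Qed.

Lemma powR23 x : x `^ (2 / 3) = (x `^ 3^-1) ^+ 2.
Proof. by rewrite -powR_mulrn ?powR_ge0// -powRrM mulrC. Qed.

Lemma powR32 x : 0 <= x -> x `^ (3 / 2) = Num.sqrt x ^+ 3.
Proof. by move=> x0; rewrite -powR12_sqrt// -powR_mulrn ?powR_ge0// -powRrM mulrC. Qed.

Lemma cube_le x y : 0 <= y -> x ^+ 3 <= y ^+ 3 -> x <= y.
Proof.
move=> y0 h; have [x0|x0] := ltP x 0; first exact: le_trans (ltW x0) y0.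
by rewrite -(@ler_pXn2r _ 3) // nnegrE.
Qed.

(** Each of 32 p and 32 s is at most q, and (512 + 6) / 32^2 < 1. This is the origin of the constant
    32^3. *)
Lemma cube_sum_bound (p s q : R) : 0 <= p -> 0 <= s -> 0 <= q ->
  32 ^+ 3 * (p ^+ 3 + s ^+ 3) <= q ^+ 3 -> 512 * p ^+ 2 + 6 * s ^+ 2 <= q ^+ 2.
Proof.
move=> p0 s0 q0 h; have p3 : 0 <= p ^+ 3 by rewrite exprn_ge0.
have s3 : 0 <= s ^+ 3 by rewrite exprn_ge0.
have c3 : 0 <= (32 ^+ 3 : R) by rewrite exprn_ge0.
have hp : 32 * p <= q.
  apply: cube_le => //; rewrite exprMn; apply: le_trans h.
  by rewrite ler_wpM2l // lerDl.
have hs : 32 * s <= q.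
  apply: cube_le => //; rewrite exprMn; apply: le_trans h.
  by rewrite ler_wpM2l // lerDr.
have := @lerXn2r _ 2 (32 * p) q; rewrite !nnegrE mulr_ge0 // q0 => /(_ isT isT hp).
have := @lerXn2r _ 2 (32 * s) q; rewrite !nnegrE mulr_ge0 // q0 => /(_ isT isT hs).
rewrite !exprMn; have : 0 <= q ^+ 2 by rewrite exprn_ge0.
set x := p ^+ 2; set y := s ^+ 2; set z := q ^+ 2.
rewrite !expr2; lra.
Qed.

End Powers.

Section Tuning.
Context (R : realType) (N K : nat) (L d : R).
Hypotheses (N0 : (0 < N)%N) (L1 : 1 <= L) (d01 : 0 < d <= 1)
  (Kbig : N%:R ^+ 2 / d ^+ 6 <= K%:R).

(** In terms of the cube roots of N and K every power in the tuning is integral, within reach of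
    [field]. *)
Let u := (N%:R : R) `^ 3^-1.
Let v := cbrtK R K.
Let a := step_size N K L.

Let NR : 0 < (N%:R : R). Proof. by rewrite ltr0n. Qed.
Let L0 : 0 < L. Proof. exact: lt_le_trans L1. Qed.
Let d0 : 0 < d. Proof. by case/andP: d01. Qed.

Lemma tuning_K_gt0 : (0 < K)%N.
Proof.
rewrite -(ltr0n R); apply: lt_le_trans Kbig.
by rewrite divr_gt0 // exprn_gt0.
Qed.

Let u0 : 0 < u. Proof. exact: powR_gt0. Qed.
Let v0 : 0 < v. Proof. by apply: powR_gt0; rewrite ltr0n tuning_K_gt0. Qed.
Let u3 : u ^+ 3 = N%:R. Proof. exact: cbrt_exprK. Qed.
Let v3 : v ^+ 3 = K%:R. Proof. exact: cbrt_exprK. Qed.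

Lemma step_sizeE : a = u ^+ 2 / (64 * L * v).
Proof. by rewrite /a /step_size /step_alpha powR23 -/u -/v -mulrA -invfM. Qed.

Lemma step_size_gt0 : 0 < a.
Proof. by rewrite step_sizeE divr_gt0 ?exprn_gt0 // !mulr_gt0. Qed.

(** Here a L = u^2 / (64 v), and the cube of u^2 <= d^2 v is N^2 <= d^6 K, the assumed lower bound
    on K. *)
Lemma step_size_le : a * L <= d ^+ 2 / 64.
Proof.
have -> : a * L = u ^+ 2 / v / 64 by rewrite step_sizeE; field; rewrite !gt_eqF.
rewrite ler_pM2r ?invr_gt0 // ler_pdivrMr //; apply: cube_le.
  by rewrite mulr_ge0 ?exprn_ge0 // ltW.
have -> : (u ^+ 2) ^+ 3 = N%:R ^+ 2 by rewrite -u3 -!exprM mulnC.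
rewrite exprMn v3 -exprM mulrC -ler_pdivrMr ?exprn_gt0 //.
Qed.

Lemma momentumE : momentum N K L = 144 * (a * L) ^+ 2 / N%:R.
Proof.
rewrite /momentum powR23 -/(cbrtK R K) /a /step_size -/v.
by field; rewrite !gt_eqF.
Qed.

Lemma momentum_itv : 0 <= momentum N K L <= 1.
Proof.
rewrite momentumE; have aL0 : 0 <= a * L by rewrite mulr_ge0 // ltW // step_size_gt0.
apply/andP; split; first by apply: divr_ge0 => //; apply: mulr_ge0 => //; exact: exprn_ge0.
have N1 : 1 <= (N%:R : R) by rewrite ler1n.
rewrite ler_pdivrMr // mul1r; apply: le_trans N1.
have d2 : d ^+ 2 <= 1 by apply: exprn_ile1; [exact: ltW|case/andP: d01].
have h : a * L <= 64^-1 by apply: le_trans step_size_le _; rewrite ler_pdivrMr //; lra.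
rewrite expr2; nra.
Qed.

Lemma gamma2E : gamma2 N K L (1 - d) = 16 / (N%:R * d * a).
Proof.
rewrite /gamma2 -/v opprB addrC subrK /a /step_size -/v.
have al0 : 0 < step_alpha N L by rewrite divr_gt0 ?mulr_gt0 // powR_gt0.
by field; rewrite !gt_eqF.
Qed.

Lemma gamma3E : gamma3 N K L = (48 * N%:R * L ^+ 2 * a)^-1.
Proof.
rewrite /gamma3 /a /step_size -/v.
have al0 : 0 < step_alpha N L by rewrite divr_gt0 ?mulr_gt0 // powR_gt0.
by field; rewrite !gt_eqF.
Qed.

Lemma gamma4E : gamma4 N K L = N%:R / (48 * L ^+ 2 * a).
Proof.
rewrite /gamma4 /a /step_size -/v.
have al0 : 0 < step_alpha N L by rewrite divr_gt0 ?mulr_gt0 // powR_gt0.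
by field; rewrite !gt_eqF.
Qed.

(** The lower bound on K gives N <= K, so N K <= K^3, and rounding the cube root up cannot pass the
    integer K. The initial batch thus fits in the O(K) gradient budget. *)
Lemma init_batch_le : (init_batch R N K <= K)%N.
Proof.
rewrite -lez_nat /init_batch gez0_abs; last first.
  by rewrite ceil_ge0; apply: lt_le_trans (powR_ge0 _ _); rewrite ltrN10.
rewrite ceil_le_int -pmulrn; apply: cube_le; first exact: ler0n.
rewrite cbrt_exprK ?ler0n // natrM exprS ler_pM ?ler0n //; last first.
  by rewrite expr2 ler_peMl ?ler0n // ler1n tuning_K_gt0.
apply: le_trans Kbig; have d6 : 0 < d ^+ 6 by rewrite exprn_gt0.
rewrite ler_pdivlMr // expr2 ler_pM ?ler0n // ?(ltW d6) //.
have /andP[_ d1] := d01; have : d ^+ 6 <= 1 by rewrite expr_le1 // ltW.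
by move=> /le_trans; apply; rewrite ler1n.
Qed.

(** Only the first term of the maximum is kept. With p^2 = L Delta and e^2 = eps it reads 32^3 (p^3
    + s^3) <= (u v e)^3, and the goal is 512 p^2 + (189/32) s^2 <= (u v e)^2, where 512 = 8 x 64 and
    189/32 = 8 x 3024 / 64^2 < 6. *)
Lemma complexity_bound (C rhot Delta s eps : R) : 0 <= Delta -> 0 < s -> 0 < eps ->
  32 ^+ 3 <= C -> C * complexity N L rhot Delta s eps <= K%:R ->
  8 * Delta / (a * K%:R) + 8 * (3024 * a ^+ 2 * L ^+ 2 / N%:R ^+ 2 * s ^+ 2) <= eps.
Proof.
move=> D0 s0 e0 hC hK.
have LD : 0 <= L * Delta by rewrite mulr_ge0 // ltW.
set p := Num.sqrt (L * Delta); have p0 : 0 <= p by rewrite sqrtr_ge0.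
have p2 : p ^+ 2 = L * Delta by rewrite sqr_sqrtr.
set e := Num.sqrt eps; have ee : 0 < e by rewrite sqrtr_gt0.
have e2 : e ^+ 2 = eps by rewrite sqr_sqrtr // ltW.
pose t := (p ^+ 3 + s ^+ 3) / (N%:R * e ^+ 3).
have t0 : 0 <= t.
  by rewrite divr_ge0 ?addr_ge0 ?mulr_ge0 ?exprn_ge0 // ltW.
have tc : t <= complexity N L rhot Delta s eps.
  by rewrite /complexity !powR32 ?(ltW e0) ?(ltW s0) // -/p -/e le_max lexx.
have : 32 ^+ 3 * t <= K%:R.
  apply: le_trans hK; apply: ler_pM => //; exact: exprn_ge0.
rewrite /t mulrA ler_pdivrMr ?mulr_gt0 ?exprn_gt0 // => h.
have : 512 * p ^+ 2 + 6 * s ^+ 2 <= (u * v * e) ^+ 2.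
  apply: cube_sum_bound => //; [exact: ltW|by apply: ltW; rewrite !mulr_gt0|].
  apply: le_trans h _; rewrite -u3 -v3; apply: le_of_eq; ring.
have uv : 0 < (u * v) ^+ 2 by rewrite exprn_gt0 // mulr_gt0.
rewrite exprMn e2 p2 -ler_pdivrMl // => h2.
apply: le_trans h2; rewrite step_sizeE -u3 -v3.
have -> : 8 * Delta / (u ^+ 2 / (64 * L * v) * v ^+ 3) = (512 * (L * Delta)) / (u * v) ^+ 2.
  by field; rewrite !gt_eqF.
rewrite mulrDr [_^-1 * _]mulrC lerD2l.
have -> : 8 * (3024 * (u ^+ 2 / (64 * L * v)) ^+ 2 * L ^+ 2 / (u ^+ 3) ^+ 2 * s ^+ 2)
    = (189 / 32) * (s ^+ 2 / (u * v) ^+ 2).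
  by field; rewrite !gt_eqF.
rewrite [leRHS]mulrC -[leRHS]mulrA ler_wpM2r ?divr_ge0 ?sqr_ge0 //; lra.
Qed.

End Tuning.

(** * Counts of gradients and communications *)

Section Counts.
Context (R : realType) (N p : nat) (dX : measure_display) (Xi : measurableType dX)
  (dO : measure_display) (Om : measurableType dO) (P : probability Om R) (m0 m : nat)
  (F : 'I_N -> 'rV[R]_p -> Xi -> R) (r : 'rV[R]_p -> R) (W : 'M[R]_N) (T0 T : nat)
  (alpha beta : nat -> R) (X0 : 'M[R]_(N, p)) (xi0 : 'I_N -> 'I_m0 -> {RV P >-> Xi})
  (xi : nat -> 'I_N -> 'I_m -> {RV P >-> Xi}) (est : estimator N p Xi P m).

Let run := deepstorm F r W T0 T alpha beta X0 xi0 xi est.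

Lemma st_commsE w k : st_comms (run w k) = (T0 + T * k)%N.
Proof.
elim: k => [|k IH]; first by rewrite muln0 addn0.
by rewrite mulnS addnCA addnC -IH.
Qed.

(** A step evaluates its batch at two points, and a separate estimator adds at most m
    evaluations. *)
Lemma st_grads_le w k : (st_grads (run w k) <= m0 + 3 * m * k)%N.
Proof.
elim: k => [|k IH]; first by rewrite muln0 addn0.
have -> : st_grads (run w k.+1) = (st_grads (run w k) + (m + m + estimate_cost est))%N by [].
rewrite mulnS [(3 * m + _)%N]addnC [leqRHS]addnA leq_add //.
have -> : (3 * m = m + m + m)%N by rewrite !mulSn mul0n addn0 addnA.
by rewrite leq_add2l; case: est.
Qed.

End Counts.

(** The order of the quantifiers makes the O-constants uniform: C is fixed by [mmax], the meaning
    given to m = O(1), before the network and the problem. Costs are read at state K - 1 because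
    Z^(K-1) is the last possible output. *)
Theorem corollary1 (R : realType) (mmax : nat) :
  exists C : R, 0 < C /\
  forall (N p : nat) (E : rel 'I_N) (W : 'M[R]_N)
    (dX : measure_display) (Xi : measurableType dX)
    (D : 'I_N -> probability Xi R) (F : 'I_N -> 'rV[R]_p -> Xi -> R)
    (r : 'rV[R]_p -> R) (L sigma phistar : R)
    (dO : measure_display) (Om : measurableType dO) (P : probability Om R)
    (K T m : nat) (X0 : 'M[R]_(N, p)),
  let rho := mix_rho W in
  let rhot := mix_rho_tilde W T in
  let T0 := init_rounds rho rhot in
  let m0 := init_batch R N K in
  forall (xi0 : 'I_N -> 'I_m0 -> {RV P >-> Xi})
    (xi : nat -> 'I_N -> 'I_m -> {RV P >-> Xi})
    (est : estimator N p Xi P m) (tau : {RV P >-> nat})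
    (shat eps Delta : R),
  let run := deepstorm F r W T0 T (fun _ : nat => step_size N K L)
               (fun _ : nat => momentum N K L) X0 xi0 xi est in
  (0 < N)%N ->
  0 < eps ->
  1 <= L ->
  problem_assumptions D F r L sigma phistar ->
  mixing_matrix E W ->
  (1 <= T)%N ->
  (1 <= m <= mmax)%N ->
  (forall i j, row i X0 = row j X0) ->
  samples_law D xi0 xi K ->
  randomness_independent xi0 xi est K tau ->
  uniform_index K tau ->
  0 < shat ->
  estimator_assumptions D F r W T0 T (fun _ : nat => step_size N K L)
    (fun _ : nat => momentum N K L) X0 xi0 xi est K shat ->
  ('E_P[fun w : Om => lyapunov D F r (gamma1 N L rhot) (gamma2 N K L rhot)
          (gamma3 N K L) (gamma4 N K L) (run w 0%N)] - phistar%:E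
     = Delta%:E)%E ->
  N%:R ^+ 2 / (1 - rhot) ^+ 6 <= K%:R ->
  C * complexity N L rhot Delta shat eps <= K%:R ->
  [/\ stochastic_stationary D F r P L (step_size N K L) eps
        (fun w : Om => st_Z (run w (tau w))),
      forall w, (st_grads (run w K.-1))%:R <= C * K%:R &
      forall w, st_comms (run w K.-1) = (T0 + T * (K - 1))%N].
Proof.
(* 32^3 secures the accuracy; 1 + 3 mmax bounds the gradients per unit of K, with 1 for the initial
   batch and 3 mmax for each step. *)
pose C : R := 32 ^+ 3 + 1 + (3 * mmax)%:R.
have C32 : 32 ^+ 3 <= C by rewrite /C -addrA lerDl addr_ge0.
exists C; split; first by apply: lt_le_trans C32; rewrite exprn_gt0.
move=> N p E W dX Xi D F r L sigma phistar dO Om P K T m X0 rho rhot T0 m0.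
move=> xi0 xi est tau shat eps Delta run N0 eps0 L1 pb mixW T1 /andP[m1 mM] _.
move=> laws indep unif shat0 estP lyap Kbig CK.
have d01 : 0 < 1 - rhot <= 1.
  by rewrite subr_gt0 (mix_rho_tilde_lt1 N0 mixW T1) lerBlDr lerDl mix_rho_tilde_ge0.
have K0 := tuning_K_gt0 N0 d01 Kbig.
have a0 := step_size_gt0 N0 L1 d01 Kbig.
split; last 1 first.
- by move=> w; rewrite st_commsE subn1.
- split => //; have e2 := gamma2E N0 L1 d01 Kbig; rewrite opprB addrC subrK in e2.
  rewrite e2 (gamma3E N0 L1 d01 Kbig) (gamma4E N0 L1 d01 Kbig) in lyap.
  have [D0 /le_trans] := stationarity_bound N0 pb a0 (momentum_itv N0 L1 d01 Kbig) m1 laws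
    indep estP mixW T1 (step_size_le N0 L1 d01 Kbig) (momentumE L N0 d01 Kbig) K0 unif lyap.
  by apply; rewrite lee_fin; exact: (complexity_bound N0 L1 d01 Kbig D0 shat0 eps0 C32 CK).
move=> w; apply: (@le_trans _ _ ((1 + 3 * mmax) * K)%:R); last first.
  rewrite natrM ler_wpM2r // natrD /C -addrA lerDr; exact: exprn_ge0.
rewrite ler_nat; apply: leq_trans (st_grads_le _ _ _ _ _ _ _ _ _ _ _ _ _) _.
rewrite mulnDl mul1n leq_add ?(init_batch_le N0 d01 Kbig) //.
by rewrite leq_mul ?leq_pred // leq_mul2l.
Qed.
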